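(* Let $k\in\mathbb{R}$, let $v$ be a multiplier system of weight $k$ on $\mathrm{SL}(2,\mathbb{Z})$, let $R$ be an $n$-dimensional complex representation of $\mathrm{SL}(2,\mathbb{Z})$, and let $F=(f_1,\ldots,f_n)^{\mathrm{T}}\in\mathcal{M}^!(k,\mathrm{SL}(2,\mathbb{Z}),v,R)$. Suppose that each $f_i$ has a convergent $q$-expansion $f_i=q^{\lambda_i}\sum_{t=0}^{\infty}a_{it}q^{mt}$ with a common $m>0$ and $a_{i0}\neq 0$, and that $\lambda_1,\ldots,\lambda_n\in\mathbb{R}$ are pairwise distinct. Then: (1) $n(k+n-1)\ge 12(\lambda_1+\cdots+\lambda_n)$; (2) $f_1,\ldots,f_n$ are solutions to one MLDE of order $n$ and weight $k$; (3) the following are equivalent: (a) $n(k+n-1)=12(\lambda_1+\cdots+\lambda_n)$; (b) $f_1,\ldots,f_n$ are solutions to one monic MLDE of order $n$ and weight $k$.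
   Context: $\mathcal{H}$ is the upper half plane, $q=e^{2\pi i z}$, $q^{\alpha}=e^{2\pi i\alpha z}$, and $f'=\frac{1}{2\pi i}\frac{df}{dz}$. For $A=\begin{pmatrix}a&b\\c&d\end{pmatrix}\in\mathrm{SL}(2,\mathbb{Z})$ and a holomorphic $f$ on $\mathcal{H}$, $(f|_kA)(z)=(cz+d)^{-k}f(Az)$, powers computed with the principal argument in $(-\pi,\pi]$; for vectors the slash acts componentwise. A multiplier system of weight $k$ is the standard notion (a function $v$ on $\mathrm{SL}(2,\mathbb{Z})$ with $|v|=1$ compatible with the weight-$k$ slash action). $\mathcal{M}^!(k,\mathrm{SL}(2,\mathbb{Z}),v,R)$ is the set of $F\in\mathrm{Hol}(\mathcal{H})^n$ with $F|_kB=v(B)R(B)F$ for all $B\in\mathrm{SL}(2,\mathbb{Z})$ and such that for every $A\in\mathrm{SL}(2,\mathbb{Z})$ each component of $F|_kA$ has at most exponential growth at infinity (there exist $C,M>0$ with $|g(z)|<e^{C\,\mathrm{Im}(z)}$ for $\mathrm{Im}(z)>M$). $E_2,E_4,E_6$ are the Eisenstein series normalized to have constant term $1$; $\mathcal{M}_w$ denotes the space of holomorphic modular forms of weight $w$ on $\mathrm{SL}(2,\mathbb{Z})$ with trivial multiplier. For $k\in\mathbb{R}$, $D_kf=f'-\frac{k}{12}E_2f$, $D_k^{(0)}=\mathrm{id}$, $D_k^{(j)}=D_{k+2j-2}\circ\cdots\circ D_{k+2}\circ D_k$. An MLDE of weight $k$ and order $n$ is an equation $(g_0D_k^{(n)}+g_1D_k^{(n-1)}+\cdots+g_{n-1}D_k+g_n)f=0$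 with $g_i\in\mathcal{M}_{l+2i}$ for some integer $l\ge0$ and $g_0\neq0$; it is monic if $l=0$ and $g_0=1$. *)

(* Defs.v *)
From Stdlib Require Import Reals ZArith Lia List.
From Coquelicot Require Import Coquelicot.
Open Scope R_scope.

Definition Cexp (z : C) : C :=
  (exp (Re z) * cos (Im z), exp (Re z) * sin (Im z)).

(* principal argument, with values in (-PI, PI] (arg 0 := 0, irrelevant) *)
Definition Carg (w : C) : R :=
  let x := Re w in let y := Im w in
  if Rlt_dec 0 x then atan (y / x)
  else if Rlt_dec x 0 then
    (if Rle_dec 0 y then atan (y / x) + PI else atan (y / x) - PI)
  else if Rlt_dec 0 y then PI / 2
  else if Rlt_dec y 0 then - (PI / 2)
  else 0.

(* principal power w^s = exp(s Log w), s real; (0^s := 0, never used on H) *)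
Definition cpow (w : C) (s : R) : C :=
  if Ceq_dec w (RtoC 0) then RtoC 0
  else Cmult (RtoC (Rpower (Cmod w) s)) (Cexp (0, s * Carg w)).

Definition qpow (alpha : R) (z : C) : C :=
  Cexp (Cmult (Cmult (RtoC (2 * PI * alpha)) Ci) z).

Definition upper (z : C) : Prop := 0 < Im z.

Definition holo_H (f : C -> C) : Prop :=
  forall z, upper z -> @ex_derive C_AbsRing C_NormedModule f z.

Definition sumR (n : nat) (f : nat -> R) : R :=
  fold_right Rplus 0 (map f (seq 0 n)).
Definition sumC (n : nat) (f : nat -> C) : C :=
  fold_right Cplus (RtoC 0) (map f (seq 0 n)).

Record SL2 := mkSL2 { sa : Z; sb : Z; sc : Z; sd : Z;
                      sdet : (sa * sd - sb * sc)%Z = 1%Z }.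

Lemma SL2mul_det (A B : SL2) :
  ((sa A * sa B + sb A * sc B) * (sc A * sb B + sd A * sd B)
   - (sa A * sb B + sb A * sd B) * (sc A * sa B + sd A * sc B))%Z = 1%Z.
Proof.
  destruct A as [a b c d hA], B as [a' b' c' d' hB]; simpl.
  replace ((a * a' + b * c') * (c * b' + d * d') - (a * b' + b * d') * (c * a' + d * c'))%Z
    with ((a * d - b * c) * (a' * d' - b' * c'))%Z by ring.
  rewrite hA, hB; reflexivity.
Qed.

Definition SL2mul (A B : SL2) : SL2 :=
  mkSL2 (sa A * sa B + sb A * sc B)%Z (sa A * sb B + sb A * sd B)%Z
        (sc A * sa B + sd A * sc B)%Z (sc A * sb B + sd A * sd B)%Z
        (SL2mul_det A B).

Definition SL2one : SL2 := mkSL2 1 0 0 1 eq_refl.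

Definition jfac (A : SL2) (z : C) : C :=
  Cplus (Cmult (RtoC (IZR (sc A))) z) (RtoC (IZR (sd A))).
Definition mob (A : SL2) (z : C) : C :=
  Cdiv (Cplus (Cmult (RtoC (IZR (sa A))) z) (RtoC (IZR (sb A)))) (jfac A z).

Definition slash (k : R) (f : C -> C) (A : SL2) (z : C) : C :=
  Cmult (cpow (jfac A z) (- k)) (f (mob A z)).

Definition multiplier_system (k : R) (v : SL2 -> C) : Prop :=
  (forall A, Cmod (v A) = 1) /\
  (forall A B z, upper z ->
     Cmult (v (SL2mul A B)) (cpow (jfac (SL2mul A B) z) k) =
     Cmult (Cmult (v A) (v B))
           (Cmult (cpow (jfac A (mob B z)) k) (cpow (jfac B z) k))).

Definition representation (n : nat) (Rep : SL2 -> nat -> nat -> C) : Prop :=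
  (forall i j, (i < n)%nat -> (j < n)%nat ->
     Rep SL2one i j = if Nat.eq_dec i j then RtoC 1 else RtoC 0) /\
  (forall A B i j, (i < n)%nat -> (j < n)%nat ->
     Rep (SL2mul A B) i j = sumC n (fun l => Cmult (Rep A i l) (Rep B l j))).

Definition exp_growth (g : C -> C) : Prop :=
  exists Cc M, 0 < Cc /\ 0 < M /\
    forall z, M < Im z -> Cmod (g z) < exp (Cc * Im z).

Definition weakly_holo_vvmf (k : R) (v : SL2 -> C) (n : nat)
    (Rep : SL2 -> nat -> nat -> C) (F : nat -> C -> C) : Prop :=
  (forall i, (i < n)%nat -> holo_H (F i)) /\
  (forall B i z, (i < n)%nat -> upper z ->
     slash k (F i) B z = Cmult (v B) (sumC n (fun j => Cmult (Rep B i j) (F j z)))) /\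
  (forall A i, (i < n)%nat -> exp_growth (slash k (F i) A)).

Definition modular_form (w : nat) (g : C -> C) : Prop :=
  holo_H g /\
  (forall A z, upper z -> g (mob A z) = Cmult (Cpow (jfac A z) w) (g z)) /\
  (exists Bd M, forall z, M < Im z -> Cmod (g z) <= Bd).

Definition sigma1 (n : nat) : nat :=
  fold_right Nat.add 0%nat
    (map (fun d => if Nat.eqb (n mod d) 0 then d else 0%nat) (seq 1 n)).

Definition E2_term (z : C) (n : nat) : C :=
  Cmult (RtoC (INR (sigma1 n))) (qpow (INR n) z).

(* E2 = 1 - 24 sum_{n>=1} sigma_1(n) q^n (sigma1 0 = 0) *)
Definition E2 (z : C) : C :=
  Cminus (RtoC 1)
    (Cmult (RtoC 24) (Series (fun n => Re (E2_term z n)),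
                      Series (fun n => Im (E2_term z n)))).

Definition qderiv (f : C -> C) (z : C) : C :=
  Cdiv (C_derive f z) (Cmult (RtoC (2 * PI)) Ci).

Definition Dk (k : R) (f : C -> C) (z : C) : C :=
  Cminus (qderiv f z) (Cmult (RtoC (k / 12)) (Cmult (E2 z) (f z))).

Fixpoint Dk_iter (k : R) (j : nat) (f : C -> C) : C -> C :=
  match j with
  | O => f
  | S j' => Dk (k + 2 * INR j') (Dk_iter k j' f)
  end.

Definition is_MLDE (n l : nat) (g : nat -> C -> C) : Prop :=
  (forall i, (i <= n)%nat -> modular_form (l + 2 * i) (g i)) /\
  (exists z, upper z /\ g 0%nat z <> RtoC 0).

Definition is_monic_MLDE (n : nat) (g : nat -> C -> C) : Prop :=
  is_MLDE n 0 g /\ (forall z, upper z -> g 0%nat z = RtoC 1).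

Definition solves_MLDE (k : R) (n : nat) (g : nat -> C -> C) (f : C -> C) : Prop :=
  forall z, upper z ->
    sumC (S n) (fun j => Cmult (g j z) (Dk_iter k (n - j) f z)) = RtoC 0.

(* Main.v *)
(** Dividing the Wronskian of [F] by [Delta^L], with [L] the sum of the exponents [lambda_i],
    gives a function [h] on the upper half plane with a finite nonzero limit at the cusp
    (a Vandermonde determinant in the [lambda_i]). The limit makes its multiplier at [T] trivial,
    and then [S^2 = -1] and [(ST)^3 = -1] force [h] to be a classical modular form of even
    weight [s = n(k+n-1) - 12 L]. The other minors of the matrix [D^j f_i] divided by [Delta^L]
    are modular forms of weights [s + 2i], and they are the coefficients of an equation solved
    by [F]. In place of the valence formula, the only global input is that a form of negative
    weight that is bounded at the cusp vanishes: [|h|^2 y^s] would have an interior maximum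
    although its logarithm is strictly subharmonic. Hence [s >= 0]; for [s = 0] the same
    principle applied to [(h - h(oo)) Delta^(-eps)] shows that [h] is constant, so the equation can
    be made monic; conversely a monic equation has a nowhere vanishing Wronskian, and the
    principle applied to [1/h] gives [s <= 0].

    The quasi-modularity of [E2] is derived from the partial fractions of the cotangent by
    summing the weight-2 lattice sum in both orders. The value of [zeta(2)] is not needed: the constant
    term of [E2] is recovered from [(ST)^3 = -1] acting on the logarithm of [Delta]. *)
From HB Require Import structures.
From mathcomp Require boot.all_boot fingroup.perm algebra.all_algebra classical.boolp.
Require Import Defs.
From Stdlib Require Import Reals ZArith Lia Lra List Classical.
From Coquelicot Require Import Coquelicot.
Open Scope R_scope.
Set Bullet Behavior "Strict Subproofs".

(** * Complex differentiation *)

(** No contour integral occurs: holomorphic functions are handled by real calculus along lines and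
    by term-by-term differentiation of q-series. The maximum principle is stated for moduli alone,
    so that real weights, unitary multipliers, twists by powers of Delta and reciprocals all fall
    under one lemma.

    The exponents are arbitrary reals, so Delta^L must be a definite function: it is the exponential
    of L times [logDelta], a primitive of 2 PI i E2. Likewise z^s is [Cexp (s * Clog z)], and
    questions about multipliers become questions about branches of the logarithm on the upper half
    plane.

    Serre derivatives are the right entries of the Wronskian because the anomaly 6z/(PI i) of E2
    under inversion cancels the derivative of z^k. The obstacle in proving this anomaly is that the
    weight-2 lattice sum converges only conditionally. Subtracting 1/(u^2 - 1/4), which telescopes
    in n, makes the sum absolutely convergent; the subtracted part then contributes nothing in one
    order of summation and the term PI i/z in the other. *)

Ltac split_min H A B :=
  pose proof (Rlt_le_trans _ _ _ H (Rmin_l _ _)) as A;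
  pose proof (Rlt_le_trans _ _ _ H (Rmin_r _ _)) as B.

Lemma Cmod_minus_sym (a b : C) : Cmod (a - b) = Cmod (b - a).
Proof. rewrite <- (Cmod_opp (a - b)). f_equal. ring. Qed.

Lemma Cmod_sub_triangle (a b : C) : Cmod (a - b) <= Cmod a + Cmod b.
Proof.
  unfold Cminus. eapply Rle_trans; [apply Cmod_triangle|]. rewrite Cmod_opp. lra.
Qed.

Lemma Cmod_le_add (a b : C) : Cmod a <= Cmod (a - b) + Cmod b.
Proof.
  replace a with ((a - b) + b)%C at 1 by ring. apply Cmod_triangle.
Qed.

Lemma Im_le_Cmod (c : C) : Rabs (Im c) <= Cmod c.
Proof.
  eapply Rle_trans; [|apply Rmax_Cmod]. apply Rmax_r.
Qed.

Lemma Cmod_le_Re_Im (c : C) : Cmod c <= Rabs (Re c) + Rabs (Im c).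
Proof.
  destruct c as [x y]; simpl.
  replace (x, y) with (RtoC x + Ci * RtoC y)%C
    by (unfold RtoC, Ci, Cplus, Cmult; simpl; f_equal; ring).
  eapply Rle_trans; [apply Cmod_triangle|].
  rewrite Cmod_mult, Cmod_Ci, !Cmod_R. lra.
Qed.

Lemma Cmod_sqr (c : C) : Cmod c ^ 2 = Re c * Re c + Im c * Im c.
Proof. rewrite Cmod2_alt. ring. Qed.

Lemma C_eq (a b : C) : Re a = Re b -> Im a = Im b -> a = b.
Proof. destruct a, b; simpl; intros; subst; reflexivity. Qed.

Lemma Cexp_add (a b : C) : Cexp (a + b) = (Cexp a * Cexp b)%C.
Proof.
  destruct a as [x y], b as [x' y']; unfold Cexp, Cmult, Cplus; simpl.
  rewrite exp_plus, cos_plus, sin_plus. f_equal; ring.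
Qed.

Lemma Cexp_0 : Cexp 0 = 1.
Proof.
  unfold Cexp, RtoC; simpl. rewrite exp_0, cos_0, sin_0. f_equal; ring.
Qed.

Lemma Cexp_neq_0 (z : C) : Cexp z <> 0.
Proof.
  intro H. pose proof (Cexp_add z (- z)) as E.
  rewrite H in E. replace (z + - z)%C with (RtoC 0) in E by ring.
  rewrite Cexp_0, Cmult_0_l in E. apply RtoC_inj in E. lra.
Qed.

Lemma Cexp_opp (z : C) : Cexp (- z) = (/ Cexp z)%C.
Proof.
  pose proof (Cexp_neq_0 z) as N.
  assert (E : (Cexp z * Cexp (- z))%C = 1).
  { rewrite <- Cexp_add. replace (z + - z)%C with (RtoC 0) by ring. apply Cexp_0. }
  replace (Cexp (- z)) with (/ Cexp z * (Cexp z * Cexp (- z)))%C by (field; auto).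
  rewrite E. ring.
Qed.

Lemma Cmod_Cexp (z : C) : Cmod (Cexp z) = exp (Re z).
Proof.
  unfold Cmod, Cexp; simpl.
  replace (_ + _) with (exp (Re z) * exp (Re z) * ((Rsqr (sin (Im z))) + Rsqr (cos (Im z))))
    by (unfold Rsqr, Re, Im; ring).
  rewrite sin2_cos2, Rmult_1_r. apply sqrt_square. left; apply exp_pos.
Qed.

Lemma exp_sub1_abs (x : R) : Rabs (exp x - 1) <= Rabs x * exp (Rabs x).
Proof.
  pose proof (exp_ineq1_le x) as H1. pose proof (exp_ineq1_le (- x)) as H2.
  pose proof (exp_pos x) as H3.
  assert (H4 : exp x - 1 <= x * exp x).
  { assert (E : exp (- x) * exp x = 1) by (rewrite <- exp_plus, Rplus_opp_l, exp_0; auto).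
    nra. }
  unfold Rabs at 1. destruct (Rcase_abs (exp x - 1)).
  - assert (x < 0).
    { destruct (Rlt_dec x 0); auto. assert (1 + x <= exp x) by auto. lra. }
    rewrite Rabs_left by lra. pose proof (exp_ineq1_le (- x)). nra.
  - assert (0 <= x).
    { destruct (Rle_dec 0 x); auto.
      assert (exp x < exp 0) by (apply exp_increasing; lra). rewrite exp_0 in *. lra. }
    rewrite !Rabs_pos_eq by lra. lra.
Qed.

Lemma exp_sub1_sub_abs (x : R) : Rabs (exp x - 1 - x) <= Rabs x * Rabs x * exp (Rabs x).
Proof.
  pose proof (exp_ineq1_le x) as H1. pose proof (exp_ineq1_le (- x)) as H2.
  pose proof (exp_pos x) as H3.
  assert (E : exp (- x) * exp x = 1) by (rewrite <- exp_plus, Rplus_opp_l, exp_0; auto).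
  assert (H4 : exp x - 1 - x <= x * (exp x - 1)) by nra.
  rewrite Rabs_pos_eq by lra.
  eapply Rle_trans; [apply H4|]. eapply Rle_trans; [apply Rle_abs|].
  rewrite Rabs_mult, Rmult_assoc. apply Rmult_le_compat_l; [apply Rabs_pos|].
  apply exp_sub1_abs.
Qed.

Lemma sin_abs_le (y : R) : Rabs (sin y) <= Rabs y.
Proof.
  destruct (MVT_gen sin 0 y cos) as [c [_ Hc]].
  - intros. apply is_derive_sin.
  - intros. apply continuity_sin.
  - rewrite sin_0, !Rminus_0_r in Hc. rewrite Hc, Rabs_mult.
    pose proof (COS_bound c). pose proof (Rabs_pos y).
    assert (Rabs (cos c) <= 1) by (apply Rabs_le; lra). nra.
Qed.

Lemma cos_sub1 (y : R) : 1 - cos y = 2 * (sin (y / 2) * sin (y / 2)).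
Proof.
  replace y with (2 * (y / 2)) at 1 by field. rewrite cos_2a_sin. ring.
Qed.

Lemma cos_sub1_abs (y : R) : Rabs (cos y - 1) <= Rabs y.
Proof.
  rewrite Rabs_minus_sym, cos_sub1, Rabs_mult, Rabs_mult.
  rewrite (Rabs_pos_eq 2) by lra.
  pose proof (sin_abs_le (y / 2)) as H. unfold Rdiv in H at 2.
  rewrite Rabs_mult, (Rabs_pos_eq (/ 2)) in H by lra.
  assert (Rabs (sin (y / 2)) <= 1) by (apply Rabs_le; pose proof (SIN_bound (y / 2)); lra).
  pose proof (Rabs_pos (sin (y / 2))). nra.
Qed.

Lemma cos_sub1_sqr (y : R) : Rabs (cos y - 1) <= Rabs y * Rabs y.
Proof.
  rewrite Rabs_minus_sym, cos_sub1, Rabs_mult, Rabs_mult.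
  rewrite (Rabs_pos_eq 2) by lra.
  pose proof (sin_abs_le (y / 2)) as H. unfold Rdiv in H at 2.
  rewrite Rabs_mult, (Rabs_pos_eq (/ 2)) in H by lra.
  pose proof (Rabs_pos (sin (y / 2))). pose proof (Rabs_pos y). nra.
Qed.

Lemma sin_sub_sqr (y : R) : Rabs (sin y - y) <= Rabs y * Rabs y.
Proof.
  destruct (MVT_gen (fun t => sin t - t) 0 y (fun t => cos t - 1)) as [c [Hc1 Hc]].
  - intros. auto_derive; auto. ring.
  - intros. apply continuity_pt_minus; [apply continuity_sin | apply continuity_pt_id].
  - rewrite sin_0, !Rminus_0_r in Hc. rewrite Hc, Rabs_mult.
    apply Rmult_le_compat_r; [apply Rabs_pos|].
    eapply Rle_trans; [apply cos_sub1_abs|].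
    unfold Rmin, Rmax in Hc1. destruct (Rle_dec 0 y).
    + rewrite !Rabs_pos_eq; lra.
    + rewrite !Rabs_left1; lra.
Qed.

(** An explicit quadratic remainder, and not just the derivative at 0, because term-by-term
    differentiation of q-series needs remainders that can be summed. *)
Lemma Cexp_taylor1 (h : C) :
  Cmod (Cexp h - 1 - h) <= 4 * (Cmod h * Cmod h) * exp (Cmod h).
Proof.
  destruct h as [x y]. set (h := (x, y)).
  pose proof (re_le_Cmod h) as Hx. pose proof (Im_le_Cmod h) as Hy. simpl in Hx, Hy.
  assert (HE : exp (Rabs x) <= exp (Cmod h)).
  { destruct Hx as [Hx|Hx]; [left; apply exp_increasing; auto | rewrite Hx; lra]. }
  assert (H1E : 1 <= exp (Cmod h)).
  { pose proof (exp_ineq1_le (Cmod h)). pose proof (Cmod_ge_0 h). lra. }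
  assert (Ex : exp x <= exp (Cmod h)).
  { eapply Rle_trans; [|apply HE]. destruct (Rle_abs x) as [H|H].
    - left; apply exp_increasing; auto.
    - rewrite <- H; lra. }
  set (E := exp (Cmod h)) in *. set (r := Cmod h) in *.
  pose proof (Rabs_pos x). pose proof (Rabs_pos y).
  eapply Rle_trans; [apply Cmod_le_Re_Im|]. simpl.
  assert (A : Rabs (exp x * cos y + - (1) + - x) <= 2 * (r * r) * E).
  { replace (exp x * cos y + - (1) + - x)
      with ((exp x - 1 - x) + exp x * (cos y - 1)) by ring.
    eapply Rle_trans; [apply Rabs_triang|].
    rewrite Rabs_mult, (Rabs_pos_eq (exp x)) by (left; apply exp_pos).
    pose proof (exp_sub1_sub_abs x). pose proof (cos_sub1_sqr y).
    assert (Rabs x * Rabs x * exp (Rabs x) <= r * r * E).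
    { apply Rmult_le_compat; try nra. left; apply exp_pos. }
    assert (exp x * Rabs (cos y - 1) <= E * (r * r)).
    { apply Rmult_le_compat; try nra. left; apply exp_pos. apply Rabs_pos. }
    lra. }
  assert (B : Rabs (exp x * sin y + - 0 + - y) <= 2 * (r * r) * E).
  { replace (exp x * sin y + - 0 + - y)
      with ((exp x - 1) * sin y + (sin y - y)) by ring.
    eapply Rle_trans; [apply Rabs_triang|]. rewrite Rabs_mult.
    pose proof (exp_sub1_abs x). pose proof (sin_sub_sqr y). pose proof (sin_abs_le y).
    assert (Rabs (exp x - 1) * Rabs (sin y) <= (r * E) * r).
    { apply Rmult_le_compat; try apply Rabs_pos; try lra.
      eapply Rle_trans; [eassumption|]. apply Rmult_le_compat; try lra.
      left; apply exp_pos. }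
    assert (Rabs y * Rabs y <= r * r) by nra.
    assert (0 <= r * r * (E - 1)) by (apply Rmult_le_pos; nra).
    nra. }
  unfold Rminus in *. lra.
Qed.

(** The increment inequality without a quotient, so that [w = z] needs no exception. It is the
    working form of [is_derive], which exists on C for two normed module structures. *)
Definition Cdrv (f : C -> C) (z d : C) : Prop :=
  forall eps : R, 0 < eps -> exists delta, 0 < delta /\
    forall w, Cmod (w - z) < delta ->
      Cmod (f w - f z - (w - z) * d) <= eps * Cmod (w - z).

Lemma Cdrv_is_derive (f : C -> C) (z d : C) :
  Cdrv f z d -> @is_derive C_AbsRing C_NormedModule f z d.
Proof.
  intros H. split.
  - apply is_linear_scal_l.
  - intros x Hx. apply (@is_filter_lim_locally_unique C_AbsRing (AbsRing_NormedModule C_AbsRing)) in Hx. subst x.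
    intros eps. destruct (H eps (cond_pos eps)) as [delta [Hd Hw]].
    exists (mkposreal _ Hd). intros w Hb. apply (Hw w Hb).
Qed.

Lemma is_derive_Cdrv (f : C -> C) (z d : C) :
  @is_derive C_AbsRing C_NormedModule f z d -> Cdrv f z d.
Proof.
  intros [_ H] eps Heps.
  assert (L : is_filter_lim (locally (T := AbsRing_NormedModule C_AbsRing) z) z)
    by (intros P HP; exact HP).
  destruct (H z L (mkposreal _ Heps)) as [delta Hd].
  exists delta. split; [apply cond_pos|]. intros w Hw. exact (Hd w Hw).
Qed.

(** The general differentiation rules are applied over [AbsRing_NormedModule C_AbsRing], whereas
    [holo_H] uses [C_NormedModule]; [Cdrv] connects the two. *)
Lemma Cdrv_is_derive_abs (f : C -> C) (z d : C) :
  Cdrv f z d <-> @is_derive C_AbsRing (AbsRing_NormedModule C_AbsRing) f z d.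
Proof.
  split; [intros H|intros [_ H]; apply is_derive_Cdrv];
    [destruct (Cdrv_is_derive _ _ _ H) as [_ H']|]; split; try apply is_linear_scal_l; auto.
Qed.

Lemma Cdrv_C_derive (f : C -> C) (z d : C) : Cdrv f z d -> C_derive f z = d.
Proof. intros H. apply is_C_derive_unique. apply Cdrv_is_derive, H. Qed.

Lemma Cdrv_unique (f : C -> C) (z d d' : C) : Cdrv f z d -> Cdrv f z d' -> d = d'.
Proof.
  intros H H'. apply Cdrv_C_derive in H. apply Cdrv_C_derive in H'. congruence.
Qed.

Lemma Cdrv_ext_loc (f g : C -> C) (z d : C) (r : R) :
  0 < r -> (forall w, Cmod (w - z) < r -> f w = g w) -> Cdrv f z d -> Cdrv g z d.
Proof.
  intros Hr E H eps Heps. destruct (H eps Heps) as [delta [Hd Hw]].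
  exists (Rmin delta r). split; [apply Rmin_pos; auto|]. intros w Hwr.
  rewrite <- !E.
  - apply Hw. eapply Rlt_le_trans; [apply Hwr|apply Rmin_l].
  - replace (z - z)%C with (RtoC 0) by ring. rewrite Cmod_0; auto.
  - eapply Rlt_le_trans; [apply Hwr|apply Rmin_r].
Qed.

Lemma Cdrv_ext (f g : C -> C) (z d : C) :
  (forall w, f w = g w) -> Cdrv f z d -> Cdrv g z d.
Proof. intros E. apply (Cdrv_ext_loc f g z d 1); auto. lra. Qed.

Lemma Cdrv_val (f : C -> C) (z d d' : C) : Cdrv f z d -> d = d' -> Cdrv f z d'.
Proof. intros H E; subst; auto. Qed.

Lemma Cdrv_const (c z : C) : Cdrv (fun _ => c) z 0.
Proof.
  intros eps Heps. exists 1. split; [lra|]. intros w _.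
  replace (c - c - (w - z) * 0)%C with (RtoC 0) by ring. rewrite Cmod_0.
  apply Rmult_le_pos; [lra|apply Cmod_ge_0].
Qed.

Lemma Cdrv_id (z : C) : Cdrv (fun w => w) z 1.
Proof.
  intros eps Heps. exists 1. split; [lra|]. intros w _.
  replace (w - z - (w - z) * 1)%C with (RtoC 0) by ring. rewrite Cmod_0.
  apply Rmult_le_pos; [lra|apply Cmod_ge_0].
Qed.

Lemma Cdrv_plus (f g : C -> C) (z d e : C) :
  Cdrv f z d -> Cdrv g z e -> Cdrv (fun w => f w + g w)%C z (d + e).
Proof.
  intros Hf Hg. apply Cdrv_is_derive_abs.
  exact (is_derive_plus (V := AbsRing_NormedModule C_AbsRing) f g z d e
    (proj1 (Cdrv_is_derive_abs _ _ _) Hf) (proj1 (Cdrv_is_derive_abs _ _ _) Hg)).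
Qed.

Lemma Cdrv_lip (f : C -> C) (z d : C) : Cdrv f z d ->
  exists delta, 0 < delta /\ forall w, Cmod (w - z) < delta ->
    Cmod (f w - f z) <= (Cmod d + 1) * Cmod (w - z).
Proof.
  intros H. destruct (H 1 Rlt_0_1) as [delta [Hd Hw]]. exists delta. split; auto.
  intros w Hwz. specialize (Hw w Hwz).
  pose proof (Cmod_le_add (f w - f z) ((w - z) * d)) as T.
  rewrite Cmod_mult in T. lra.
Qed.

Lemma Cdrv_continuous (f : C -> C) (z d : C) : Cdrv f z d ->
  forall eps, 0 < eps -> exists delta, 0 < delta /\
    forall w, Cmod (w - z) < delta -> Cmod (f w - f z) < eps.
Proof.
  intros H eps Heps. destruct (Cdrv_lip f z d H) as [delta [Hd Hw]].
  pose proof (Cmod_ge_0 d) as Hcd.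
  exists (Rmin delta (eps / (Cmod d + 2))). split.
  { apply Rmin_pos; auto. apply Rdiv_lt_0_compat; lra. }
  intros w Hwz.
  split_min Hwz A B.
  specialize (Hw w A). apply Rlt_div_r in B; [|lra].
  pose proof (Cmod_ge_0 (w - z)). nra.
Qed.

Lemma Cdrv_mult (f g : C -> C) (z d e : C) :
  Cdrv f z d -> Cdrv g z e -> Cdrv (fun w => f w * g w)%C z (d * g z + f z * e).
Proof.
  intros Hf Hg. apply Cdrv_is_derive_abs.
  exact (is_derive_mult f g z d e
    (proj1 (Cdrv_is_derive_abs _ _ _) Hf) (proj1 (Cdrv_is_derive_abs _ _ _) Hg) Cmult_comm).
Qed.

Lemma Cdrv_scal (c : C) (f : C -> C) (z d : C) :
  Cdrv f z d -> Cdrv (fun w => c * f w)%C z (c * d).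
Proof.
  intros H. eapply Cdrv_val; [apply (Cdrv_mult (fun _ => c) f z 0 d); auto|].
  - apply Cdrv_const.
  - ring.
Qed.

Lemma Cdrv_opp (f : C -> C) (z d : C) : Cdrv f z d -> Cdrv (fun w => - f w)%C z (- d).
Proof.
  intros H. eapply Cdrv_val; [eapply Cdrv_ext; [|apply (Cdrv_scal (- (1)) f z d H)]|].
  - intros w; simpl. ring.
  - ring.
Qed.

Lemma Cdrv_minus (f g : C -> C) (z d e : C) :
  Cdrv f z d -> Cdrv g z e -> Cdrv (fun w => f w - g w)%C z (d - e).
Proof. intros Hf Hg. apply Cdrv_plus; auto. apply Cdrv_opp; auto. Qed.

Lemma Cdrv_comp (f g : C -> C) (z d e : C) :
  Cdrv g z e -> Cdrv f (g z) d -> Cdrv (fun w => f (g w)) z (e * d).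
Proof.
  intros Hg Hf. apply Cdrv_is_derive_abs.
  exact (is_derive_comp (V := AbsRing_NormedModule C_AbsRing) f g z d e
    (proj1 (Cdrv_is_derive_abs _ _ _) Hf) (proj1 (Cdrv_is_derive_abs _ _ _) Hg)).
Qed.

Lemma Cdrv_Cexp (z : C) : Cdrv Cexp z (Cexp z).
Proof.
  intros eps Heps.
  set (M := 4 * exp 1 * Cmod (Cexp z)).
  assert (HM : 0 < M).
  { unfold M. rewrite Cmod_Cexp. pose proof (exp_pos 1). pose proof (exp_pos (Re z)).
    repeat apply Rmult_lt_0_compat; lra. }
  exists (Rmin 1 (eps / M)). split; [apply Rmin_pos; [lra|apply Rdiv_lt_0_compat; lra]|].
  intros w Hw.
  split_min Hw W1 W2.
  replace (Cexp w) with (Cexp z * Cexp (w - z))%C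
    by (rewrite <- Cexp_add; f_equal; ring).
  replace (Cexp z * Cexp (w - z) - Cexp z - (w - z) * Cexp z)%C
    with (Cexp z * (Cexp (w - z) - 1 - (w - z)))%C by ring.
  rewrite Cmod_mult. pose proof (Cexp_taylor1 (w - z)) as T.
  set (r := Cmod (w - z)) in *. assert (Hr : 0 <= r) by apply Cmod_ge_0.
  assert (Er : exp r <= exp 1) by (left; apply exp_increasing; auto).
  eapply Rle_trans; [apply Rmult_le_compat_l; [apply Cmod_ge_0|apply T]|].
  assert (A : 4 * (r * r) * exp r <= 4 * (r * r) * exp 1)
    by (apply Rmult_le_compat_l; nra).
  apply Rlt_div_r in W2; [|lra].
  eapply Rle_trans; [apply Rmult_le_compat_l; [apply Cmod_ge_0|apply A]|].
  replace (Cmod (Cexp z) * (4 * (r * r) * exp 1)) with (r * M * r) by (unfold M; ring).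
  apply Rmult_le_compat_r; auto. lra.
Qed.

Lemma Cdrv_inv_id (z : C) : z <> 0 -> Cdrv Cinv z (- / (z * z)).
Proof.
  intros Hz eps Heps. pose proof (proj1 (Cmod_gt_0 z) Hz) as Hm.
  set (m := Cmod z) in *.
  exists (Rmin (m / 2) (eps * (m * m * m) / 2)). split.
  { apply Rmin_pos; [lra|]. apply Rdiv_lt_0_compat; [|lra].
    repeat apply Rmult_lt_0_compat; auto. }
  intros w Hw.
  split_min Hw W1 W2.
  assert (Hwm : m / 2 < Cmod w).
  { pose proof (Cmod_le_add z w) as T. rewrite Cmod_minus_sym in T. fold m in T. lra. }
  assert (Hw0 : w <> 0) by (intro E; rewrite E, Cmod_0 in Hwm; lra).
  replace (/ w - / z - (w - z) * - / (z * z))%C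
    with ((w - z) * (w - z) * / (w * z * z))%C by (field; auto).
  assert (Hwzz : (w * z * z)%C <> 0) by (repeat apply Cmult_neq_0; auto).
  rewrite !Cmod_mult, Cmod_inv by auto. rewrite !Cmod_mult. fold m.
  set (r := Cmod (w - z)) in *. assert (Hr : 0 <= r) by apply Cmod_ge_0.
  set (x := Cmod w) in *.
  assert (Hx : 0 < x * m * m) by (repeat apply Rmult_lt_0_compat; lra).
  rewrite (Rmult_assoc r), Rmult_comm. apply Rmult_le_compat_r; auto.
  apply (Rmult_le_reg_r (x * m * m)); auto.
  rewrite Rmult_assoc, Rinv_l, Rmult_1_r by lra.
  assert (eps * (m * m * m) / 2 <= eps * (x * m * m)).
  { replace (eps * (m * m * m) / 2) with (eps * (m / 2 * (m * m))) by field.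
    rewrite (Rmult_assoc x). apply Rmult_le_compat_l; [lra|]. apply Rmult_le_compat_r; nra. }
  lra.
Qed.

Lemma Cdrv_inv (f : C -> C) (z d : C) :
  f z <> 0 -> Cdrv f z d -> Cdrv (fun w => / f w)%C z (- d / (f z * f z)).
Proof.
  intros Hz H. eapply Cdrv_val; [apply (Cdrv_comp Cinv f z _ d H (Cdrv_inv_id _ Hz))|].
  field. auto.
Qed.

Lemma Cdrv_cexp_lin (c z : C) : Cdrv (fun w => Cexp (c * w)) z (c * Cexp (c * z)).
Proof.
  eapply Cdrv_val; [apply (Cdrv_comp Cexp (fun w => c * w)%C z)|].
  - apply Cdrv_scal, Cdrv_id.
  - apply Cdrv_Cexp.
  - ring.
Qed.

(** The bridge to real calculus: the mean value theorem, the second derivative test and Gronwall's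
    inequality are all applied to real and imaginary parts along a line. *)
Lemma Cdrv_line (f : C -> C) (z u : C) (t : R) (d : C) :
  Cdrv f (z + t * u) d ->
  is_derive (fun s : R => Re (f (z + s * u)%C)) t (Re (u * d)) /\
  is_derive (fun s : R => Im (f (z + s * u)%C)) t (Im (u * d)).
Proof.
  intros H.
  assert (G : forall eps : posreal, locally t (fun s : R =>
     Cmod (f (z + s * u) - f (z + t * u) - (s - t)%R * (u * d))%C <= eps * Rabs (s - t))).
  { intros eps.
    set (K := Cmod u + 1). assert (HK : 0 < K) by (unfold K; pose proof (Cmod_ge_0 u); lra).
    destruct (H (eps / K)) as [delta [Hd Hw]].
    { apply Rdiv_lt_0_compat; auto. apply cond_pos. }
    assert (Hdk : 0 < delta / K) by (apply Rdiv_lt_0_compat; auto).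
    exists (mkposreal _ Hdk). intros s Hs.
    unfold ball in Hs; simpl in Hs; unfold AbsRing_ball, abs, minus, plus, opp in Hs; simpl in Hs.
    assert (E : (z + s * u - (z + t * u))%C = (RtoC (s - t) * u)%C)
      by (rewrite RtoC_minus; ring).
    specialize (Hw (z + s * u)%C). rewrite E, Cmod_mult, Cmod_R in Hw.
    assert (A : Rabs (s - t) * Cmod u <= Rabs (s - t) * K).
    { apply Rmult_le_compat_l; [apply Rabs_pos|]. unfold K; lra. }
    assert (B : Rabs (s - t) * K < delta).
    { apply Rlt_div_r in Hs; [|lra]. exact Hs. }
    rewrite Cmult_assoc.
    eapply Rle_trans; [apply Hw; lra|].
    apply (Rmult_le_compat_l (eps / K)) in A;
      [|left; apply Rdiv_lt_0_compat; auto; apply cond_pos].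
    replace (eps / K * (Rabs (s - t) * K)) with (eps * Rabs (s - t)) in A by (field; lra).
    exact A. }
  split; split; try apply is_linear_scal_l.
  - intros x Hx. apply (@is_filter_lim_locally_unique R_AbsRing (AbsRing_NormedModule R_AbsRing)) in Hx. subst x.
    intros eps. generalize (G eps). apply filter_imp. intros s Hs.
    eapply Rle_trans; [|apply Hs].
    eapply Rle_trans; [|apply re_le_Cmod]. apply Req_le.
    unfold norm, minus, plus, opp, scal; simpl; unfold abs, mult; simpl. f_equal. unfold Re; simpl.
    ring.
  - intros x Hx. apply (@is_filter_lim_locally_unique R_AbsRing (AbsRing_NormedModule R_AbsRing)) in Hx. subst x.
    intros eps. generalize (G eps). apply filter_imp. intros s Hs.
    eapply Rle_trans; [|apply Hs].
    eapply Rle_trans; [|apply Im_le_Cmod]. apply Req_le.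
    unfold norm, minus, plus, opp, scal; simpl; unfold abs, mult; simpl. f_equal. unfold Im; simpl.
    ring.
Qed.

(** * Complex series *)

Lemma sumC_S (n : nat) (f : nat -> C) : sumC (S n) f = (sumC n f + f n)%C.
Proof.
  unfold sumC. rewrite seq_S, map_app, fold_right_app. simpl.
  generalize (map f (seq 0 n)). intros l. induction l as [|x l IH]; simpl.
  - ring.
  - rewrite IH. ring.
Qed.

Lemma sumR_S (n : nat) (f : nat -> R) : sumR (S n) f = sumR n f + f n.
Proof.
  unfold sumR. rewrite seq_S, map_app, fold_right_app. simpl.
  generalize (map f (seq 0 n)). intros l. induction l as [|x l IH]; simpl.
  - ring.
  - rewrite IH. ring.
Qed.

Lemma sumC_ext (n : nat) (f g : nat -> C) :
  (forall i, (i < n)%nat -> f i = g i) -> sumC n f = sumC n g.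
Proof.
  induction n; intros H; [reflexivity|]. rewrite !sumC_S, IHn, H; auto.
Qed.

Lemma sumC_plus (n : nat) (f g : nat -> C) :
  sumC n (fun i => f i + g i)%C = (sumC n f + sumC n g)%C.
Proof. induction n; [unfold sumC; simpl; ring|]. rewrite !sumC_S, IHn. ring. Qed.

Lemma sumC_scal (n : nat) (c : C) (f : nat -> C) :
  sumC n (fun i => c * f i)%C = (c * sumC n f)%C.
Proof. induction n; [unfold sumC; simpl; ring|]. rewrite !sumC_S, IHn. ring. Qed.

Lemma sumC_minus (n : nat) (f g : nat -> C) :
  sumC n (fun i => f i - g i)%C = (sumC n f - sumC n g)%C.
Proof. induction n; [unfold sumC; simpl; ring|]. rewrite !sumC_S, IHn. ring. Qed.

Lemma sumC_shift (n : nat) (f : nat -> C) :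
  sumC (S n) f = (f O + sumC n (fun i => f (S i)))%C.
Proof. induction n; [unfold sumC; simpl; ring|]. rewrite sumC_S, IHn, sumC_S. ring. Qed.

Lemma sumC_split (n m : nat) (f : nat -> C) :
  sumC (n + m) f = (sumC n f + sumC m (fun i => f (n + i)%nat))%C.
Proof.
  induction m.
  - rewrite Nat.add_0_r. unfold sumC at 3; simpl. ring.
  - rewrite Nat.add_succ_r, !sumC_S, IHm. ring.
Qed.

Lemma sumC_rev (n : nat) (f : nat -> C) :
  sumC n f = sumC n (fun i => f (n - 1 - i)%nat).
Proof.
  revert f. induction n; intros f; [reflexivity|].
  rewrite sumC_S, sumC_shift, Cplus_comm. f_equal.
  - f_equal. lia.
  - rewrite IHn. apply sumC_ext. intros i Hi. f_equal. lia.
Qed.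

Lemma sumC_exchange (n m : nat) (f : nat -> nat -> C) :
  sumC n (fun i => sumC m (fun j => f i j)) = sumC m (fun j => sumC n (fun i => f i j)).
Proof.
  induction n.
  - unfold sumC at 1. simpl. symmetry. rewrite (sumC_ext m _ (fun _ => 0 * 0)%C).
    + rewrite sumC_scal. ring.
    + intros; unfold sumC; simpl; ring.
  - rewrite sumC_S, IHn, <- sumC_plus. apply sumC_ext. intros. rewrite sumC_S. auto.
Qed.

Lemma sumC_Re (n : nat) (f : nat -> C) : Re (sumC n f) = sumR n (fun i => Re (f i)).
Proof. induction n; [reflexivity|]. rewrite sumC_S, sumR_S, <- IHn. reflexivity. Qed.

Lemma sumC_Im (n : nat) (f : nat -> C) : Im (sumC n f) = sumR n (fun i => Im (f i)).
Proof. induction n; [reflexivity|]. rewrite sumC_S, sumR_S, <- IHn. reflexivity. Qed.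

Lemma sumR_le (n : nat) (f g : nat -> R) :
  (forall i, (i < n)%nat -> f i <= g i) -> sumR n f <= sumR n g.
Proof.
  induction n; intros H; [unfold sumR; simpl; lra|]. rewrite !sumR_S.
  apply Rplus_le_compat; auto.
Qed.

Lemma Cmod_sumC (n : nat) (f : nat -> C) : Cmod (sumC n f) <= sumR n (fun i => Cmod (f i)).
Proof.
  induction n.
  - unfold sumC, sumR; simpl. rewrite Cmod_0. lra.
  - rewrite sumC_S, sumR_S. eapply Rle_trans; [apply Cmod_triangle|]. lra.
Qed.

Lemma sum_n_sumR (f : nat -> R) (n : nat) : sum_n f n = sumR (S n) f.
Proof.
  induction n.
  - rewrite sum_O, sumR_S. unfold sumR; simpl. ring.
  - rewrite sum_Sn, sumR_S, IHn. reflexivity.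
Qed.

Lemma sum_n_sumC (f : nat -> C) (n : nat) :
  @sum_n C_AbelianMonoid f n = sumC (S n) f.
Proof.
  induction n.
  - rewrite sum_O, sumC_S. unfold sumC; simpl. ring.
  - rewrite sum_Sn, sumC_S, IHn. reflexivity.
Qed.

Definition Clim (u : nat -> C) (l : C) : Prop :=
  forall eps, 0 < eps -> exists N, forall n, (N <= n)%nat -> Cmod (u n - l) < eps.

Lemma Clim_unique (u : nat -> C) (l l' : C) : Clim u l -> Clim u l' -> l = l'.
Proof.
  intros H H'. destruct (Ceq_dec l l') as [E|E]; auto. exfalso.
  assert (P : 0 < Cmod (l - l')).
  { apply Cmod_gt_0. intros Z. apply E. replace l with ((l - l') + l')%C by ring.
    rewrite Z. ring. }
  destruct (H (Cmod (l - l') / 2)) as [N HN]; [lra|].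
  destruct (H' (Cmod (l - l') / 2)) as [N' HN']; [lra|].
  specialize (HN (N + N')%nat). specialize (HN' (N + N')%nat).
  replace (l - l')%C with ((u (N + N')%nat - l') - (u (N + N')%nat - l))%C in * by ring.
  pose proof (Cmod_sub_triangle (u (N + N')%nat - l') (u (N + N')%nat - l)).
  assert (N <= N + N')%nat by lia. assert (N' <= N + N')%nat by lia.
  specialize (HN H1). specialize (HN' H2). lra.
Qed.

Lemma Clim_ext_ev (u v : nat -> C) (l : C) (N0 : nat) :
  (forall n, (N0 <= n)%nat -> u n = v n) -> Clim u l -> Clim v l.
Proof.
  intros E H eps Heps. destruct (H eps Heps) as [N HN]. exists (N + N0)%nat.
  intros n Hn. rewrite <- E by lia. apply HN. lia.
Qed.

Lemma Clim_ext (u v : nat -> C) (l : C) :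
  (forall n, u n = v n) -> Clim u l -> Clim v l.
Proof. intros E. apply (Clim_ext_ev u v l 0). auto. Qed.

Lemma Clim_const (c : C) : Clim (fun _ => c) c.
Proof.
  intros eps Heps. exists O. intros n _. replace (c - c)%C with (RtoC 0) by ring.
  rewrite Cmod_0. auto.
Qed.

Lemma Clim_plus (u v : nat -> C) (l m : C) :
  Clim u l -> Clim v m -> Clim (fun n => u n + v n)%C (l + m).
Proof.
  intros H H' eps Heps.
  destruct (H (eps / 2)) as [N HN]; [lra|].
  destruct (H' (eps / 2)) as [N' HN']; [lra|].
  exists (N + N')%nat. intros n Hn.
  replace (u n + v n - (l + m))%C with ((u n - l) + (v n - m))%C by ring.
  eapply Rle_lt_trans; [apply Cmod_triangle|].
  specialize (HN n ltac:(lia)). specialize (HN' n ltac:(lia)). lra.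
Qed.

Lemma Clim_scal (c : C) (u : nat -> C) (l : C) :
  Clim u l -> Clim (fun n => c * u n)%C (c * l).
Proof.
  intros H eps Heps. pose proof (Cmod_ge_0 c) as Hc.
  destruct (H (eps / (Cmod c + 1))) as [N HN]; [apply Rdiv_lt_0_compat; lra|].
  exists N. intros n Hn. specialize (HN n Hn).
  replace (c * u n - c * l)%C with (c * (u n - l))%C by ring. rewrite Cmod_mult.
  apply Rlt_div_r in HN; [|lra].
  pose proof (Cmod_ge_0 (u n - l)). nra.
Qed.

Lemma Clim_minus (u v : nat -> C) (l m : C) :
  Clim u l -> Clim v m -> Clim (fun n => u n - v n)%C (l - m).
Proof.
  intros H H'. apply (Clim_ext (fun n => u n + - (1) * v n)%C); [intros; ring|].
  replace (l - m)%C with (l + - (1) * m)%C by ring.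
  apply Clim_plus; auto. apply Clim_scal; auto.
Qed.

Lemma Clim_shift (u : nat -> C) (l : C) : Clim u l -> Clim (fun n => u (S n)) l.
Proof.
  intros H eps Heps. destruct (H eps Heps) as [N HN]. exists N. intros; apply HN; lia.
Qed.

Lemma Clim_unshift (u : nat -> C) (l : C) : Clim (fun n => u (S n)) l -> Clim u l.
Proof.
  intros H eps Heps. destruct (H eps Heps) as [N HN]. exists (S N). intros n Hn.
  destruct n; [lia|]. apply HN; lia.
Qed.

Lemma Clim_bound (u : nat -> C) (l : C) (K : R) (N0 : nat) :
  (forall n, (N0 <= n)%nat -> Cmod (u n) <= K) -> Clim u l -> Cmod l <= K.
Proof.
  intros H H'. apply Rnot_lt_le. intros HK.
  destruct (H' (Cmod l - K)) as [N HN]; [lra|].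
  specialize (HN (N + N0)%nat ltac:(lia)). specialize (H (N + N0)%nat ltac:(lia)).
  pose proof (Cmod_le_add l (u (N + N0)%nat)) as T. rewrite Cmod_minus_sym in T. lra.
Qed.

Lemma Clim_comp (u : nat -> C) (l : C) (phi : nat -> nat) :
  (forall M, exists N, forall n, (N <= n)%nat -> (M <= phi n)%nat) ->
  Clim u l -> Clim (fun n => u (phi n)) l.
Proof.
  intros Hp H eps Heps. destruct (H eps Heps) as [M HM]. destruct (Hp M) as [N HN].
  exists N. auto.
Qed.

Definition Cser (u : nat -> C) (s : C) : Prop := Clim (fun n => sumC n u) s.

Lemma Cser_unique (u : nat -> C) (s s' : C) : Cser u s -> Cser u s' -> s = s'.
Proof. apply Clim_unique. Qed.

Lemma Cser_ext (u v : nat -> C) (s : C) : (forall n, u n = v n) -> Cser u s -> Cser v s.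
Proof. intros E. apply Clim_ext. intros n. apply sumC_ext. auto. Qed.

Lemma Cser_plus (u v : nat -> C) (s t : C) :
  Cser u s -> Cser v t -> Cser (fun n => u n + v n)%C (s + t).
Proof.
  intros H H'. eapply Clim_ext; [|apply Clim_plus; [apply H|apply H']].
  intros n; simpl. rewrite sumC_plus. auto.
Qed.

Lemma Cser_minus (u v : nat -> C) (s t : C) :
  Cser u s -> Cser v t -> Cser (fun n => u n - v n)%C (s - t).
Proof.
  intros H H'. eapply Clim_ext; [|apply Clim_minus; [apply H|apply H']].
  intros n; simpl. rewrite sumC_minus. auto.
Qed.

Lemma Cser_scal (c : C) (u : nat -> C) (s : C) :
  Cser u s -> Cser (fun n => c * u n)%C (c * s).
Proof.
  intros H. eapply Clim_ext; [|apply Clim_scal, H].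
  intros n; simpl. rewrite sumC_scal. auto.
Qed.

Lemma Cser_shift (u : nat -> C) (s : C) : Cser u s -> Cser (fun n => u (S n)) (s - u O).
Proof.
  intros H. apply Clim_shift in H.
  eapply Clim_ext; [|apply Clim_minus; [apply H|apply (Clim_const (u O))]].
  intros n; simpl. rewrite sumC_shift. ring.
Qed.

Lemma Cser_finite (u : nat -> C) (N : nat) :
  (forall n, (N <= n)%nat -> u n = 0) -> Cser u (sumC N u).
Proof.
  intros H. eapply (Clim_ext_ev (fun _ => sumC N u) _ _ N); [|apply Clim_const].
  intros n Hn. replace n with (N + (n - N))%nat by lia. rewrite sumC_split.
  rewrite (sumC_ext (n - N) _ (fun _ => 0 * 0)%C).
  - rewrite sumC_scal. ring.
  - intros i Hi. rewrite H by lia. ring.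
Qed.

Lemma is_series_sumR (b : nat -> R) (s : R) : is_series b s <-> is_lim_seq (fun n => sumR n b) s.
Proof.
  unfold is_series, is_lim_seq.
  split; intros H.
  - apply is_lim_seq_incr_1. eapply filterlim_ext; [|apply H]. intros n; apply sum_n_sumR.
  - apply is_lim_seq_incr_1 in H. eapply filterlim_ext; [|apply H].
    intros n; symmetry; apply sum_n_sumR.
Qed.

Lemma Cser_Re_Im (u : nat -> C) (s : C) :
  is_series (fun n => Re (u n)) (Re s) -> is_series (fun n => Im (u n)) (Im s) -> Cser u s.
Proof.
  intros H H' eps Heps. apply is_series_sumR, is_lim_seq_spec in H.
  apply is_series_sumR, is_lim_seq_spec in H'.
  assert (He : 0 < eps / 2) by lra.
  destruct (H (mkposreal _ He)) as [N HN]. destruct (H' (mkposreal _ He)) as [N' HN'].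
  exists (N + N')%nat. intros n Hn.
  specialize (HN n ltac:(lia)). specialize (HN' n ltac:(lia)).
  rewrite <- sumC_Re in HN. rewrite <- sumC_Im in HN'. simpl in HN, HN'.
  eapply Rle_lt_trans; [apply Cmod_le_Re_Im|].
  change (Re (sumC n u - s)) with (Re (sumC n u) - Re s).
  change (Im (sumC n u - s)) with (Im (sumC n u) - Im s). lra.
Qed.

Lemma Cser_Re (u : nat -> C) (s : C) : Cser u s -> is_series (fun n => Re (u n)) (Re s).
Proof.
  intros H. apply is_series_sumR, is_lim_seq_spec. intros eps.
  destruct (H eps (cond_pos eps)) as [N HN]. exists N. intros n Hn.
  rewrite <- sumC_Re. eapply Rle_lt_trans; [|apply (HN n Hn)].
  change (Re (sumC n u) - Re s) with (Re (sumC n u - s)). apply re_le_Cmod.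
Qed.

Lemma Cser_Im (u : nat -> C) (s : C) : Cser u s -> is_series (fun n => Im (u n)) (Im s).
Proof.
  intros H. apply is_series_sumR, is_lim_seq_spec. intros eps.
  destruct (H eps (cond_pos eps)) as [N HN]. exists N. intros n Hn.
  rewrite <- sumC_Im. eapply Rle_lt_trans; [|apply (HN n Hn)].
  change (Im (sumC n u) - Im s) with (Im (sumC n u - s)). apply Im_le_Cmod.
Qed.

Lemma is_series_Cser (u : nat -> C) (s : C) :
  @is_series C_AbsRing C_NormedModule u s -> Cser u s.
Proof.
  intros H. apply Clim_unshift. intros eps Heps.
  assert (H2 : 0 < eps / 2) by lra.
  destruct (H (fun w => Cmod (w - s) < eps)) as [N HN].
  - exists (mkposreal _ H2). intros w Hw.
    apply C_NormedModule_mixin_compat2 in Hw. simpl in Hw.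
    eapply Rlt_trans; [apply Hw|].
    assert (sqrt 2 < 2).
    { rewrite <- (sqrt_square 2) at 2 by lra. apply sqrt_lt_1; lra. }
    nra.
  - exists N. intros n Hn. rewrite <- sum_n_sumC. apply HN. auto.
Qed.

Lemma ex_series_scal_R (c : R) (a : nat -> R) : ex_series a -> ex_series (fun n => c * a n).
Proof. apply (@ex_series_scal R_AbsRing R_NormedModule). Qed.

Lemma ex_series_dominated (a b : nat -> R) :
  (forall n, 0 <= a n <= b n) -> ex_series b -> ex_series a.
Proof.
  intros H. apply (@ex_series_le R_AbsRing R_CompleteNormedModule). intros n.
  destruct (H n). change (Rabs (a n) <= b n). rewrite Rabs_pos_eq; auto.
Qed.

(** The same shape as the pair of real series in the definition of [E2], which therefore unfolds to
    a [CS] by conversion. *)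
Definition CS (u : nat -> C) : C :=
  (Series (fun n => Re (u n)), Series (fun n => Im (u n))).

Lemma Cser_CS_eq (u : nat -> C) (s : C) : Cser u s -> CS u = s.
Proof.
  intros H. apply C_eq; apply is_series_unique; [apply Cser_Re|apply Cser_Im]; auto.
Qed.

Lemma Cser_CS (u : nat -> C) (B : nat -> R) (N : nat) :
  (forall n, (N <= n)%nat -> Cmod (u n) <= B n) -> ex_series B -> Cser u (CS u).
Proof.
  intros H HB. apply (ex_series_incr_n _ N) in HB.
  apply Cser_Re_Im; apply Series_correct; apply (ex_series_incr_n _ N);
    (eapply (@ex_series_le R_AbsRing R_CompleteNormedModule); [|apply HB]); intros n;
    (eapply Rle_trans; [|apply H; lia]); [apply re_le_Cmod|apply Im_le_Cmod].
Qed.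

Lemma sumR_nonneg (n : nat) (B : nat -> R) : (forall i, 0 <= B i) -> 0 <= sumR n B.
Proof.
  intros H. induction n; [unfold sumR; simpl; lra|]. rewrite sumR_S. specialize (H n). lra.
Qed.

Lemma sumR_le_Series (n : nat) (B : nat -> R) :
  (forall i, 0 <= B i) -> ex_series B -> sumR n B <= Series B.
Proof.
  intros H HB. apply Series_correct, is_series_sumR in HB.
  apply (is_lim_seq_incr_compare (fun n => sumR n B)); auto.
  intros m. rewrite sumR_S. specialize (H m). lra.
Qed.

Lemma Cser_tail_bound (u : nat -> C) (s : C) (B : nat -> R) (K : nat) :
  Cser u s -> (forall i, (K <= i)%nat -> Cmod (u i) <= B i) -> ex_series B ->
  Cmod (s - sumC K u) <= Series (fun i => B (K + i)%nat).
Proof.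
  intros H Hu HB. apply (ex_series_incr_n _ K) in HB.
  apply (Clim_bound (fun n => sumC n u - sumC K u)%C _ _ K).
  - intros n Hn. replace n with (K + (n - K))%nat by lia. rewrite sumC_split.
    replace (sumC K u + _ - sumC K u)%C with (sumC (n - K) (fun i => u (K + i)%nat)) by ring.
    eapply Rle_trans; [apply Cmod_sumC|].
    eapply Rle_trans; [|apply (sumR_le_Series (n - K)); auto].
    + apply sumR_le. intros i _. apply Hu. lia.
    + intros i. eapply Rle_trans; [apply Cmod_ge_0|apply Hu; lia].
  - apply Clim_minus; [apply H|apply Clim_const].
Qed.

Lemma Cser_bound (u : nat -> C) (s : C) (B : nat -> R) :
  Cser u s -> (forall i, Cmod (u i) <= B i) -> ex_series B -> Cmod s <= Series B.
Proof.
  intros H Hu HB. pose proof (Cser_tail_bound u s B 0 H (fun i _ => Hu i) HB) as T.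
  replace (s - sumC 0 u)%C with s in T by (unfold sumC; simpl; ring). exact T.
Qed.

Lemma Series_tail_small (B : nat -> R) : ex_series B -> forall eps, 0 < eps ->
  exists K0, forall K, (K0 <= K)%nat -> Series (fun i => B (K + i)%nat) < eps.
Proof.
  intros HB eps Heps. pose proof (Series_correct _ HB) as H.
  apply is_series_sumR, is_lim_seq_spec in H.
  destruct (H (mkposreal _ Heps)) as [N HN]. exists (S N). intros K HK. simpl in HN.
  specialize (HN K ltac:(lia)).
  rewrite (Series_incr_n B K) in HN; [|lia|auto].
  rewrite <- sum_n_Reals in HN. rewrite sum_n_sumR in HN.
  replace (S (Init.Nat.pred K)) with K in HN by lia.
  apply Rabs_def2 in HN. lra.
Qed.

(** Dominated convergence for series: the tails beyond a fixed K are small uniformly in N, and the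
    heads are finite sums. Domination is asked only for large [N] and large [i], because the bounds
    for the cotangent series are available only there. *)
Lemma tannery (u : nat -> nat -> C) (l : nat -> C) (s : nat -> C) (B : nat -> R) (N0 J : nat) :
  ex_series B ->
  (forall N i, (N0 <= N)%nat -> (J <= i)%nat -> Cmod (u N i) <= B i) ->
  (forall i, Clim (fun N => u N i) (l i)) ->
  (forall N, Cser (u N) (s N)) ->
  Cser l (CS l) /\ Clim s (CS l).
Proof.
  intros HB Hu Hl Hs.
  assert (Hlb : forall i, (J <= i)%nat -> Cmod (l i) <= B i).
  { intros i Hi. apply (Clim_bound (fun N => u N i) _ _ N0); auto. }
  assert (HL : Cser l (CS l)) by (apply (Cser_CS l B J); auto).
  split; auto. intros eps Heps.
  destruct (Series_tail_small B HB (eps / 3)) as [K0 HK0]; [lra|].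
  set (K := (K0 + J)%nat). specialize (HK0 K ltac:(unfold K; lia)).
  assert (HF : Clim (fun N => sumC K (u N)) (sumC K l)).
  { clear - Hl. induction K.
    - unfold sumC; simpl. apply Clim_const.
    - rewrite sumC_S. eapply Clim_ext; [|apply Clim_plus; [apply IHK|apply (Hl K)]].
      intros n; simpl. rewrite sumC_S. auto. }
  destruct (HF (eps / 3)) as [N1 HN1]; [lra|].
  exists (N1 + N0)%nat. intros N HN. specialize (HN1 N ltac:(lia)).
  pose proof (Cser_tail_bound (u N) (s N) B K (Hs N)
     (fun i Hi => Hu N i ltac:(lia) ltac:(unfold K in Hi; lia)) HB) as T1.
  pose proof (Cser_tail_bound l (CS l) B K HL
     (fun i Hi => Hlb i ltac:(unfold K in Hi; lia)) HB) as T2.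
  replace (s N - CS l)%C with ((s N - sumC K (u N)) + ((sumC K (u N) - sumC K l)
     - (CS l - sumC K l)))%C by ring.
  eapply Rle_lt_trans; [apply Cmod_triangle|].
  pose proof (Cmod_sub_triangle (sumC K (u N) - sumC K l) (CS l - sumC K l)). lra.
Qed.

(** This is [tannery] for the rows cut at length N: each cut row tends to [r i] under the majorant
    [T i], and the sum over i of the cut rows is the sum of the first N columns. *)
Lemma Cser_exchange (a : nat -> nat -> C) (r c : nat -> C) (B : nat -> nat -> R) (T : nat -> R) :
  (forall i j, Cmod (a i j) <= B i j) ->
  (forall i n, sumR n (B i) <= T i) -> ex_series T ->
  (forall i, Cser (a i) (r i)) ->
  (forall j, Cser (fun i => a i j) (c j)) ->
  Cser r (CS r) /\ Cser c (CS r).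
Proof.
  intros Ha HT HTs Hr Hc.
  apply (tannery (fun N i => sumC N (a i)) r (fun N => sumC N c) T 0 0 HTs).
  - intros N i _ _. eapply Rle_trans; [apply Cmod_sumC|].
    eapply Rle_trans; [|apply (HT i N)]. apply sumR_le; auto.
  - intros i. apply Hr.
  - intros N. induction N.
    + eapply Cser_ext; [|apply (Cser_finite (fun _ => RtoC 0) 0)]; auto.
    + rewrite sumC_S. eapply Cser_ext; [|apply Cser_plus; [apply IHN|apply (Hc N)]].
      intros n; simpl. rewrite sumC_S. auto.
Qed.

(** Quadratic remainders with summable constants replace uniform convergence of the derivatives: the
    total remainder is at most [Series M] times |w - z|^2. *)
Lemma Cser_derive (u : nat -> C -> C) (u' : nat -> C) (z : C) (r : R) (M : nat -> R)
    (U : C -> C) (V : C) :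
  0 < r -> ex_series M ->
  (forall n w, Cmod (w - z) < r ->
     Cmod (u n w - u n z - (w - z) * u' n) <= M n * (Cmod (w - z) * Cmod (w - z))) ->
  (forall w, Cmod (w - z) < r -> Cser (fun n => u n w) (U w)) ->
  Cser u' V -> Cdrv U z V.
Proof.
  intros Hr HM Hb HU HV eps Heps.
  assert (Hzz : Cmod (z - z) < r).
  { replace (z - z)%C with (RtoC 0) by ring. rewrite Cmod_0; auto. }
  set (K := Rabs (Series M) + 1).
  assert (HK : 0 < K) by (unfold K; pose proof (Rabs_pos (Series M)); lra).
  exists (Rmin r (eps / K)). split; [apply Rmin_pos; auto; apply Rdiv_lt_0_compat; auto|].
  intros w Hw.
  split_min Hw W1 W2.
  pose proof (Cser_minus _ _ _ _ (Cser_minus _ _ _ _ (HU w W1) (HU z Hzz))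
     (Cser_scal (w - z) _ _ HV)) as HS.
  pose proof (Cser_bound _ _ (fun n => M n * (Cmod (w - z) * Cmod (w - z))) HS
     (fun n => Hb n w W1) (ex_series_scal_r _ _ HM)) as HBd.
  rewrite Series_scal_r in HBd. eapply Rle_trans; [apply HBd|].
  rewrite <- Rmult_assoc. apply Rmult_le_compat_r; [apply Cmod_ge_0|].
  apply Rlt_div_r in W2; [|lra].
  pose proof (Rle_abs (Series M)). pose proof (Cmod_ge_0 (w - z)). unfold K in W2. nra.
Qed.

(** * q-series *)

Lemma upper_ball (z w : C) : upper z -> Cmod (w - z) < Im z / 2 -> Im z / 2 < Im w.
Proof.
  intros Hz H. pose proof (Im_le_Cmod (w - z)) as T.
  change (Im (w - z)) with (Im w - Im z) in T. apply Rabs_le_between in T. lra.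
Qed.

Lemma upper_near (z w : C) : upper z -> Cmod (w - z) < Im z / 2 -> upper w.
Proof. intros Hz H. pose proof (upper_ball z w Hz H). unfold upper in *. lra. Qed.

Lemma Cdrv_ext_upper (f g : C -> C) (z d : C) :
  upper z -> (forall w, upper w -> f w = g w) -> Cdrv f z d -> Cdrv g z d.
Proof.
  intros Hz E. apply (Cdrv_ext_loc f g z d (Im z / 2)).
  - unfold upper in Hz. lra.
  - intros w Hw. apply E, (upper_near z); auto.
Qed.

Lemma Cmod_qpow (al : R) (z : C) : Cmod (qpow al z) = exp (- (2 * PI * al * Im z)).
Proof.
  unfold qpow. rewrite Cmod_Cexp. f_equal. simpl. unfold Im. ring.
Qed.

Lemma qpow_neq_0 (al : R) (z : C) : qpow al z <> 0.
Proof. apply Cexp_neq_0. Qed.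

Lemma qpow_plus (a b : R) (z : C) : qpow (a + b) z = (qpow a z * qpow b z)%C.
Proof.
  unfold qpow. rewrite <- Cexp_add. f_equal.
  rewrite !RtoC_mult, RtoC_plus. ring.
Qed.

Lemma qpow_0 (z : C) : qpow 0 z = 1.
Proof.
  unfold qpow. rewrite <- Cexp_0. f_equal. rewrite Rmult_0_r. ring.
Qed.

Lemma Cdrv_qpow (al : R) (z : C) :
  Cdrv (qpow al) z (RtoC (2 * PI * al) * Ci * qpow al z)%C.
Proof. unfold qpow. apply Cdrv_cexp_lin. Qed.

Lemma exp_INR (x : R) (n : nat) : exp (x * INR n) = exp x ^ n.
Proof.
  induction n.
  - simpl. rewrite Rmult_0_r, exp_0. auto.
  - rewrite S_INR, Rmult_plus_distr_l, exp_plus, IHn, Rmult_1_r. simpl. ring.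
Qed.

Lemma Cmod_qpow_nat (m : R) (t : nat) (z : C) :
  Cmod (qpow (m * INR t) z) = exp (- (2 * PI * m * Im z)) ^ t.
Proof. rewrite Cmod_qpow, <- exp_INR. f_equal. ring. Qed.

Lemma exp_neg_lt_1 (x : R) : 0 < x -> 0 <= exp (- x) < 1.
Proof.
  intros H. split; [left; apply exp_pos|]. rewrite <- exp_0. apply exp_increasing. lra.
Qed.

Definition disc_coef (a : nat -> C) : Prop :=
  forall r, 0 <= r < 1 -> ex_series (fun t => Cmod (a t) * r ^ t).

(** The geometric sum 1 + r + ... + r^(t-1) has t terms, each at least r^t. *)
Lemma nat_pow_bound (r : R) (t : nat) : 0 <= r <= 1 -> INR t * r ^ t * (1 - r) <= 1 - r ^ t.
Proof.
  intros Hr. induction t.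
  - simpl. lra.
  - assert (0 <= r ^ t) by (apply pow_le; lra).
    rewrite S_INR. simpl.
    apply (Rmult_le_compat_l r) in IHt; [|lra].
    assert (r ^ t <= 1) by (rewrite <- (pow1 t); apply pow_incr; lra).
    assert (0 <= (1 - r) * (1 - r * r ^ t)) by (apply Rmult_le_pos; nra).
    lra.
Qed.

(** In r^t = (sqrt r)^t (sqrt r)^t one factor absorbs t, and the other keeps the series convergent
    because sqrt r < 1. *)
Lemma disc_coef_deriv (a : nat -> C) (c : C) :
  disc_coef a -> disc_coef (fun t => a t * (c * INR t))%C.
Proof.
  intros H r Hr.
  assert (Hs : 0 <= sqrt r < 1).
  { split; [apply sqrt_pos|]. rewrite <- sqrt_1. apply sqrt_lt_1; lra. }
  apply (ex_series_dominated _
    (fun t => Cmod c * / (1 - sqrt r) * (Cmod (a t) * sqrt r ^ t))).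
  - intros t. split; [apply Rmult_le_pos; [apply Cmod_ge_0|apply pow_le; lra]|].
    rewrite !Cmod_mult, Cmod_R, (Rabs_pos_eq (INR t)) by apply pos_INR.
    pose proof (Cmod_ge_0 (a t)). pose proof (Cmod_ge_0 c). pose proof (pos_INR t).
    assert (0 <= r ^ t) by (apply pow_le; lra).
    assert (Ers : r ^ t = sqrt r ^ t * sqrt r ^ t).
    { rewrite <- Rpow_mult_distr, sqrt_sqrt by lra. auto. }
    rewrite Ers.
    assert (P : 0 <= sqrt r ^ t) by (apply pow_le; lra).
    pose proof (nat_pow_bound (sqrt r) t ltac:(lra)) as B.
    assert (B' : INR t * sqrt r ^ t <= / (1 - sqrt r)).
    { apply (Rmult_le_reg_r (1 - sqrt r)); [lra|]. rewrite Rinv_l by lra. lra. }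
    replace (Cmod (a t) * (Cmod c * INR t) * (sqrt r ^ t * sqrt r ^ t))
      with (Cmod c * Cmod (a t) * sqrt r ^ t * (INR t * sqrt r ^ t)) by ring.
    replace (Cmod c * / (1 - sqrt r) * (Cmod (a t) * sqrt r ^ t))
      with (Cmod c * Cmod (a t) * sqrt r ^ t * / (1 - sqrt r)) by ring.
    apply Rmult_le_compat_l; auto. repeat apply Rmult_le_pos; auto.
  - apply ex_series_scal_R. apply H, Hs.
Qed.

Lemma disc_coef_le (a b : nat -> C) : (forall t, Cmod (a t) <= Cmod (b t)) ->
  disc_coef b -> disc_coef a.
Proof.
  intros Hab H r Hr. eapply ex_series_dominated; [|apply (H r Hr)].
  intros t. assert (0 <= r ^ t) by (apply pow_le; lra).
  split; [apply Rmult_le_pos; auto; apply Cmod_ge_0|].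
  apply Rmult_le_compat_r; auto.
Qed.

Lemma disc_coef_const (c : C) : disc_coef (fun _ => c).
Proof.
  intros r Hr. apply ex_series_scal_R.
  apply ex_series_geom. rewrite Rabs_pos_eq; lra.
Qed.

Definition qser (m : R) (a : nat -> C) (z : C) : C :=
  CS (fun t => a t * qpow (m * INR t) z)%C.

Lemma qser_term_bound (m : R) (a : nat -> C) (z : C) (t : nat) :
  Cmod (a t * qpow (m * INR t) z) = Cmod (a t) * exp (- (2 * PI * m * Im z)) ^ t.
Proof. rewrite Cmod_mult, Cmod_qpow_nat. auto. Qed.

Lemma qser_rate (m : R) (y : R) : 0 < m -> 0 < y -> 0 < 2 * PI * m * y.
Proof.
  intros Hm Hy. pose proof PI_RGT_0.
  apply Rmult_lt_0_compat; auto. apply Rmult_lt_0_compat; lra.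
Qed.

Lemma qser_Cser (m : R) (a : nat -> C) (z : C) : 0 < m -> disc_coef a -> upper z ->
  Cser (fun t => a t * qpow (m * INR t) z)%C (qser m a z).
Proof.
  intros Hm Ha Hz.
  apply (Cser_CS _ (fun t => Cmod (a t) * exp (- (2 * PI * m * Im z)) ^ t) 0).
  - intros t _. rewrite qser_term_bound. apply Rle_refl.
  - apply Ha, exp_neg_lt_1, qser_rate; auto.
Qed.

Lemma qser_Cdrv (m : R) (a : nat -> C) (z : C) : 0 < m -> disc_coef a -> upper z ->
  Cdrv (qser m a) z (qser m (fun t => a t * (RtoC (2 * PI * m) * Ci * INR t))%C z).
Proof.
  intros Hm Ha Hz.
  set (c := (RtoC (2 * PI * m) * Ci)%C).
  assert (Ha' : disc_coef (fun t => a t * (c * INR t))%C) by (apply disc_coef_deriv; auto).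
  assert (Ha'' : disc_coef (fun t => a t * (c * INR t) * (c * INR t))%C)
    by (apply (disc_coef_deriv (fun t => a t * (c * INR t))%C); auto).
  (* Inside the ball of radius Im z / 2 the factor exp |d h| costs at most half of the decay of the
     t-th term, so the rate at height Im z / 2 majorises all remainders. *)
  set (r := exp (- (2 * PI * m * (Im z / 2)))).
  assert (Hr : 0 <= r < 1) by (apply exp_neg_lt_1, qser_rate; auto; unfold upper in Hz; lra).
  apply (Cser_derive (fun t w => a t * qpow (m * INR t) w)%C
     (fun t => a t * (c * INR t) * qpow (m * INR t) z)%C z (Im z / 2)
     (fun t => 4 * (Cmod (a t * (c * INR t) * (c * INR t)) * r ^ t))).
  - unfold upper in Hz; lra.
  - apply ex_series_scal_R. apply Ha'', Hr.
  - intros t w Hw. set (d := (c * INR t)%C). set (h := (w - z)%C) in *.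
    assert (E : qpow (m * INR t) w = (qpow (m * INR t) z * Cexp (d * h))%C).
    { unfold qpow. rewrite <- Cexp_add. f_equal. unfold d, h, c.
      rewrite !RtoC_mult. ring. }
    rewrite E.
    replace (a t * (qpow (m * INR t) z * Cexp (d * h)) - a t * qpow (m * INR t) z
              - h * (a t * d * qpow (m * INR t) z))%C
      with (a t * qpow (m * INR t) z * (Cexp (d * h) - 1 - d * h))%C by ring.
    rewrite Cmod_mult, qser_term_bound.
    pose proof (Cexp_taylor1 (d * h)) as T. rewrite !Cmod_mult in T.
    rewrite !Cmod_mult.
    assert (Hd : Cmod d = 2 * PI * m * INR t).
    { unfold d, c. rewrite !Cmod_mult, Cmod_Ci, !Cmod_R. pose proof PI_RGT_0.
      rewrite !Rabs_pos_eq; [ring|apply pos_INR|].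
      apply Rmult_le_pos; lra. }
    assert (He : exp (- (2 * PI * m * Im z)) ^ t * exp (Cmod d * Cmod h) <= r ^ t).
    { unfold r. rewrite <- !exp_INR, <- exp_plus.
      assert (X : - (2 * PI * m * Im z) * INR t + Cmod d * Cmod h <= - (2 * PI * m * (Im z / 2)) * INR t).
      { rewrite Hd. assert (0 <= 2 * PI * m * INR t) by (rewrite <- Hd; apply Cmod_ge_0).
        assert (2 * PI * m * INR t * Cmod h <= 2 * PI * m * INR t * (Im z / 2))
          by (apply Rmult_le_compat_l; lra). lra. }
      destruct X as [X|X]; [left; apply exp_increasing; auto|rewrite X; lra]. }
    pose proof (Cmod_ge_0 (a t)) as G1. pose proof (Cmod_ge_0 d) as G2.
    pose proof (Cmod_ge_0 h) as G3.
    assert (G4 : 0 <= exp (- (2 * PI * m * Im z)) ^ t) by (apply pow_le; left; apply exp_pos).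
    eapply Rle_trans.
    { apply Rmult_le_compat_l; [|apply T]. apply Rmult_le_pos; auto. }
    replace (Cmod (a t) * exp (- (2 * PI * m * Im z)) ^ t *
       (4 * (Cmod d * Cmod h * (Cmod d * Cmod h)) * exp (Cmod d * Cmod h)))
      with (4 * (Cmod (a t) * Cmod d * Cmod d) * (Cmod h * Cmod h) *
         (exp (- (2 * PI * m * Im z)) ^ t * exp (Cmod d * Cmod h))) by ring.
    replace (4 * (Cmod (a t) * Cmod d * Cmod d * r ^ t) * (Cmod h * Cmod h))
      with (4 * (Cmod (a t) * Cmod d * Cmod d) * (Cmod h * Cmod h) * r ^ t) by ring.
    apply Rmult_le_compat_l; auto. repeat apply Rmult_le_pos; auto; lra.
  - intros w Hw. apply qser_Cser; auto. apply (upper_near z); auto.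
  - apply qser_Cser; auto.
Qed.

(** Exponential convergence at the cusp, uniform in the real part. It keeps only the constant term
    of a q-expansion, and it passes through sums, products and exponentials without any handling of
    coefficients. *)
Definition decay (c : C) (f : C -> C) : Prop :=
  exists e K, 0 < e /\ 0 <= K /\ forall z, 1 <= Im z -> Cmod (f z - c) <= K * exp (- (e * Im z)).

Lemma qser_decay (m : R) (a : nat -> C) : 0 < m -> disc_coef a -> decay (a O) (qser m a).
Proof.
  intros Hm Ha.
  set (r1 := exp (- (2 * PI * m))).
  assert (Hr1 : 0 <= r1 < 1).
  { apply exp_neg_lt_1. pose proof (qser_rate m 1 Hm ltac:(lra)). lra. }
  assert (Hr1' : 0 < r1) by apply exp_pos.
  set (K := Series (fun t => Cmod (a (1 + t)%nat) * r1 ^ (1 + t))).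
  assert (Hex : ex_series (fun t => Cmod (a (1 + t)%nat) * r1 ^ (1 + t)))
    by (apply (proj1 (ex_series_incr_n (fun t => Cmod (a t) * r1 ^ t) 1)), Ha, Hr1).
  (* For Im z >= 1 one has r <= r1, hence r^(1+t) <= (r / r1) r1^(1+t): a single factor r is kept
     for the decay and the rest is summed at height 1. *)
  exists (2 * PI * m), (K * / r1). repeat split.
  - pose proof (qser_rate m 1 Hm ltac:(lra)). lra.
  - apply Rmult_le_pos; [|left; apply Rinv_0_lt_compat; auto].
    apply (sumR_le_Series 0 (fun t => Cmod (a (1 + t)%nat) * r1 ^ (1 + t))); auto.
    intros n. apply Rmult_le_pos; [apply Cmod_ge_0|]. apply pow_le; lra.
  - intros z Hz. assert (Hu : upper z) by (unfold upper; lra).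
    pose proof (qser_Cser m a z Hm Ha Hu) as HS.
    set (r := exp (- (2 * PI * m * Im z))).
    assert (Hr : 0 <= r < 1) by (apply exp_neg_lt_1, qser_rate; auto).
    pose proof (Cser_tail_bound _ _ (fun t => Cmod (a t) * r ^ t) 1 HS) as T.
    assert (E1 : sumC 1 (fun t => a t * qpow (m * INR t) z)%C = a O).
    { unfold sumC; simpl. rewrite Rmult_0_r, qpow_0. ring. }
    rewrite E1 in T. eapply Rle_trans; [apply T|].
    + intros i _. rewrite qser_term_bound. unfold r; lra.
    + apply Ha; auto.
    + unfold K. rewrite Rmult_assoc, <- Series_scal_r. apply Series_le.
      * intros n. assert (0 <= r ^ (1 + n)) by (apply pow_le; lra). split.
        { apply Rmult_le_pos; auto. apply Cmod_ge_0. }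
        rewrite Rmult_assoc. apply Rmult_le_compat_l; [apply Cmod_ge_0|].
        fold r.
        set (x := r * / r1).
        assert (Hrr : r <= r1).
        { unfold r, r1. pose proof (qser_rate m 1 Hm ltac:(lra)).
          assert (X : - (2 * PI * m * Im z) <= - (2 * PI * m)) by nra.
          destruct X as [X|X]; [left; apply exp_increasing; auto|rewrite X; lra]. }
        assert (Hx : 0 <= x <= 1).
        { unfold x. split; [apply Rmult_le_pos; [lra|left; apply Rinv_0_lt_compat; auto]|].
          apply (Rmult_le_reg_r r1); auto. rewrite Rmult_assoc, Rinv_l by lra. lra. }
        assert (Exr : r = x * r1) by (unfold x; field; lra).
        replace (/ r1 * r) with x by (unfold x; ring).
        rewrite Exr at 1. rewrite Rpow_mult_distr, (Rmult_comm (x ^ (1 + n))).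
        apply Rmult_le_compat_l; [apply pow_le; lra|].
        assert (x ^ n <= 1) by (rewrite <- (pow1 n); apply pow_incr; auto).
        simpl. nra.
      * apply ex_series_scal_r; auto.
Qed.

Definition dH (f g : C -> C) : Prop := forall z, upper z -> Cdrv f z (g z).

(** Convergence at the cusp for [f] and n successive derivatives, the derivatives tending to 0.
    Counting the derivatives permits induction for products and exponentials; [f'] is existential
    because only its values on the upper half plane matter. *)
Fixpoint tame (n : nat) (c : C) (f : C -> C) : Prop :=
  decay c f /\
  match n with
  | O => True
  | S n' => exists f', dH f f' /\ tame n' 0 f'
  end.

Lemma tame_decay (n : nat) (c : C) (f : C -> C) : tame n c f -> decay c f.
Proof. destruct n; intros [H _]; auto. Qed.

Lemma decay_ext (c : C) (f g : C -> C) :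
  (forall z, upper z -> f z = g z) -> decay c f -> decay c g.
Proof.
  intros E [e [K [He [HK H]]]]. exists e, K. repeat split; auto. intros z Hz.
  rewrite <- E; auto. unfold upper; lra.
Qed.

Lemma dH_ext (f g f' g' : C -> C) :
  (forall z, upper z -> f z = g z) -> (forall z, upper z -> f' z = g' z) ->
  dH f f' -> dH g g'.
Proof.
  intros E E' H z Hz. rewrite <- E'; auto. apply (Cdrv_ext_upper f); auto.
Qed.

Lemma tame_ext (n : nat) (c : C) (f g : C -> C) :
  (forall z, upper z -> f z = g z) -> tame n c f -> tame n c g.
Proof.
  destruct n; intros E [H H']; (split; [apply (decay_ext c f); auto|]); auto.
  destruct H' as [f' [Hd Ht]]. exists f'. split; auto.
  apply (dH_ext f g f' f'); auto.
Qed.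

Lemma decay_weaken (c : C) (f : C -> C) (e K : R) :
  0 < e -> 0 <= K -> (forall z, 1 <= Im z -> Cmod (f z - c) <= K * exp (- (e * Im z))) ->
  decay c f.
Proof. intros. exists e, K. auto. Qed.

Lemma decay_common (c d : C) (f g : C -> C) : decay c f -> decay d g ->
  exists e K, 0 < e /\ 0 <= K /\ forall z, 1 <= Im z ->
    Cmod (f z - c) <= K * exp (- (e * Im z)) /\ Cmod (g z - d) <= K * exp (- (e * Im z)).
Proof.
  intros [e1 [K1 [He1 [HK1 H1]]]] [e2 [K2 [He2 [HK2 H2]]]].
  exists (Rmin e1 e2), (Rmax K1 K2). repeat split.
  - apply Rmin_pos; auto.
  - eapply Rle_trans; [apply HK1|apply Rmax_l].
  - eapply Rle_trans; [apply H1; auto|].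
    apply Rmult_le_compat; auto; [left; apply exp_pos|apply Rmax_l|].
    pose proof (Rmin_l e1 e2).
    assert (X : - (e1 * Im z) <= - (Rmin e1 e2 * Im z)) by nra.
    destruct X as [X|X]; [left; apply exp_increasing; auto|rewrite X; lra].
  - eapply Rle_trans; [apply H2; auto|].
    apply Rmult_le_compat; auto; [left; apply exp_pos|apply Rmax_r|].
    pose proof (Rmin_r e1 e2).
    assert (X : - (e2 * Im z) <= - (Rmin e1 e2 * Im z)) by nra.
    destruct X as [X|X]; [left; apply exp_increasing; auto|rewrite X; lra].
Qed.

Lemma decay_const (c : C) : decay c (fun _ => c).
Proof.
  apply (decay_weaken c _ 1 0); try lra. intros z _.
  replace (c - c)%C with (RtoC 0) by ring. rewrite Cmod_0. lra.
Qed.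

Lemma decay_plus (c d : C) (f g : C -> C) :
  decay c f -> decay d g -> decay (c + d) (fun z => f z + g z)%C.
Proof.
  intros Hf Hg. destruct (decay_common c d f g Hf Hg) as [e [K [He [HK H]]]].
  apply (decay_weaken _ _ e (K + K)); try lra. intros z Hz. destruct (H z Hz).
  replace (f z + g z - (c + d))%C with ((f z - c) + (g z - d))%C by ring.
  eapply Rle_trans; [apply Cmod_triangle|]. lra.
Qed.

Lemma exp_neg_le_1 (x : R) : 0 <= x -> exp (- x) <= 1.
Proof.
  intros [H|H]; [|rewrite <- H, Ropp_0, exp_0; lra]. apply exp_neg_lt_1 in H; lra.
Qed.

Lemma decay_mult (c d : C) (f g : C -> C) :
  decay c f -> decay d g -> decay (c * d) (fun z => f z * g z)%C.
Proof.
  intros Hf Hg. destruct (decay_common c d f g Hf Hg) as [e [K [He [HK H]]]].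
  pose proof (Cmod_ge_0 c). pose proof (Cmod_ge_0 d).
  apply (decay_weaken _ _ e (K * K + Cmod d * K + Cmod c * K)); auto; [nra|].
  intros z Hz. destruct (H z Hz) as [Hf1 Hg1].
  replace (f z * g z - c * d)%C
    with ((f z - c) * (g z - d) + (d * (f z - c) + c * (g z - d)))%C by ring.
  eapply Rle_trans; [apply Cmod_triangle|].
  eapply Rle_trans; [apply Rplus_le_compat_l, Cmod_triangle|]. rewrite !Cmod_mult.
  assert (HE : 0 < exp (- (e * Im z)) <= 1).
  { split; [apply exp_pos|apply exp_neg_le_1; nra]. }
  set (E := exp (- (e * Im z))) in *.
  pose proof (Cmod_ge_0 (f z - c)). pose proof (Cmod_ge_0 (g z - d)).
  assert (Cmod (f z - c) * Cmod (g z - d) <= (K * E) * K).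
  { apply Rmult_le_compat; auto. nra. }
  assert (Cmod d * Cmod (f z - c) <= Cmod d * (K * E)) by (apply Rmult_le_compat_l; auto).
  assert (Cmod c * Cmod (g z - d) <= Cmod c * (K * E)) by (apply Rmult_le_compat_l; auto).
  lra.
Qed.

Lemma dH_plus (f g f' g' : C -> C) :
  dH f f' -> dH g g' -> dH (fun z => f z + g z)%C (fun z => f' z + g' z)%C.
Proof. intros Hf Hg z Hz. apply Cdrv_plus; auto. Qed.

Lemma dH_mult (f g f' g' : C -> C) : dH f f' -> dH g g' ->
  dH (fun z => f z * g z)%C (fun z => f' z * g z + f z * g' z)%C.
Proof. intros Hf Hg z Hz. apply Cdrv_mult; auto. Qed.

Lemma dH_const (c : C) : dH (fun _ => c) (fun _ => RtoC 0).
Proof. intros z _. apply Cdrv_const. Qed.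

Lemma tame_const (n : nat) (c : C) : tame n c (fun _ => c).
Proof.
  revert c. induction n; intros c; (split; [apply decay_const|]); auto.
  exists (fun _ => RtoC 0). split; [apply dH_const|apply IHn].
Qed.

Lemma tame_pred (n : nat) (c : C) (f : C -> C) : tame (S n) c f -> tame n c f.
Proof.
  revert c f. induction n; intros c f [H [f' [Hd Ht]]]; (split; auto).
  exists f'. auto.
Qed.

Lemma tame_plus (n : nat) (c d : C) (f g : C -> C) :
  tame n c f -> tame n d g -> tame n (c + d) (fun z => f z + g z)%C.
Proof.
  revert c d f g. induction n; intros c d f g [Hf Hf'] [Hg Hg'];
    (split; [apply decay_plus; auto|]); auto.
  destruct Hf' as [f' [Df Tf]], Hg' as [g' [Dg Tg]].
  exists (fun z => f' z + g' z)%C. split; [apply dH_plus; auto|].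
  replace (RtoC 0) with (0 + 0)%C by ring. auto.
Qed.

Lemma tame_mult (n : nat) (c d : C) (f g : C -> C) :
  tame n c f -> tame n d g -> tame n (c * d) (fun z => f z * g z)%C.
Proof.
  revert c d f g. induction n; intros c d f g Hf Hg.
  - destruct Hf as [Hf Hf'], Hg as [Hg Hg']. split; auto. apply decay_mult; auto.
  - pose proof (tame_pred _ _ _ Hf) as Pf. pose proof (tame_pred _ _ _ Hg) as Pg.
    destruct Hf as [Hf [f' [Df Tf]]], Hg as [Hg [g' [Dg Tg]]].
    split; [apply decay_mult; auto|].
    exists (fun z => f' z * g z + f z * g' z)%C. split; [apply dH_mult; auto|].
    replace (RtoC 0) with (0 * d + c * 0)%C by ring. apply tame_plus; auto.
Qed.

Lemma tame_scal (n : nat) (k c : C) (f : C -> C) :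
  tame n c f -> tame n (k * c) (fun z => k * f z)%C.
Proof. intros H. apply (tame_mult n k c (fun _ => k)); auto. apply tame_const. Qed.

Lemma decay_Cexp (f : C -> C) (c : C) : decay c f -> decay (Cexp c) (fun z => Cexp (f z)).
Proof.
  intros [e [K [He [HK H]]]].
  pose proof (Cmod_ge_0 (Cexp c)) as Hc. pose proof (exp_pos K) as HeK.
  apply (decay_weaken _ _ e (Cmod (Cexp c) * (K + 4 * K * K * exp K))); auto.
  { apply Rmult_le_pos; auto. assert (0 <= 4 * K * K * exp K) by (repeat apply Rmult_le_pos; lra). lra. }
  intros z Hz. specialize (H z Hz). set (w := (f z - c)%C) in *.
  assert (HE : 0 < exp (- (e * Im z)) <= 1).
  { split; [apply exp_pos|apply exp_neg_le_1; nra]. }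
  set (E := exp (- (e * Im z))) in *.
  replace (Cexp (f z)) with (Cexp c * Cexp w)%C
    by (rewrite <- Cexp_add; f_equal; unfold w; ring).
  replace (Cexp c * Cexp w - Cexp c)%C with (Cexp c * (w + (Cexp w - 1 - w)))%C by ring.
  rewrite Cmod_mult, Rmult_assoc. apply Rmult_le_compat_l; auto.
  eapply Rle_trans; [apply Cmod_triangle|].
  pose proof (Cexp_taylor1 w) as T. pose proof (Cmod_ge_0 w) as Hw.
  assert (HwK : Cmod w <= K) by nra.
  assert (exp (Cmod w) <= exp K).
  { destruct HwK as [X|X]; [left; apply exp_increasing; auto|rewrite X; lra]. }
  assert (4 * (Cmod w * Cmod w) * exp (Cmod w) <= 4 * (K * E * K) * exp K).
  { apply Rmult_le_compat; auto; [nra|left; apply exp_pos|].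
    apply Rmult_le_compat_l; [lra|]. apply Rmult_le_compat; auto. }
  lra.
Qed.

Lemma tame_Cexp (n : nat) (c : C) (f : C -> C) :
  tame n c f -> tame n (Cexp c) (fun z => Cexp (f z)).
Proof.
  revert c f. induction n; intros c f Hf.
  - destruct Hf as [Hf _]. split; auto. apply decay_Cexp; auto.
  - pose proof (tame_pred _ _ _ Hf) as Pf. destruct Hf as [Hf [f' [Df Tf]]].
    split; [apply decay_Cexp; auto|].
    exists (fun z => f' z * Cexp (f z))%C. split.
    + intros z Hz. apply (Cdrv_comp Cexp f); auto. apply Cdrv_Cexp.
    + replace (RtoC 0) with (0 * Cexp c)%C by ring. apply tame_mult; auto.
Qed.

Lemma qser_tame (n : nat) (m : R) (a : nat -> C) : 0 < m -> disc_coef a ->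
  tame n (a O) (qser m a).
Proof.
  intros Hm. revert a. induction n; intros a Ha; (split; [apply qser_decay; auto|]); auto.
  exists (qser m (fun t => a t * (RtoC (2 * PI * m) * Ci * INR t))%C). split.
  - intros z Hz. apply qser_Cdrv; auto.
  - assert (H := IHn _ (disc_coef_deriv a (RtoC (2 * PI * m) * Ci)%C Ha)).
    simpl in H. rewrite !Cmult_0_r in H. exact H.
Qed.

(** * Forms of negative weight *)

(** A gauge [delta] is chosen with g <= 1 / delta near each point, so that it encodes radius and
    local bound at once. Compactness puts every point close to one whose gauge is at least some
    fixed e > 0, and 1 / e bounds g. *)
Lemma rect_bounded (g : R -> R -> R) (a b c d : R) :
  (forall x y, a <= x <= b -> c <= y <= d -> exists B delta, 0 < delta /\
     forall u v, a <= u <= b -> c <= v <= d -> Rabs (u - x) < delta -> Rabs (v - y) < delta ->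
       g u v <= B) ->
  exists K, 0 < K /\ forall x y, a <= x <= b -> c <= y <= d -> g x y <= K.
Proof.
  intros H.
  assert (H' : forall p : R * R, exists delta : posreal,
    a <= fst p <= b -> c <= snd p <= d -> forall u v, a <= u <= b -> c <= v <= d ->
      Rabs (u - fst p) < delta -> Rabs (v - snd p) < delta -> g u v <= / delta).
  { intros [x y]; simpl.
    destruct (classic (a <= x <= b /\ c <= y <= d)) as [[Hx Hy]|N].
    - destruct (H x y Hx Hy) as [B [delta [Hd HB]]].
      assert (Hm : 0 < Rmin delta (/ (Rabs B + 1))).
      { apply Rmin_pos; auto. apply Rinv_0_lt_compat. pose proof (Rabs_pos B); lra. }
      exists (mkposreal _ Hm). simpl. intros _ _ u v Hu Hv Hux Hvy.
      pose proof (Rmin_l delta (/ (Rabs B + 1))). pose proof (Rmin_r delta (/ (Rabs B + 1))).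
      eapply Rle_trans; [apply HB; auto; lra|].
      apply Rle_trans with (Rabs B + 1); [pose proof (Rle_abs B); lra|].
      apply Rle_trans with (/ / (Rabs B + 1)); [rewrite Rinv_inv; lra|].
      apply Rinv_le_contravar; auto.
    - exists (mkposreal 1 Rlt_0_1). intros Hx Hy. exfalso; auto. }
  set (delta := fun p => proj1_sig (boolp.constructive_indefinite_description (H' p))).
  assert (Hdelta := fun p => proj2_sig (boolp.constructive_indefinite_description (H' p))).
  fold delta in Hdelta.
  destruct (compactness_value_2d a b c d (fun x y => delta (x, y))) as [e He].
  exists (/ e). split; [apply Rinv_0_lt_compat, cond_pos|]. intros x y Hx Hy.
  apply NNPP. intros N. apply (He x y Hx Hy). intros [u [v [Hu [Hv [Hxu [Hyv Hl]]]]]].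
  apply N. eapply Rle_trans; [apply (Hdelta (u, v)); simpl; auto|].
  apply Rinv_le_contravar; auto. apply cond_pos.
Qed.

(** If the supremum M were not attained, 1 / (M - f) would be locally bounded, hence bounded by some
    K, and M - 1 / K would be a smaller upper bound. *)
Lemma rect_max (f : R -> R -> R) (a b c d : R) :
  a <= b -> c <= d ->
  (forall x y, a <= x <= b -> c <= y <= d -> continuity_2d_pt f x y) ->
  exists x0 y0, a <= x0 <= b /\ c <= y0 <= d /\
    forall x y, a <= x <= b -> c <= y <= d -> f x y <= f x0 y0.
Proof.
  intros Hab Hcd Hf.
  destruct (rect_bounded f a b c d) as [K0 [_ HK0]].
  { intros x y Hx Hy. destruct (Hf x y Hx Hy (mkposreal 1 Rlt_0_1)) as [delta Hd].
    exists (f x y + 1), delta. split; [apply cond_pos|]. intros u v _ _ Hu Hv.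
    specialize (Hd u v Hu Hv). simpl in Hd. apply Rabs_def2 in Hd. lra. }
  set (E := fun v => exists x y, a <= x <= b /\ c <= y <= d /\ v = f x y).
  destruct (completeness E) as [M [HM1 HM2]].
  { exists K0. intros v [x [y [Hx [Hy ->]]]]. auto. }
  { exists (f a c), a, c. repeat split; lra. }
  assert (Hle : forall x y, a <= x <= b -> c <= y <= d -> f x y <= M).
  { intros x y Hx Hy. apply HM1. exists x, y. auto. }
  apply NNPP. intros N.
  assert (Hlt : forall x y, a <= x <= b -> c <= y <= d -> f x y < M).
  { intros x y Hx Hy. destruct (Hle x y Hx Hy) as [L|L]; auto. exfalso. apply N.
    exists x, y. repeat split; try lra. intros u v Hu Hv. rewrite L. auto. }
  destruct (rect_bounded (fun x y => / (M - f x y)) a b c d) as [K [HKp HK]].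
  { intros x y Hx Hy. pose proof (Hlt x y Hx Hy) as L.
    assert (He : 0 < (M - f x y) / 2) by lra.
    destruct (Hf x y Hx Hy (mkposreal _ He)) as [delta Hd]. simpl in Hd.
    exists (/ ((M - f x y) / 2)), delta. split; [apply cond_pos|]. intros u v _ _ Hu Hv.
    specialize (Hd u v Hu Hv). apply Rabs_def2 in Hd.
    apply Rinv_le_contravar; lra. }
  assert (M <= M - / K).
  { apply HM2. intros v [x [y [Hx [Hy ->]]]]. specialize (HK x y Hx Hy).
    specialize (Hlt x y Hx Hy).
    assert (/ K <= M - f x y).
    { apply Rle_trans with (/ / (M - f x y)); [|rewrite Rinv_inv; lra].
      apply Rinv_le_contravar; auto. apply Rinv_0_lt_compat; lra. }
    lra. }
  assert (0 < / K) by (apply Rinv_0_lt_compat; auto). lra.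
Qed.

Lemma second_derivative_test (p p1 : R -> R) (p2 r : R) :
  0 < r -> (forall t, Rabs t < r -> is_derive p t (p1 t)) -> is_derive p1 0 p2 ->
  (forall t, Rabs t < r -> p t <= p 0) -> p1 0 = 0 /\ p2 <= 0.
Proof.
  intros Hr Hp Hp1 Hmax.
  assert (H0 : p1 0 = 0).
  { assert (Hd : is_derive p 0 (p1 0)) by (apply Hp; rewrite Rabs_R0; auto).
    apply is_derive_Reals in Hd.
    assert (pr : derivable_pt p 0) by (exists (p1 0); auto).
    pose proof (deriv_maximum p (- r) r 0 pr ltac:(lra) Hr) as M.
    rewrite <- (derive_pt_eq_0 p 0 (p1 0) pr Hd). apply M.
    intros x H1 H2. apply Hmax. apply Rabs_def1; lra. }
  split; auto. apply Rnot_lt_le. intros Hpos.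
  apply is_derive_Reals in Hp1.
  destruct (Hp1 (p2 / 2)) as [delta Hd]; [lra|].
  set (t := Rmin r delta / 2).
  assert (Ht : 0 < t < r /\ t < delta).
  { unfold t. pose proof (Rmin_l r delta). pose proof (Rmin_r r delta).
    pose proof (Rmin_pos r delta Hr (cond_pos delta)). lra. }
  destruct (MVT_gen p 0 t p1) as [c [Hc1 Hc2]].
  { intros x Hx. rewrite Rmin_left, Rmax_right in Hx by lra. apply Hp, Rabs_def1; lra. }
  { intros x Hx. rewrite Rmin_left, Rmax_right in Hx by lra.
    apply continuity_pt_filterlim. apply (ex_derive_continuous p). exists (p1 x).
    apply Hp, Rabs_def1; lra. }
  rewrite Rmin_left, Rmax_right in Hc1 by lra.
  pose proof (Hmax t ltac:(apply Rabs_def1; lra)) as Ht'.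
  (* [MVT_gen] may return the endpoint 0. Then p t = p 0, and the mean value theorem on the open
     interval gives a zero of [p1] at a point where p1 c / c is within p2 / 2 of p2 > 0. *)
  assert (Hc : 0 < c).
  { destruct (proj1 Hc1) as [L|L]; auto. exfalso. subst c.
    assert (Hpt : p t = p 0) by (rewrite H0 in Hc2; lra).
    destruct (MVT_cor2 p p1 0 t) as [c [Hc3 Hc4]]; [lra| |].
    { intros x Hx. apply is_derive_Reals, Hp, Rabs_def1; lra. }
    specialize (Hd c ltac:(lra) ltac:(apply Rabs_def1; lra)).
    rewrite Rplus_0_l, H0, Rminus_0_r in Hd. apply Rabs_def2 in Hd.
    assert (p1 c = 0) by nra. rewrite H in Hd. unfold Rdiv in Hd at 1. lra. }
  specialize (Hd c ltac:(lra) ltac:(apply Rabs_def1; lra)).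
  rewrite Rplus_0_l, H0, Rminus_0_r in Hd. apply Rabs_def2 in Hd.
  assert (0 < p1 c / c) by lra.
  assert (0 < p1 c).
  { replace (p1 c) with (p1 c / c * c) by (field; lra). apply Rmult_lt_0_compat; auto. }
  assert (0 < p1 c * (t - 0)) by (apply Rmult_lt_0_compat; lra). lra.
Qed.

(** Meant for the two directions u = 1 and u = Ci: as Ci^2 = -1, the [h2] terms cancel when the two
    second derivatives are added, and the Laplacian 4 |h1|^2 remains. *)
Lemma second_derivative_Cmod_sqr (h h1 h2 : C -> C) (z0 u : C) (r : R) :
  dH h h1 -> dH h1 h2 -> (forall t : R, Rabs t < r -> upper (z0 + t * u)) -> 0 < r ->
  let p := fun t : R => Cmod (h (z0 + t * u)%C) ^ 2 in
  let p1 := fun t : R => 2 * (Re (h (z0 + t * u)%C) * Re (u * h1 (z0 + t * u))%C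
                              + Im (h (z0 + t * u)%C) * Im (u * h1 (z0 + t * u))%C) in
  (forall t, Rabs t < r -> is_derive p t (p1 t)) /\
  is_derive p1 0 (2 * (Cmod (u * h1 z0) ^ 2
      + (Re (h z0) * Re (u * (u * h2 z0))%C + Im (h z0) * Im (u * (u * h2 z0))%C))).
Proof.
  intros H1 H2 Hup Hr p p1.
  assert (D1 : forall t : R, Rabs t < r ->
     is_derive (fun s : R => Re (h (z0 + s * u)%C)) t (Re (u * h1 (z0 + t * u))%C) /\
     is_derive (fun s : R => Im (h (z0 + s * u)%C)) t (Im (u * h1 (z0 + t * u))%C)).
  { intros t Ht. apply Cdrv_line, H1, Hup, Ht. }
  split.
  - intros t Ht. destruct (D1 t Ht) as [Da Db].
    eapply is_derive_ext; [intros s; symmetry; apply Cmod_sqr|].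
    unfold p1. evar_last.
    + exact (is_derive_plus _ _ _ _ _ (is_derive_mult _ _ _ _ _ Da Da Rmult_comm)
        (is_derive_mult _ _ _ _ _ Db Db Rmult_comm)).
    + unfold plus, mult; simpl. unfold mult; simpl. ring.
  - assert (R0 : Rabs 0 < r) by (rewrite Rabs_R0; auto).
    destruct (D1 0 R0) as [Da Db].
    assert (E0 : (z0 + 0 * u)%C = z0) by ring.
    assert (D2 := Cdrv_line (fun z => u * h1 z)%C z0 u 0 (u * h2 z0)%C).
    rewrite E0 in Da, Db.
    destruct D2 as [Dc Dd].
    { rewrite E0. apply Cdrv_scal, H2. rewrite <- E0. apply Hup, R0. }
    evar_last.
    + exact (is_derive_scal _ _ 2 _ (is_derive_plus _ _ _ _ _
        (is_derive_mult _ _ _ _ _ Da Dc Rmult_comm)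
        (is_derive_mult _ _ _ _ _ Db Dd Rmult_comm))).
    + cbv beta. rewrite E0. rewrite Cmod_sqr. unfold plus, mult; simpl. unfold mult; simpl.
      unfold Re, Im; simpl. ring.
Qed.

(** [log (|h|^2 y^s)] is strictly subharmonic for [s < 0], so it has no interior maximum. *)
Lemma no_interior_max (h h1 h2 : C -> C) (s : R) (z0 : C) (r : R) :
  dH h h1 -> dH h1 h2 -> s < 0 -> upper z0 -> h z0 <> 0 -> 0 < r <= Im z0 ->
  (forall z, Cmod (z - z0) < r ->
     Cmod (h z) ^ 2 * Rpower (Im z) s <= Cmod (h z0) ^ 2 * Rpower (Im z0) s) -> False.
Proof.
  intros H1 H2 Hs Hz Hh Hr Hmax.
  assert (Hin : forall (t : R) u, Cmod u = 1 -> Rabs t < r -> Cmod (z0 + t * u - z0) < r).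
  { intros t u Hu Ht. replace (z0 + t * u - z0)%C with (RtoC t * u)%C by ring.
    rewrite Cmod_mult, Hu, Cmod_R. lra. }
  set (y0 := Im z0) in *.
  assert (Hy : 0 < y0) by apply Hz.
  set (P0 := Cmod (h z0) ^ 2).
  assert (HP0 : 0 < P0) by (apply pow_lt, Cmod_gt_0; auto).
  set (sg := - s).
  assert (Hpos : forall x, 0 < Rpower x s) by (intros; apply exp_pos).
  assert (Hinv : forall x, Rpower x s * Rpower x sg = 1).
  { intros x. unfold Rpower, sg. rewrite <- exp_plus.
    replace (s * ln x + - s * ln x) with 0 by ring. apply exp_0. }
  destruct (second_derivative_Cmod_sqr h h1 h2 z0 1 r H1 H2) as [A1 A2]; [|lra|].
  { intros t Ht. unfold upper. simpl. unfold y0, upper, Im in *. lra. }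
  destruct (second_derivative_Cmod_sqr h h1 h2 z0 Ci r H1 H2) as [B1 B2]; [|lra|].
  { intros t Ht. apply Rabs_def2 in Ht. unfold upper; simpl. unfold y0, Im in *. lra. }
  destruct (second_derivative_test _ _ _ r ltac:(lra) A1 A2) as [A3 A4].
  { intros t Ht. replace (z0 + 0 * 1)%C with z0 by ring.
    specialize (Hmax (z0 + t * 1)%C (Hin t (RtoC 1) Cmod_1 Ht)).
    replace (Im (z0 + t * 1)%C) with y0 in Hmax by (unfold y0, Im; simpl; ring).
    apply Rmult_le_reg_r in Hmax; auto. }
  (* In the vertical direction maximality is read as |h|^2 <= c y^sg with equality at [z0], which
     spares differentiating the product of |h|^2 with the power of y. *)
  set (c := P0 * Rpower y0 s).
  set (q := fun t : R => c * Rpower (y0 + t) sg).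
  set (q1 := fun t : R => c * (sg * / (y0 + t) * Rpower (y0 + t) sg)).
  assert (Q1 : forall t, Rabs t < r -> is_derive q t (q1 t)).
  { intros t Ht. apply Rabs_def2 in Ht. unfold q, q1, Rpower. auto_derive; [lra|].
    field. lra. }
  assert (Q2 : is_derive q1 0 (c * ((sg * sg - sg) * / (y0 * y0) * Rpower y0 sg))).
  { unfold q1, Rpower. auto_derive; [lra|]. rewrite Rplus_0_r. field. lra. }
  assert (C0 : c * Rpower y0 sg = P0).
  { unfold c. rewrite Rmult_assoc, Hinv. ring. }
  destruct (second_derivative_test
    (fun t => Cmod (h (z0 + t * Ci)%C) ^ 2 - q t) _ _ r ltac:(lra)
    (fun t Ht => is_derive_minus _ _ _ _ _ (B1 t Ht) (Q1 t Ht))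
    (is_derive_minus _ _ _ _ _ B2 Q2)) as [B3 B4].
  { intros t Ht. replace (z0 + 0 * Ci)%C with z0 by ring.
    unfold q at 2. rewrite Rplus_0_r, C0. fold P0.
    specialize (Hmax (z0 + t * Ci)%C (Hin t Ci Cmod_Ci Ht)).
    replace (Im (z0 + t * Ci)%C) with (y0 + t) in Hmax by (unfold y0, Im; simpl; ring).
    fold P0 c in Hmax. unfold q.
    apply (Rmult_le_compat_r (Rpower (y0 + t) sg)) in Hmax; [|left; apply exp_pos].
    rewrite Rmult_assoc, Hinv in Hmax. lra. }
  cbv beta in A3, A4, B3, B4. unfold minus, plus, opp in B3, B4. simpl in B3, B4.
  replace (z0 + 0 * Ci)%C with z0 in B3 by ring.
  replace (z0 + 0 * 1)%C with z0 in A3 by ring.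
  unfold q1 in B3. rewrite Rplus_0_r in B3.
  replace (c * (sg * / y0 * Rpower y0 sg)) with (sg * / y0 * P0) in B3
    by (rewrite <- C0; ring).
  replace (c * ((sg * sg - sg) * / (y0 * y0) * Rpower y0 sg))
    with ((sg * sg - sg) * / y0 * / y0 * P0) in B4 by (rewrite <- C0; field; lra).
  rewrite Cmod_sqr in A4.
  change (Cmod (Ci * h1 z0) * (Cmod (Ci * h1 z0) * 1)) with (Cmod (Ci * h1 z0) ^ 2) in B4.
  rewrite Cmod_sqr in B4.
  assert (EP : P0 = Re (h z0) * Re (h z0) + Im (h z0) * Im (h z0)) by apply Cmod_sqr.
  destruct (h z0) as [a b]. destruct (h1 z0) as [d e]. destruct (h2 z0) as [f g].
  unfold Re, Im in *. simpl in A3, A4, B3, B4, EP.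
  set (iy := / y0) in *.
  assert (Hiy : 0 < iy) by (apply Rinv_0_lt_compat; auto).
  assert (Hsg : 0 < sg) by (unfold sg; lra).
  (* The first-order conditions X1 and X2 determine conj(h) h1, hence |h|^2 |h1|^2 in X4. The sum X3
     of the second-order conditions, free of [h2], then says sg^2 <= sg^2 - sg up to a positive
     factor, which is impossible for sg > 0. *)
  assert (X1 : a * d + b * e = 0) by lra.
  assert (X2 : 2 * (b * d - a * e) = sg * iy * P0) by lra.
  assert (X3 : 4 * (d * d + e * e) <= (sg * sg - sg) * iy * iy * P0) by lra.
  assert (X4 : 4 * P0 * (d * d + e * e) = (sg * iy * P0) * (sg * iy * P0)).
  { rewrite <- X2, EP. replace (4 * (a * a + b * b) * (d * d + e * e))
     with (4 * ((a * d + b * e) * (a * d + b * e)) + (2 * (b * d - a * e)) * (2 * (b * d - a * e)))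
     by ring. rewrite X1. ring. }
  apply (Rmult_le_compat_l P0) in X3; [|lra].
  assert (G1 : 0 < iy * iy) by nra. assert (G2 : 0 < P0 * P0) by (apply Rmult_lt_0_compat; exact HP0).
  assert (0 < sg * (iy * iy) * (P0 * P0)) by (apply Rmult_lt_0_compat; auto; apply Rmult_lt_0_compat; auto).
  nra.
Qed.

(** * Translation, inversion and the maximum principle *)

Lemma Im_neg_inv (z : C) : upper z -> Im (- / z)%C = Im z / Cmod z ^ 2.
Proof.
  intros Hz. unfold upper in Hz. rewrite Cmod_sqr. destruct z as [x y]; simpl in *. field. nra.
Qed.

Lemma upper_neq_0 (z : C) : upper z -> z <> 0.
Proof. intros H E. rewrite E in H. unfold upper in H; simpl in H. lra. Qed.

Lemma upper_neg_inv (z : C) : upper z -> upper (- / z)%C.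
Proof.
  intros Hz. unfold upper. rewrite Im_neg_inv by auto. apply Rdiv_lt_0_compat; auto.
  apply pow_lt, Cmod_gt_0, upper_neq_0; auto.
Qed.

Lemma upper_plus_R (z : C) (x : R) : upper z -> upper (z + x).
Proof. unfold upper; simpl. unfold Im. lra. Qed.

Lemma periodic_Z {T : Type} (P : C -> T) :
  (forall z, upper z -> P (z + 1)%C = P z) ->
  forall (n : Z) z, upper z -> P (z + IZR n)%C = P z.
Proof.
  intros H.
  assert (N : forall (n : nat) z, upper z -> P (z + INR n)%C = P z).
  { induction n; intros z Hz.
    - simpl. f_equal. ring.
    - rewrite S_INR, RtoC_plus. rewrite Cplus_assoc, H, IHn; auto.
      apply upper_plus_R; auto. }
  intros n z Hz. destruct (Z_le_dec 0 n) as [L|L].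
  - replace n with (Z.of_nat (Z.to_nat n)) by lia. rewrite <- INR_IZR_INZ. apply N; auto.
  - rewrite <- (N (Z.to_nat (- n))) by (apply upper_plus_R; auto).
    f_equal. rewrite INR_IZR_INZ, Z2Nat.id, opp_IZR, RtoC_opp by lia. ring.
Qed.

Lemma strip_translate (x : R) : exists n : Z, - (1 / 2) <= x + IZR n <= 1 / 2.
Proof.
  exists (- Int_part (x + 1 / 2))%Z. rewrite opp_IZR.
  pose proof (base_Int_part (x + 1 / 2)). lra.
Qed.

Lemma Rpower_mult_base (x y s : R) : 0 < x -> 0 < y ->
  Rpower (x * y) s = Rpower x s * Rpower y s.
Proof. intros. unfold Rpower. rewrite ln_mult, <- exp_plus by auto. f_equal. ring. Qed.

Lemma continuity_2d_pt_Cdrv (h h1 : C -> C) (s x y : R) : dH h h1 -> 0 < y ->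
  continuity_2d_pt (fun x y => Cmod (h (x, y)) ^ 2 * Rpower y s) x y.
Proof.
  intros H Hy.
  assert (HC : forall (p : C -> R), (forall c d : C, Rabs (p c - p d) <= Cmod (c - d)) ->
     continuity_2d_pt (fun x y => p (h (x, y))) x y).
  { intros p Hp eps.
    assert (Hu : upper (x, y)) by exact Hy.
    destruct (Cdrv_continuous h (x, y) _ (H _ Hu) eps (cond_pos eps)) as [delta [Hd Hw]].
    assert (Hd2 : 0 < delta / 2) by lra.
    exists (mkposreal _ Hd2). simpl. intros u v Huv1 Huv2.
    eapply Rle_lt_trans; [apply Hp|]. apply Hw.
    eapply Rle_lt_trans; [apply Cmod_le_Re_Im|]. simpl. unfold Rminus in *. lra. }
  apply continuity_2d_pt_mult.
  - apply (continuity_2d_pt_ext (fun x y => Re (h (x, y)) * Re (h (x, y)) + Im (h (x, y)) * Im (h (x, y)))).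
    { intros. rewrite Cmod_sqr. auto. }
    assert (CR : continuity_2d_pt (fun x y => Re (h (x, y))) x y)
      by (apply HC; intros; apply (re_le_Cmod (c - d))).
    assert (CI : continuity_2d_pt (fun x y => Im (h (x, y))) x y)
      by (apply HC; intros; apply (Im_le_Cmod (c - d))).
    apply continuity_2d_pt_plus; apply continuity_2d_pt_mult; auto.
  - apply (continuity_1d_2d_pt_comp (fun t => Rpower t s) (fun _ v => v)).
    + apply continuity_pt_filterlim, (ex_derive_continuous (fun t => Rpower t s)).
      unfold Rpower. auto_derive. auto.
    + apply continuity_2d_pt_id2.
Qed.

(** Only moduli appear in the transformation laws, so the lemma applies equally to a form twisted by
    a real power of Delta and to the reciprocal of a form. *)
Lemma negative_weight_zero (h h1 h2 : C -> C) (s K M : R) :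
  dH h h1 -> dH h1 h2 -> s < 0 ->
  (forall z, upper z -> Cmod (h (z + 1)%C) = Cmod (h z)) ->
  (forall z, upper z -> Cmod (h (- / z)%C) = Rpower (Cmod z) s * Cmod (h z)) ->
  (forall z, M <= Im z -> Cmod (h z) <= K) ->
  forall z, upper z -> h z = 0.
Proof.
  intros H1 H2 Hs HT HS HK z Hz. apply NNPP. intros Hh.
  set (phi := fun z => Cmod (h z) ^ 2 * Rpower (Im z) s).
  assert (phiT : forall (n : Z) z, upper z -> phi (z + IZR n)%C = phi z).
  { intros n. apply periodic_Z. intros w Hw. unfold phi. rewrite HT by auto.
    f_equal. f_equal. simpl. unfold Im. ring. }
  assert (phiS : forall z, upper z -> phi (- / z)%C = phi z).
  { intros w Hw. unfold phi. rewrite HS, Im_neg_inv by auto.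
    pose proof (proj1 (Cmod_gt_0 w) (upper_neq_0 w Hw)) as Hm.
    unfold Rdiv. rewrite Rpower_mult_base; [|apply Hw|].
    2: apply Rinv_0_lt_compat, pow_lt; auto.
    assert (E : Rpower (Cmod w) s * Rpower (Cmod w) s * Rpower (/ Cmod w ^ 2) s = 1).
    { unfold Rpower. rewrite ln_Rinv by (apply pow_lt; auto).
      replace (Cmod w ^ 2) with (Cmod w * Cmod w) by ring.
      rewrite ln_mult by auto. rewrite <- !exp_plus, <- exp_0. f_equal. ring. }
    transitivity (Cmod (h w) ^ 2 * Rpower (Im w) s *
      (Rpower (Cmod w) s * Rpower (Cmod w) s * Rpower (/ Cmod w ^ 2) s)); [ring|].
    rewrite E. ring. }
  set (eps := phi z).
  assert (Heps : 0 < eps).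
  { apply Rmult_lt_0_compat; [apply pow_lt, Cmod_gt_0; auto|apply exp_pos]. }
  set (delta := Rmin (1 / 2) (Im z)).
  assert (Hdelta : 0 < delta <= 1 / 2 /\ delta <= Im z).
  { unfold delta. pose proof (Rmin_l (1 / 2) (Im z)). pose proof (Rmin_r (1 / 2) (Im z)).
    pose proof (Rmin_pos (1 / 2) (Im z) ltac:(lra) Hz). lra. }
  (* Above height exp L the function [phi] is below [eps]: there y^s <= 1 / (K^2 / eps + 2), because
     exp (- s ln y) >= 1 - s ln y. The term |M| puts exp L above the threshold [M]. *)
  set (L := (K * K / eps + 1) / (- s) + Rabs M).
  assert (HL : 0 < L).
  { unfold L. apply Rplus_lt_le_0_compat; [|apply Rabs_pos]. apply Rdiv_lt_0_compat; [|lra].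
    assert (0 <= K * K / eps) by (apply Rmult_le_pos; [nra|left; apply Rinv_0_lt_compat; auto]). lra. }
  assert (HY : forall w, exp L <= Im w -> phi w < eps).
  { intros w Hw.
    assert (H1L : M <= exp L).
    { pose proof (exp_ineq1_le L). pose proof (Rle_abs M).
      assert (0 < (K * K / eps + 1) / (- s)).
      { apply Rdiv_lt_0_compat; [|lra].
        assert (0 <= K * K / eps) by (apply Rmult_le_pos; [nra|left; apply Rinv_0_lt_compat; auto]). lra. }
      unfold L in *. lra. }
    assert (Hln : L <= ln (Im w)).
    { rewrite <- (ln_exp L). destruct Hw as [Hw|Hw].
      - left. apply ln_increasing; auto. apply exp_pos.
      - rewrite Hw. lra. }
    assert (Hp : Rpower (Im w) s <= / (K * K / eps + 1 + 1)).
    { unfold Rpower. replace (s * ln (Im w)) with (- (- s * ln (Im w))) by ring.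
      rewrite exp_Ropp.
      assert (0 <= K * K / eps) by (apply Rmult_le_pos; [nra|left; apply Rinv_0_lt_compat; auto]).
      apply Rinv_le_contravar; [lra|].
      apply Rle_trans with (1 + (- s) * ln (Im w)); [|apply exp_ineq1_le].
      assert (K * K / eps + 1 <= - s * L).
      { unfold L. rewrite Rmult_plus_distr_l. pose proof (Rabs_pos M).
        replace (- s * ((K * K / eps + 1) / - s)) with (K * K / eps + 1) by (field; lra). nra. }
      assert (- s * L <= - s * ln (Im w)) by (apply Rmult_le_compat_l; lra). lra. }
    assert (HKw : Cmod (h w) ^ 2 <= K * K).
    { specialize (HK w ltac:(lra)). pose proof (Cmod_ge_0 (h w)). nra. }
    assert (0 <= K * K / eps) by (apply Rmult_le_pos; [nra|left; apply Rinv_0_lt_compat; auto]).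
    unfold phi. eapply Rle_lt_trans.
    { apply Rmult_le_compat; [apply pow2_ge_0|left; apply exp_pos|apply HKw|apply Hp]. }
    apply (Rmult_lt_reg_r (K * K / eps + 1 + 1)); [lra|].
    rewrite Rmult_assoc, Rinv_l by lra.
    replace (eps * (K * K / eps + 1 + 1)) with (K * K + 2 * eps) by (field; lra). lra. }
  set (Y := Rmax (exp L) 1).
  destruct (rect_max (fun x y => phi (x, y)) (- (1 / 2)) (1 / 2) delta Y)
    as [x0 [y0 [Hx0 [Hy0 Hmax]]]].
  { lra. }
  { unfold Y. pose proof (Rmax_r (exp L) 1). lra. }
  { intros x y Hx Hy. apply (continuity_2d_pt_Cdrv h h1 s x y H1). lra. }
  set (z0 := (x0, y0) : C).
  assert (Hu0 : upper z0) by (unfold upper; simpl; lra).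
  assert (Hge : forall w, delta <= Im w -> phi w < eps \/ phi w <= phi z0).
  { intros w Hw. assert (Hwu : upper w) by (unfold upper; lra).
    destruct (Rle_dec (exp L) (Im w)) as [Hbig|Hsmall]; [left; auto|right].
    destruct (strip_translate (Re w)) as [n Hn]. rewrite <- (phiT n w) by auto.
    replace (w + IZR n)%C with (Re w + IZR n, Im w) by (apply C_eq; simpl; unfold Re, Im; ring).
    apply Hmax; auto. unfold Y. pose proof (Rmax_l (exp L) 1). lra. }
  assert (Hphi0 : eps <= phi z0) by (destruct (Hge z) as [X|X]; [apply Hdelta|unfold eps in X|unfold eps]; lra).
  assert (Hle : forall w, delta <= Im w -> phi w <= phi z0) by (intros w Hw; destruct (Hge w Hw) as [X|X]; lra).
  (* A maximum on the bottom edge is lifted by inversion: |x0| <= 1/2 and delta <= 1/2 give |z0|^2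
     <= 1/2, so the height at least doubles and the point becomes interior. *)
  assert (Hz1 : exists z1, delta < Im z1 /\ phi z1 = phi z0).
  { destruct (proj1 Hy0) as [G|G].
    - exists z0. auto.
    - exists (- / z0)%C. split; [|apply phiS; auto].
      rewrite Im_neg_inv by auto. rewrite Cmod_sqr. simpl. rewrite <- G.
      apply (Rmult_lt_reg_r (x0 * x0 + delta * delta)); [nra|].
      unfold Rdiv. rewrite (Rmult_assoc delta), Rinv_l by nra. rewrite Rmult_1_r.
      assert (x0 * x0 <= 1 / 4) by nra. assert (delta * delta <= 1 / 4) by nra. nra. }
  destruct Hz1 as [z1 [Hz1 Ez1]].
  assert (Hu1 : upper z1) by (unfold upper; lra).
  apply (no_interior_max h h1 h2 s z1 (Im z1 - delta)); auto; [|lra|].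
  - intros E. assert (phi z1 = 0) by (unfold phi; rewrite E, Cmod_0; ring). lra.
  - intros w Hw. fold (phi w) (phi z1). rewrite Ez1. apply Hle.
    pose proof (Im_le_Cmod (w - z1)) as T. change (Im (w - z1)) with (Im w - Im z1) in T.
    apply Rabs_le_between in T. lra.
Qed.

(** * Partial fractions of the cotangent *)

Definition e1 (w : C) : C := Cexp (RtoC (2 * PI) * Ci * w).

(** [PI * cot (PI * w)] *)
Definition cotp (w : C) : C := (RtoC PI * Ci * (e1 w + 1) / (e1 w - 1))%C.

Lemma e1_qpow (w : C) : e1 w = qpow 1 w.
Proof. unfold e1, qpow. rewrite Rmult_1_r. auto. Qed.

Lemma e1_add (a b : C) : e1 (a + b) = (e1 a * e1 b)%C.
Proof. unfold e1. rewrite <- Cexp_add. f_equal. ring. Qed.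

Lemma e1_opp (a : C) : e1 (- a) = (/ e1 a)%C.
Proof. unfold e1. rewrite <- Cexp_opp. f_equal. ring. Qed.

Lemma e1_neq_0 (a : C) : e1 a <> 0.
Proof. apply Cexp_neq_0. Qed.

Lemma Cexp_iR (t : R) : Cexp (Ci * t) = (cos t, sin t).
Proof.
  unfold Cexp. simpl. replace (0 * t - 1 * 0) with 0 by ring.
  replace (0 * 0 + 1 * t) with t by ring. rewrite exp_0. f_equal; ring.
Qed.

Lemma e1_half : e1 (1 / 2)%C = (- (1))%C.
Proof.
  unfold e1. replace (RtoC (2 * PI) * Ci * (1 / 2))%C with (Ci * PI)%C.
  - rewrite Cexp_iR, cos_PI, sin_PI. apply C_eq; simpl; ring.
  - rewrite RtoC_mult. field.
Qed.

Lemma e1_1 : e1 1 = 1.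
Proof.
  unfold e1. replace (RtoC (2 * PI) * Ci * 1)%C with (Ci * (2 * PI))%C.
  - replace (Ci * (2 * PI))%C with (Ci * RtoC (2 * PI))%C by (rewrite RtoC_mult; ring).
    rewrite Cexp_iR, cos_2PI, sin_2PI. auto.
  - rewrite RtoC_mult. ring.
Qed.

Lemma Cmod_e1 (w : C) : Cmod (e1 w) = exp (- (2 * PI * Im w)).
Proof. rewrite e1_qpow, Cmod_qpow. f_equal. ring. Qed.

Lemma e1_neq (w c : C) : Im w <> 0 -> Cmod c = 1 -> (e1 w - c)%C <> 0.
Proof.
  intros Hw Hc E. assert (X : e1 w = c) by (replace (e1 w) with (e1 w - c + c)%C by ring; rewrite E; ring).
  apply (f_equal Cmod) in X. rewrite Cmod_e1, Hc, <- exp_0 in X. apply exp_inv in X.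
  pose proof PI_RGT_0. assert (2 * PI * Im w = 0) by lra.
  apply Rmult_integral in H0. destruct H0; lra.
Qed.

Lemma e1_neq_1 (w : C) : Im w <> 0 -> (e1 w - 1)%C <> 0.
Proof. intros H. apply e1_neq; auto. apply Cmod_1. Qed.

Lemma e1_neq_m1 (w : C) : Im w <> 0 -> (e1 w + 1)%C <> 0.
Proof.
  intros H. replace (e1 w + 1)%C with (e1 w - - (1))%C by ring. apply e1_neq; auto. apply Cmod_m1.
Qed.

Lemma C2_neq_0 : RtoC 2 <> 0.
Proof. apply Cmod_gt_0. rewrite Cmod_R, Rabs_pos_eq; lra. Qed.

Lemma cotp_half_shift (w : C) : cotp (w + 1 / 2) = cotp (w - 1 / 2).
Proof.
  unfold cotp. replace (w + 1 / 2)%C with (w - 1 / 2 + 1)%C by (field; auto using C2_neq_0).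
  rewrite e1_add, e1_1, Cmult_1_r. auto.
Qed.

Lemma cotp_double (w : C) : Im w <> 0 -> (2 * cotp (2 * w) = cotp w + cotp (w + 1 / 2))%C.
Proof.
  intros Hw. unfold cotp. replace (2 * w)%C with (w + w)%C by ring.
  rewrite !e1_add, e1_half.
  assert (H1 := e1_neq_1 w Hw). assert (H2 := e1_neq_m1 w Hw).
  assert (H3 : (e1 w * e1 w - 1)%C <> 0).
  { replace (e1 w * e1 w - 1)%C with ((e1 w - 1) * (e1 w + 1))%C by ring.
    apply Cmult_neq_0; auto. }
  field. repeat split; auto.
  intros E. apply H2. transitivity (- (e1 w * RtoC (-1) - 1))%C; [ring|]. rewrite E. ring.
Qed.

Lemma INR_pow2_pos (k : nat) : 0 < INR (2 ^ k).
Proof. apply lt_0_INR. apply Nat.neq_0_lt_0, Nat.pow_nonzero. lia. Qed.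

Lemma Cinv_neq_0 (z : C) : z <> 0 -> (/ z)%C <> 0.
Proof.
  intros H E. pose proof (Cinv_r z H) as X. rewrite E, Cmult_0_r in X.
  apply RtoC_inj in X. lra.
Qed.

Lemma RtoC_neq_0 (x : R) : x <> 0 -> RtoC x <> 0.
Proof. intros H E. apply H, RtoC_inj, E. Qed.

Lemma Im_div_R (w : C) (x : R) : x <> 0 -> Im (w / x)%C = Im w / x.
Proof.
  intros Hx. replace (w / x)%C with (w * RtoC (/ x))%C.
  - destruct w; simpl. field. auto.
  - unfold Cdiv. rewrite RtoC_inv; auto.
Qed.

(** The duplication formula iterated k + 1 times. The shifts modulo 2K are represented by 0, ..., K
    - 1 and -1, ..., -K, so that for large k the almost symmetric sum approaches the partial
    fractions. *)
Lemma cotp_multiplication (k : nat) (w : C) : Im w <> 0 ->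
  let K := (2 ^ k)%nat in
  (RtoC (2 * INR K) * cotp w =
   sumC K (fun j => cotp ((w + INR j) / RtoC (2 * INR K)))
   + sumC K (fun j => cotp ((w - INR (S j)) / RtoC (2 * INR K))))%C.
Proof.
  intros Hw. induction k; intros K.
  - unfold K, sumC; simpl. rewrite !Rmult_1_r.
    replace w with (2 * (w / 2))%C at 1 by (field; auto using C2_neq_0).
    rewrite cotp_double.
    + rewrite cotp_half_shift. replace ((w + 0) / 2)%C with (w / 2)%C by (field; auto using C2_neq_0).
      replace ((w - 1) / 2)%C with (w / 2 - 1 / 2)%C by (field; auto using C2_neq_0). ring.
    + rewrite Im_div_R by lra. intros E. apply Hw. unfold Rdiv in E. lra.
  - set (K' := (2 ^ k)%nat) in *. cbv zeta in IHk.
    assert (EK : K = (K' + K')%nat) by (unfold K; simpl; lia).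
    assert (HK : 0 < INR K') by apply INR_pow2_pos.
    assert (EI : INR K = 2 * INR K') by (rewrite EK, plus_INR; ring).
    rewrite EI, EK, !sumC_split.
    set (D := RtoC (2 * (2 * INR K'))).
    assert (HD : D <> 0) by (apply RtoC_neq_0; lra).
    assert (E2 : D = (2 * RtoC (2 * INR K'))%C) by (unfold D; rewrite RtoC_mult; auto).
    assert (Him : forall x : R, Im ((w + x) / D)%C <> 0).
    { intros x. unfold D. rewrite Im_div_R by lra. simpl. rewrite Rplus_0_r.
      intros E. apply Hw. apply (Rmult_eq_reg_r (/ (2 * (2 * INR K')))).
      - rewrite Rmult_0_l. exact E.
      - apply Rinv_neq_0_compat. lra. }
    assert (Dbl : forall x : R, (2 * cotp ((w + x) / RtoC (2 * INR K')) =
       cotp ((w + x) / D) + cotp ((w + (x + 2 * INR K')%R) / D))%C /\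
       cotp ((w + (x + 2 * INR K')%R) / D) = cotp ((w + (x - 2 * INR K')%R) / D)).
    { intros x. assert (Hk0 : RtoC (2 * INR K') <> 0) by (apply RtoC_neq_0; lra).
      replace ((w + (x + 2 * INR K')%R) / D)%C with ((w + x) / D + 1 / 2)%C.
      2:{ rewrite E2, RtoC_plus. field; auto using C2_neq_0. }
      replace ((w + (x - 2 * INR K')%R) / D)%C with ((w + x) / D - 1 / 2)%C.
      2:{ rewrite E2, RtoC_minus. field; auto using C2_neq_0. }
      split; [|apply cotp_half_shift].
      rewrite <- cotp_double by auto. f_equal. f_equal. rewrite E2. field; auto using C2_neq_0. }
    transitivity (2 * (RtoC (2 * INR K') * cotp w))%C; [rewrite E2; ring|].
    rewrite IHk, Cmult_plus_distr_l, <- !sumC_scal.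
    (* Each shift x of the coarse sum splits into x and a shift at distance 2K' from it. Periodicity
       allows the latter to be taken with the sign opposite to x, so the range stays centred;
       [sumC_rev] matches the indices. *)
    assert (F1 : sumC K' (fun i => 2 * cotp ((w + INR i) / RtoC (2 * INR K')))%C =
      (sumC K' (fun j => cotp ((w + INR j) / D)) +
       sumC K' (fun i => cotp ((w - INR (S (K' + i))) / D)))%C).
    { rewrite (sumC_rev K' (fun i => cotp ((w - INR (S (K' + i))) / D))), <- sumC_plus.
      apply sumC_ext. intros i Hi. destruct (Dbl (INR i)) as [D1 D2]. rewrite D1, D2.
      do 3 f_equal. replace (S (K' + (K' - 1 - i)))%nat with (K' + K' - i)%nat by lia.
      rewrite minus_INR, plus_INR by lia. rewrite !RtoC_minus, RtoC_plus, RtoC_mult. ring. }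
    assert (F2 : sumC K' (fun i => 2 * cotp ((w - INR (S i)) / RtoC (2 * INR K')))%C =
      (sumC K' (fun j => cotp ((w - INR (S j)) / D)) +
       sumC K' (fun i => cotp ((w + INR (K' + i)) / D)))%C).
    { rewrite (sumC_rev K' (fun i => cotp ((w + INR (K' + i)) / D))), <- sumC_plus.
      apply sumC_ext. intros i Hi. destruct (Dbl (- INR (S i))) as [D1 _].
      replace (w - INR (S i))%C with (w + (- INR (S i))%R)%C by (rewrite RtoC_opp; ring).
      rewrite D1. do 3 f_equal.
      replace (K' + (K' - 1 - i))%nat with (K' + K' - S i)%nat by lia.
      rewrite minus_INR, plus_INR by lia. rewrite RtoC_plus, !RtoC_minus, RtoC_opp, RtoC_plus, RtoC_mult. ring. }
    rewrite F1, F2. ring.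
Qed.

Lemma exp_le_mono (x y : R) : x <= y -> exp x <= exp y.
Proof. intros [H|H]; [left; apply exp_increasing; auto|rewrite H; lra]. Qed.

Lemma Cexp_taylor1_small (b : C) : Cmod b <= 1 -> Cmod (Cexp b - 1 - b) <= 12 * (Cmod b * Cmod b).
Proof.
  intros H. eapply Rle_trans; [apply Cexp_taylor1|].
  pose proof (exp_le_mono _ _ H). pose proof exp_le_3. pose proof (Cmod_ge_0 b).
  assert (0 <= Cmod b * Cmod b) by (apply Rmult_le_pos; auto). nra.
Qed.

Lemma Cmod_2PIi (w : C) : Cmod (RtoC (2 * PI) * Ci * w) = 2 * PI * Cmod w.
Proof.
  rewrite !Cmod_mult, Cmod_R, Cmod_Ci, Rabs_pos_eq; [ring|]. pose proof PI_RGT_0; lra.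
Qed.

Lemma cotp_near_0 (a : C) : a <> 0 -> 2 * PI * Cmod a <= 1 / 24 ->
  Cmod (a * cotp a - 1) <= 26 * (2 * PI * Cmod a).
Proof.
  intros Ha Hs. rewrite <- Cmod_2PIi in *. unfold cotp, e1.
  set (b := (RtoC (2 * PI) * Ci * a)%C) in *.
  assert (Hb : 0 < Cmod b).
  { unfold b. rewrite Cmod_2PIi. pose proof PI_RGT_0. apply Rmult_lt_0_compat; [lra|].
    apply Cmod_gt_0; auto. }
  pose proof (Cexp_taylor1_small b ltac:(lra)) as T.
  set (d := (Cexp b - 1 - b)%C) in *.
  assert (ED : (Cexp b - 1)%C = (b + d)%C) by (unfold d; ring).
  (* With |b| <= 1/24 the remainder satisfies |d| <= 12 |b|^2 <= |b| / 2. *)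
  assert (HD : Cmod b / 2 <= Cmod (b + d)).
  { pose proof (Cmod_le_add b (- d)) as X. replace (b - - d)%C with (b + d)%C in X by ring.
    rewrite Cmod_opp in X. nra. }
  assert (HD0 : (b + d)%C <> 0) by (apply Cmod_gt_0; lra).
  rewrite ED. replace (Cexp b + 1)%C with (2 + b + d)%C by (unfold d; ring).
  replace (a * (RtoC PI * Ci * (2 + b + d) / (b + d)) - 1)%C
    with ((b / 2 * (b + d) - d) / (b + d))%C.
  2:{ unfold b at 1. replace (RtoC (2 * PI) * Ci * a)%C with b by auto.
      assert (EA : (a * (RtoC PI * Ci))%C = (b / 2)%C)
        by (unfold b; rewrite RtoC_mult; field; auto using C2_neq_0).
      transitivity ((a * (RtoC PI * Ci)) * (2 + b + d) / (b + d) - 1)%C; [|field; auto].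
      rewrite EA. field; auto using C2_neq_0. }
  rewrite Cmod_div by auto.
  assert (HN : Cmod (b / 2 * (b + d) - d) <= 13 * (Cmod b * Cmod b)).
  { eapply Rle_trans; [apply Cmod_sub_triangle|]. rewrite Cmod_mult, Cmod_div, Cmod_R by apply C2_neq_0.
    rewrite (Rabs_pos_eq 2) by lra. pose proof (Cmod_triangle b d). 
    assert (Cmod b / 2 * Cmod (b + d) <= Cmod b / 2 * (Cmod b + 12 * (Cmod b * Cmod b))).
    { apply Rmult_le_compat_l; lra. }
    assert (0 <= Cmod b * Cmod b) by nra. nra. }
  apply (Rmult_le_reg_r (Cmod (b + d))); [lra|].
  unfold Rdiv. rewrite Rmult_assoc, Rinv_l by lra. nra.
Qed.

Lemma sin_ge_half (x : R) : 0 <= x <= PI / 2 -> x / 2 <= sin x.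
Proof.
  intros Hx. pose proof PI_RGT_0 as HP.
  assert (Hc : forall t, 0 <= t <= PI / 4 -> sqrt 2 / 2 <= cos t).
  { intros t Ht. replace (sqrt 2 / 2) with (cos (PI / 4)).
    - apply cos_decr_1; lra.
    - rewrite cos_PI4. pose proof (sqrt_lt_R0 2 ltac:(lra)).
      pose proof (sqrt_sqrt 2 ltac:(lra)).
      apply (Rmult_eq_reg_r (2 * sqrt 2)); [|lra]. field_simplify; [nra|lra]. }
  assert (Hs2 : sqrt 2 / 2 * (sqrt 2 / 2) = 1 / 2).
  { pose proof (sqrt_sqrt 2 ltac:(lra)). lra. }
  pose proof (sqrt_pos 2).
  destruct (MVT_gen sin 0 (x / 2) cos) as [c [Hc1 Hc2]].
  - intros. apply is_derive_sin.
  - intros. apply continuity_sin.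
  - rewrite Rmin_left, Rmax_right in Hc1 by lra.
    rewrite sin_0, !Rminus_0_r in Hc2.
    replace x with (2 * (x / 2)) at 2 by field. rewrite sin_2a, Hc2.
    pose proof (Hc c ltac:(lra)). pose proof (Hc (x / 2) ltac:(lra)).
    assert (1 / 2 <= cos c * cos (x / 2)) by (rewrite <- Hs2; apply Rmult_le_compat; lra).
    nra.
Qed.

Lemma e1_real (b : R) : e1 b = (cos (2 * PI * b), sin (2 * PI * b)).
Proof.
  unfold e1. rewrite <- Cexp_iR. f_equal. rewrite !RtoC_mult. ring.
Qed.

(** With A = e1 a the pair equals 2 PI i (A - 1/A) / (A + 1/A - 2 cos (2 PI b)): the numerator is
    O(|a|), and the denominator is 2 - 2 cos (2 PI b) up to O(|a|^2). After scaling this yields the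
    1/n^2 majorant of the partial fractions. *)
Lemma cotp_pair_bound (a : C) (b : R) : 2 * PI * Cmod a <= 1 -> Im a <> 0 ->
  0 <= b <= 1 / 2 -> 24 * (2 * PI * Cmod a) ^ 2 < 9 * b ^ 2 ->
  Cmod (cotp (a + b) + cotp (a - b)) <=
    2 * PI * (26 * (2 * PI * Cmod a)) / (9 * b ^ 2 - 24 * (2 * PI * Cmod a) ^ 2).
Proof.
  intros Hs Ha Hb Hlt.
  assert (HA : e1 a <> 0) by apply e1_neq_0.
  assert (HB : e1 b <> 0) by apply e1_neq_0.
  assert (N1 : (e1 a * e1 b - 1)%C <> 0).
  { rewrite <- e1_add. apply e1_neq_1. simpl. rewrite Rplus_0_r. exact Ha. }
  assert (N2 : (e1 a * / e1 b - 1)%C <> 0).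
  { rewrite <- e1_opp, <- e1_add. apply e1_neq_1. simpl. rewrite Ropp_0, Rplus_0_r. exact Ha. }
  assert (N2' : (e1 a - e1 b)%C <> 0).
  { intros E. apply N2. replace (e1 a * / e1 b - 1)%C with ((e1 a - e1 b) * / e1 b)%C by (field; auto).
    rewrite E. ring. }
  set (c := RtoC (2 * cos (2 * PI * b))).
  assert (Ec : (e1 b + / e1 b)%C = c).
  { rewrite <- e1_opp. replace (- RtoC b)%C with (RtoC (- b)) by (rewrite RtoC_opp; auto).
    rewrite !e1_real. replace (2 * PI * - b) with (- (2 * PI * b)) by ring.
    rewrite cos_neg, sin_neg. unfold c. apply C_eq; simpl; ring. }
  set (Q := (e1 a + / e1 a - c)%C).
  assert (EQ : Q = ((e1 a * e1 b - 1) * (e1 a * / e1 b - 1) / e1 a)%C).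
  { unfold Q. rewrite <- Ec. field. auto. }
  assert (HQ : Q <> 0).
  { rewrite EQ. apply Cmult_neq_0; [apply Cmult_neq_0; auto|]. apply Cinv_neq_0; auto. }
  assert (E : (cotp (a + b) + cotp (a - b) = 2 * PI * Ci * (e1 a - / e1 a) / Q)%C).
  { replace (a - b)%C with (a + - b)%C by ring. unfold cotp.
    rewrite !e1_add, !e1_opp, EQ. field.
    repeat split; auto. }
  set (be := (RtoC (2 * PI) * Ci * a)%C).
  assert (Hbe : Cmod be = 2 * PI * Cmod a) by apply Cmod_2PIi.
  pose proof (Cexp_taylor1_small be ltac:(lra)) as T1.
  pose proof (Cexp_taylor1_small (- be) ltac:(rewrite Cmod_opp; lra)) as T2.
  rewrite Cmod_opp in T2. rewrite Hbe in T1, T2.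
  assert (EA : e1 a = Cexp be) by auto.
  assert (EA' : (/ e1 a)%C = Cexp (- be)) by (rewrite EA, Cexp_opp; auto).
  set (r := 2 * PI * Cmod a) in *.
  assert (Hr : 0 <= r) by (rewrite <- Hbe; apply Cmod_ge_0).
  assert (HN : Cmod (e1 a - / e1 a) <= 26 * r).
  { rewrite EA', EA.
    replace (Cexp be - Cexp (- be))%C
      with ((Cexp be - 1 - be) - (Cexp (- be) - 1 - - be) + 2 * be)%C by ring.
    eapply Rle_trans; [apply Cmod_triangle|].
    pose proof (Cmod_sub_triangle (Cexp be - 1 - be) (Cexp (- be) - 1 - - be)).
    rewrite Cmod_mult, Cmod_R, Rabs_pos_eq by lra. rewrite Hbe. nra. }
  assert (HQb : 9 * b ^ 2 - 24 * r ^ 2 <= Cmod Q).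
  { replace Q with ((RtoC (2 - 2 * cos (2 * PI * b))) + ((Cexp be - 1 - be) + (Cexp (- be) - 1 - - be)))%C.
    2:{ unfold Q, c. rewrite EA', EA, RtoC_minus. ring. }
    set (D := ((Cexp be - 1 - be) + (Cexp (- be) - 1 - - be))%C).
    assert (HDm : Cmod D <= 24 * r ^ 2).
    { eapply Rle_trans; [apply Cmod_triangle|]. nra. }
    (* 2 - 2 cos (2 PI b) = 4 sin^2 (PI b), and sin (PI b) >= PI b / 2 >= 3 b / 2. *)
    assert (Hcos : 9 * b ^ 2 <= 2 - 2 * cos (2 * PI * b)).
    { pose proof (cos_sub1 (2 * PI * b)) as X. replace (2 * PI * b / 2) with (PI * b) in X by field.
      pose proof PI2_3_2. 
      assert (HPb : 0 <= PI * b <= PI / 2) by nra.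
      pose proof (sin_ge_half _ HPb). assert (3 * b / 2 <= sin (PI * b)) by nra.
      assert (3 * b / 2 * (3 * b / 2) <= sin (PI * b) * sin (PI * b)) by (apply Rmult_le_compat; nra).
      nra. }
    pose proof (Cmod_le_add (RtoC (2 - 2 * cos (2 * PI * b))) (- D)) as X.
    rewrite Cmod_opp, Cmod_R, Rabs_pos_eq in X by nra.
    replace (RtoC (2 - 2 * cos (2 * PI * b)) - - D)%C with (RtoC (2 - 2 * cos (2 * PI * b)) + D)%C in X by ring.
    lra. }
  rewrite E, Cmod_div, !Cmod_mult, Cmod_Ci, !Cmod_R by auto.
  pose proof PI_RGT_0. rewrite !Rabs_pos_eq by lra. rewrite Rmult_1_r.
  unfold Rdiv. apply Rmult_le_compat.
  - apply Rmult_le_pos; [lra|apply Cmod_ge_0].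
  - left. apply Rinv_0_lt_compat. apply Cmod_gt_0; auto.
  - apply Rmult_le_compat_l; lra.
  - apply Rinv_le_contravar; lra.
Qed.

Lemma INR_S_pos (n : nat) : 0 < INR (S n).
Proof. apply lt_0_INR. lia. Qed.

Lemma ex_series_inv_sqr : ex_series (fun n => / (INR (S n) * INR (S n))).
Proof.
  apply (ex_series_dominated _
     (fun n => 2 * (/ (INR (S n)) - / INR (S (S n))))).
  - intros n. pose proof (INR_S_pos n). pose proof (INR_S_pos (S n)).
    assert (E : INR (S (S n)) = INR (S n) + 1) by apply S_INR.
    rewrite E in *. set (x := INR (S n)) in *.
    assert (1 <= x) by (unfold x; rewrite S_INR; pose proof (pos_INR n); lra).
    split; [left; apply Rinv_0_lt_compat; nra|].
    replace (2 * (/ x - / (x + 1))) with (2 * / (x * (x + 1))) by (field; lra).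
    rewrite <- (Rinv_inv 2), <- Rinv_mult. apply Rinv_le_contravar; nra.
  - exists 2. apply is_series_sumR.
    apply (is_lim_seq_ext (fun n => 2 * (1 - / INR (S n)))).
    { intros n. induction n.
      - unfold sumR; simpl. field.
      - rewrite sumR_S, <- IHn. ring. }
    replace (Finite 2) with (Rbar_mult 2 (Finite (1 - 0))) by (simpl; f_equal; ring).
    apply is_lim_seq_scal_l, is_lim_seq_minus'; [apply is_lim_seq_const|].
    apply (is_lim_seq_incr_1 (fun n => / INR n)).
    apply (is_lim_seq_inv INR p_infty); [apply is_lim_seq_INR|discriminate].
Qed.

Lemma pow2_large (M : R) : exists N, forall k, (N <= k)%nat -> M <= INR (2 ^ k).
Proof.
  destruct (INR_unbounded M) as [N HN]. exists N. intros k Hk.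
  apply Rle_trans with (INR k); [apply Rle_trans with (INR N); [lra|apply le_INR; auto]|].
  apply le_INR. pose proof (Nat.pow_gt_lin_r 2 k ltac:(lia)). lia.
Qed.

Lemma nonreal_neq_0 (x : C) : Im x <> 0 -> x <> 0.
Proof. intros H E. rewrite E in H. apply H. reflexivity. Qed.

Lemma cotp_scaled_lim (x : C) : Im x <> 0 ->
  Clim (fun k => / RtoC (2 * INR (2 ^ k)) * cotp (x / RtoC (2 * INR (2 ^ k))))%C (/ x).
Proof.
  intros Hx eps Heps. pose proof PI_RGT_0 as HPI.
  pose proof (nonreal_neq_0 x Hx) as Hx0. pose proof (proj1 (Cmod_gt_0 x) Hx0) as Hm.
  destruct (pow2_large (24 * (2 * PI * Cmod x) + (26 * (2 * PI) / eps + 1))) as [N HN].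
  exists N. intros k Hk. specialize (HN k Hk). set (D := 2 * INR (2 ^ k)) in *.
  assert (HE : 0 < 26 * (2 * PI) / eps) by (apply Rdiv_lt_0_compat; lra).
  assert (HPx : 0 < 2 * PI * Cmod x) by (apply Rmult_lt_0_compat; lra).
  assert (HD : 24 * (2 * PI * Cmod x) + (26 * (2 * PI) / eps + 1) < D) by (unfold D; lra).
  assert (HD0 : 0 < D) by lra.
  assert (HDC : RtoC D <> 0) by (apply RtoC_neq_0; lra).
  assert (HxD : Cmod (x / RtoC D) = Cmod x / D).
  { rewrite Cmod_div, Cmod_R, Rabs_pos_eq; auto; lra. }
  assert (A : Cmod (x / RtoC D * cotp (x / RtoC D) - 1) <= 26 * (2 * PI * Cmod (x / RtoC D))).
  { apply cotp_near_0.
    - apply Cmult_neq_0; auto. apply Cinv_neq_0; auto.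
    - rewrite HxD. apply (Rmult_le_reg_r D); auto. unfold Rdiv.
      rewrite <- Rmult_assoc, (Rmult_assoc _ (/ D)), Rinv_l by lra. lra. }
  replace (/ RtoC D * cotp (x / RtoC D) - / x)%C
    with (/ x * (x / RtoC D * cotp (x / RtoC D) - 1))%C by (field; auto).
  rewrite Cmod_mult, Cmod_inv by auto.
  eapply Rle_lt_trans; [apply Rmult_le_compat_l; [left; apply Rinv_0_lt_compat; auto|apply A]|].
  rewrite HxD. replace (/ Cmod x * (26 * (2 * PI * (Cmod x / D)))) with (26 * (2 * PI) / D) by (field; lra).
  apply (Rmult_lt_reg_r D); auto. unfold Rdiv at 1. rewrite Rmult_assoc, Rinv_l by lra.
  assert (26 * (2 * PI) / eps * eps < D * eps) by (apply Rmult_lt_compat_r; lra).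
  replace (26 * (2 * PI) / eps * eps) with (26 * (2 * PI)) in H by (field; lra). lra.
Qed.

(** The shift -K has no partner +K. Its argument tends to -1/2, near which [cotp] is bounded, and
    the factor 1 / (2K) sends the term to 0. *)
Lemma cotp_edge_lim (w : C) : Im w <> 0 ->
  Clim (fun k => / RtoC (2 * INR (2 ^ k)) *
     cotp ((w - INR (2 ^ k)) / RtoC (2 * INR (2 ^ k))))%C 0.
Proof.
  intros Hx eps Heps. pose proof PI_RGT_0 as HPI. pose proof (Cmod_ge_0 w) as Hm.
  assert (HPx : 0 <= 2 * PI * Cmod w) by (apply Rmult_le_pos; lra).
  assert (HE : 0 < PI / eps) by (apply Rdiv_lt_0_compat; lra).
  destruct (pow2_large (24 * (2 * PI * Cmod w) + (PI / eps + 1))) as [N HN].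
  exists N. intros k Hk. specialize (HN k Hk). set (K := INR (2 ^ k)) in *. set (D := 2 * K).
  assert (HD : 24 * (2 * PI * Cmod w) + (PI / eps + 1) < D) by (unfold D; lra).
  assert (HD0 : 0 < D) by lra.
  assert (HDC : RtoC D <> 0) by (apply RtoC_neq_0; lra).
  replace ((w - K) / RtoC D)%C with (w / RtoC D + - (1 / 2))%C.
  2:{ unfold D in *. rewrite RtoC_mult in *. field.
      apply RtoC_neq_0. lra. }
  assert (HwD : Cmod (w / RtoC D) = Cmod w / D).
  { rewrite Cmod_div, Cmod_R, Rabs_pos_eq; auto; lra. }
  set (b := (RtoC (2 * PI) * Ci * (w / RtoC D))%C).
  assert (Hb : Cmod b <= 1 / 24).
  { unfold b. rewrite Cmod_2PIi, HwD. apply (Rmult_le_reg_r D); auto. unfold Rdiv.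
    rewrite <- Rmult_assoc, (Rmult_assoc _ (/ D)), Rinv_l by lra. lra. }
  pose proof (Cexp_taylor1_small b ltac:(lra)) as T.
  set (E := e1 (w / RtoC D)). change (Cexp b) with E in T.
  assert (HE1 : Cmod (E - 1) <= 1).
  { pose proof (Cmod_le_add (E - 1) b). pose proof (Cmod_ge_0 b). nra. }
  assert (HE2 : 1 <= Cmod (E + 1)).
  { pose proof (Cmod_le_add 2 (1 - E)) as X. replace (2 - (1 - E))%C with (E + 1)%C in X by ring.
    rewrite Cmod_R, Rabs_pos_eq in X by lra. rewrite Cmod_minus_sym in HE1. lra. }
  assert (HE3 : (E + 1)%C <> 0) by (apply Cmod_gt_0; lra).
  assert (HC : cotp (w / RtoC D + - (1 / 2)) = (RtoC PI * Ci * (E - 1) / (E + 1))%C).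
  { unfold cotp. rewrite e1_add, e1_opp, e1_half. fold E.
    replace (/ - (1))%C with (- (1))%C by (field; apply RtoC_neq_0; lra).
    field. split; auto. intros Z. apply HE3. transitivity (- (E * RtoC (-1) - 1))%C; [ring|].
    rewrite Z. ring. }
  rewrite HC. replace (/ RtoC D * (RtoC PI * Ci * (E - 1) / (E + 1)) - 0)%C
    with (/ RtoC D * (RtoC PI * Ci * (E - 1) / (E + 1)))%C by ring.
  rewrite Cmod_mult, Cmod_inv, Cmod_div, !Cmod_mult, Cmod_Ci, !Cmod_R by auto.
  rewrite !Rabs_pos_eq by lra.
  apply Rle_lt_trans with (/ D * PI).
  - apply Rmult_le_compat_l; [left; apply Rinv_0_lt_compat; auto|].
    apply (Rmult_le_reg_r (Cmod (E + 1))); [lra|]. unfold Rdiv.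
    rewrite Rmult_assoc, Rinv_l by lra. pose proof (Cmod_ge_0 (E - 1)). nra.
  - apply (Rmult_lt_reg_r D); auto. rewrite (Rmult_comm (/ D)), Rmult_assoc, Rinv_l by lra.
    assert (PI / eps * eps < D * eps) by (apply Rmult_lt_compat_r; lra).
    replace (PI / eps * eps) with PI in H by (field; lra). lra.
Qed.

(** The multiplication formula divided by 2K, with the shifts n and -n paired; the pairing gives a
    majorant of order 1/n^2 that is uniform in K, as [tannery] requires. The unpaired shift 0 tends
    to 1/w and the unpaired shift -K to 0. *)
Theorem cotp_series (w : C) : upper w ->
  Cser (fun n => / (w + INR (S n)) + / (w - INR (S n)))%C (cotp w - / w).
Proof.
  intros Hw. assert (Hi : Im w <> 0) by (unfold upper in Hw; lra).
  pose proof PI_RGT_0 as HPI.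
  set (D := fun k => 2 * INR (2 ^ k)).
  assert (HD : forall k, 0 < D k) by (intros k; unfold D; pose proof (INR_pow2_pos k); lra).
  assert (HDC : forall k, RtoC (D k) <> 0) by (intros k; apply RtoC_neq_0; pose proof (HD k); lra).
  set (f := fun k i => (/ RtoC (D k) * (cotp ((w + INR (S i)) / RtoC (D k)) +
                cotp ((w - INR (S i)) / RtoC (D k))))%C).
  set (u := fun k i => if Nat.ltb (S i) (2 ^ k) then f k i else RtoC 0).
  set (s := fun k => (cotp w - / RtoC (D k) * cotp (w / RtoC (D k))
              - / RtoC (D k) * cotp ((w - INR (2 ^ k)) / RtoC (D k)))%C).
  set (r0 := 2 * PI * Cmod w).
  assert (Hr0 : 0 <= r0) by (unfold r0; pose proof (Cmod_ge_0 w); apply Rmult_le_pos; lra).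
  destruct (INR_unbounded (2 * r0)) as [J HJ].
  destruct (pow2_large r0) as [N0 HN0].
  destruct (tannery u (fun n => / (w + INR (S n)) + / (w - INR (S n)))%C s
     (fun n => 2 * PI * 26 * r0 / 3 * / (INR (S n) * INR (S n))) N0 J) as [A1 A2].
  - apply ex_series_scal_R. apply ex_series_inv_sqr.
  - intros k i Hk HiJ. unfold u.
    assert (HB0 : 0 < / (INR (S i) * INR (S i))).
    { apply Rinv_0_lt_compat. pose proof (INR_S_pos i). nra. }
    destruct (Nat.ltb_spec (S i) (2 ^ k)) as [HiK|_].
    2:{ rewrite Cmod_0. apply Rmult_le_pos; [|lra]. apply Rmult_le_pos; [|lra]. nra. }
    unfold f. specialize (HD k). specialize (HN0 k Hk).
    assert (HK2 : r0 <= D k) by (unfold D in *; lra).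
    set (d := D k) in *. rewrite Cmod_mult, Cmod_inv, Cmod_R, Rabs_pos_eq by (lra || apply HDC).
    set (x := INR (S i)) in *.
    assert (Hx : 2 * r0 <= x /\ 0 < x).
    { unfold x. apply le_INR in HiJ. rewrite S_INR. pose proof (pos_INR i). lra. }
    assert (Hxd : 2 * x <= d).
    { unfold x, d, D. apply Rmult_le_compat_l; [lra|]. apply le_INR. lia. }
    replace ((w + x) / RtoC d)%C with (w / RtoC d + RtoC (x / d))%C
      by (rewrite RtoC_div by lra; field; apply HDC).
    replace ((w - x) / RtoC d)%C with (w / RtoC d - RtoC (x / d))%C
      by (rewrite RtoC_div by lra; field; apply HDC).
    assert (EM : 2 * PI * Cmod (w / RtoC d) = r0 / d).
    { rewrite Cmod_div, Cmod_R, Rabs_pos_eq by (lra || apply HDC). unfold r0. field. lra. }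
    assert (Hrx : r0 * r0 <= x * x / 4) by nra.
    assert (Hid : 0 < / d) by (apply Rinv_0_lt_compat; auto).
    assert (HQ : 3 * (x / d) ^ 2 <= 9 * (x / d) ^ 2 - 24 * (r0 / d) ^ 2).
    { unfold Rdiv in *. set (id := / d) in *. assert (0 < id * id) by nra.
      replace (9 * (x * id) ^ 2 - 24 * (r0 * id) ^ 2) with ((9 * (x * x) - 24 * (r0 * r0)) * (id * id)) by ring.
      replace (3 * (x * id) ^ 2) with ((3 * (x * x)) * (id * id)) by ring.
      apply Rmult_le_compat_r; nra. }
    assert (Hxd0 : 0 < x / d) by (apply Rdiv_lt_0_compat; lra).
    assert (HQ0 : 0 < 3 * (x / d) ^ 2) by (simpl; nra).
    pose proof (cotp_pair_bound (w / RtoC d) (x / d)) as P. rewrite EM in P.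
    eapply Rle_trans.
    { apply Rmult_le_compat_l; [lra|]. apply P.
      - apply (Rmult_le_reg_r d); auto. unfold Rdiv. rewrite Rmult_assoc, Rinv_l by lra. lra.
      - rewrite Im_div_R by lra. apply Rmult_integral_contrapositive. split; auto.
        apply Rinv_neq_0_compat. lra.
      - split; [lra|]. apply (Rmult_le_reg_r d); auto. unfold Rdiv.
        rewrite Rmult_assoc, Rinv_l by lra. lra.
      - lra. }
    apply Rle_trans with (/ d * (2 * PI * (26 * (r0 / d)) / (3 * (x / d) ^ 2))).
    + apply Rmult_le_compat_l; [lra|]. unfold Rdiv at 1 5. apply Rmult_le_compat_l.
      * apply Rmult_le_pos; [lra|]. apply Rmult_le_pos; [lra|]. unfold Rdiv. nra.
      * apply Rinv_le_contravar; lra.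
    + apply Req_le. field. lra.
  - intros i.
    assert (L : Clim (fun k => f k i) (/ (w + INR (S i)) + / (w - INR (S i)))).
    { apply (Clim_ext (fun k => / RtoC (2 * INR (2 ^ k)) * cotp ((w + INR (S i)) / RtoC (2 * INR (2 ^ k)))
        + / RtoC (2 * INR (2 ^ k)) * cotp ((w - INR (S i)) / RtoC (2 * INR (2 ^ k))))%C).
      - intros k. unfold f, D. ring.
      - apply Clim_plus; apply cotp_scaled_lim; simpl; unfold Im in *; simpl; lra. }
    apply (Clim_ext_ev (fun k => f k i) _ _ (S i)); auto.
    intros k Hk. unfold u. destruct (Nat.ltb_spec (S i) (2 ^ k)) as [_|HiK]; auto.
    pose proof (Nat.pow_gt_lin_r 2 k ltac:(lia)). lia.
  - intros k. set (K := (2 ^ k)%nat).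
    assert (HK : K <> O) by (apply Nat.pow_nonzero; lia).
    replace (s k) with (sumC (K - 1) (u k)).
    { apply Cser_finite. intros n Hn. unfold u. destruct (Nat.ltb_spec (S n) (2 ^ k)); auto.
      fold K in H. lia. }
    pose proof (cotp_multiplication k w Hi) as M. cbv zeta in M. fold K in M.
    replace K with (S (K - 1)) in M at 2 3 by lia.
    change (RtoC (2 * INR K)) with (RtoC (D k)) in M.
    rewrite sumC_shift, sumC_S in M.
    assert (F : (RtoC (D k) * sumC (K - 1) (u k) =
      sumC (K - 1) (fun j => cotp ((w + INR (S j)) / RtoC (D k))) +
      sumC (K - 1) (fun j => cotp ((w - INR (S j)) / RtoC (D k))))%C).
    { rewrite <- sumC_scal, <- sumC_plus. apply sumC_ext. intros j Hj. unfold u.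
      destruct (Nat.ltb_spec (S j) (2 ^ k)) as [_|HiK]; [|fold K in HiK; lia].
      unfold f. field. apply HDC. }
    replace (S (K - 1)) with K in M by lia.
    replace (w + INR 0)%C with w in M by (simpl; ring).
    assert (G : (sumC (K - 1) (u k) = / RtoC (D k) * (RtoC (D k) * sumC (K - 1) (u k)))%C)
      by (field; apply HDC).
    rewrite G, F. unfold s. fold K.
    replace (cotp w) with (/ RtoC (D k) * (RtoC (D k) * cotp w))%C by (field; apply HDC).
    rewrite M. field. apply HDC.
  - replace (cotp w - / w)%C with (CS (fun n : nat => (/ (w + INR (S n)) + / (w - INR (S n)))%C)); auto.
    apply (Clim_unique s); auto.
    replace (cotp w - / w)%C with (cotp w - / w - 0)%C by ring.
    apply Clim_minus; [apply Clim_minus; [apply Clim_const|]|].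
    + apply cotp_scaled_lim; auto.
    + apply cotp_edge_lim; auto.
Qed.

(** [PI^2 / sin^2 (PI * w)] *)
Definition sinp2 (w : C) : C := (- RtoC (4 * (PI * PI)) * e1 w / ((e1 w - 1) * (e1 w - 1)))%C.

Lemma Cdrv_cotp (w : C) : Im w <> 0 -> Cdrv cotp w (- sinp2 w).
Proof.
  intros Hw. assert (N := e1_neq_1 w Hw).
  assert (De : Cdrv e1 w (RtoC (2 * PI) * Ci * e1 w)%C) by apply Cdrv_cexp_lin.
  assert (Dp : Cdrv (fun w => RtoC PI * Ci * (e1 w + 1))%C w (RtoC PI * Ci * (RtoC (2 * PI) * Ci * e1 w))%C).
  { eapply Cdrv_val; [apply Cdrv_scal, Cdrv_plus; [apply De|apply Cdrv_const]|]. ring. }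
  assert (Dm : Cdrv (fun w => e1 w - 1)%C w (RtoC (2 * PI) * Ci * e1 w)%C).
  { eapply Cdrv_val; [apply Cdrv_minus; [apply De|apply Cdrv_const]|]. ring. }
  eapply Cdrv_val; [apply (Cdrv_mult _ _ _ _ _ Dp (Cdrv_inv (fun w => e1 w - 1)%C w _ N Dm))|].
  assert (Ci2 : (Ci * Ci = - (1))%C) by (apply C_eq; simpl; ring).
  unfold sinp2. rewrite !RtoC_mult.
  transitivity ((Ci * Ci) * (RtoC PI * RtoC PI) * RtoC 2 * e1 w * ((e1 w - 1) - (e1 w + 1)) / ((e1 w - 1) * (e1 w - 1)))%C.
  - field. auto.
  - rewrite Ci2. replace (RtoC 4) with (RtoC 2 * RtoC 2)%C by (rewrite <- RtoC_mult; f_equal; ring).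
    field. auto.
Qed.

(** The product of m z + nu with the conjugate of z has imaginary part - nu Im z. The resulting
    lower bound is uniform in m. *)
Lemma lattice_bound (z : C) (m nu : R) : nu * nu * (Im z * Im z) <= Cmod (m * z + nu) ^ 2 * Cmod z ^ 2.
Proof.
  rewrite !Cmod_sqr. destruct z as [x y]; simpl.
  assert (0 <= (m * (x * x + y * y) + nu * x) * (m * (x * x + y * y) + nu * x))
    by apply Rle_0_sqr.
  match goal with |- ?A <= ?B =>
    replace B with (A + (m * (x * x + y * y) + nu * x) * (m * (x * x + y * y) + nu * x)) by ring
  end.
  lra.
Qed.

(** * The weight-2 lattice sum *)

Lemma inv_taylor (a h : C) : a <> 0 -> (a + h)%C <> 0 ->
  (/ (a + h) - / a - h * - / (a * a))%C = (h * h / (a * a * (a + h)))%C.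
Proof. intros. field. auto. Qed.

Lemma inv_taylor_bound (w : C) (x : R) (h : C) : upper w -> x <> 0 -> Cmod h < Im w / 2 ->
  Cmod (/ (w + h + x) - / (w + x) - h * - / ((w + x) * (w + x))) <=
  Cmod w ^ 2 / (Im w * Im w) * (2 / Im w) * / (x * x) * (Cmod h * Cmod h).
Proof.
  intros Hw Hx Hh. unfold upper in Hw.
  assert (L := lattice_bound w 1 x). replace (1 * w + x)%C with (w + x)%C in L by ring.
  assert (I1 : Im (w + x)%C = Im w) by (simpl; unfold Im; ring).
  assert (H1 : (w + x)%C <> 0) by (apply nonreal_neq_0; lra).
  assert (B2 : Im w / 2 <= Cmod (w + x + h)).
  { eapply Rle_trans; [|apply Im_le_Cmod]. eapply Rle_trans; [|apply Rle_abs].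
    pose proof (Im_le_Cmod h) as X. apply Rabs_le_between in X.
    change (Im (w + x + h)) with (Im (w + x) + Im h). rewrite I1. lra. }
  assert (H2 : (w + x + h)%C <> 0) by (apply Cmod_gt_0; lra).
  replace (w + h + x)%C with (w + x + h)%C by ring.
  rewrite inv_taylor by auto.
  rewrite Cmod_div, !Cmod_mult by (repeat apply Cmult_neq_0; auto).
  pose proof (proj1 (Cmod_gt_0 _) H1) as P1. pose proof (proj1 (Cmod_gt_0 _) H2) as P2.
  set (A := Cmod (w + x)) in *. set (D := Cmod (w + x + h)) in *. set (W := Cmod w) in *.
  assert (Hxx : 0 < x * x) by nra.
  unfold Rdiv. rewrite Rmult_comm. apply Rmult_le_compat_r.
  { apply Rmult_le_pos; apply Cmod_ge_0. }
  assert (HW : 0 < W ^ 2).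
  { assert (0 < x * x * (Im w * Im w)) by (apply Rmult_lt_0_compat; auto; apply Rmult_lt_0_compat; auto).
    assert (0 < A ^ 2) by (apply pow_lt; auto).
    pose proof (pow2_ge_0 W). nra. }
  rewrite Rinv_mult.
  replace (W ^ 2 * / (Im w * Im w) * (2 * / Im w) * / (x * x))
    with ((W ^ 2 * / (x * x * (Im w * Im w))) * (/ (Im w * / 2))) by (field; lra).
  apply Rmult_le_compat.
  - left; apply Rinv_0_lt_compat; nra.
  - left; apply Rinv_0_lt_compat; auto.
  - apply (Rmult_le_reg_r (A * A * (x * x * (Im w * Im w)))).
    { apply Rmult_lt_0_compat; apply Rmult_lt_0_compat; auto. apply Rmult_lt_0_compat; auto. }
    replace (/ (A * A) * (A * A * (x * x * (Im w * Im w)))) with (x * x * (Im w * Im w)) by (field; lra).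
    replace (W ^ 2 * / (x * x * (Im w * Im w)) * (A * A * (x * x * (Im w * Im w))))
      with (A ^ 2 * W ^ 2) by (field; lra).
    exact L.
  - apply Rinv_le_contravar; lra.
Qed.

Lemma Cmod_upper_inv_sqr (w : C) (x : R) : upper w -> x <> 0 ->
  Cmod (/ ((w + x) * (w + x))) <= Cmod w ^ 2 / (Im w * Im w) * / (x * x).
Proof.
  intros Hw Hx. unfold upper in Hw.
  assert (L := lattice_bound w 1 x). replace (1 * w + x)%C with (w + x)%C in L by ring.
  assert (I1 : Im (w + x)%C = Im w) by (simpl; unfold Im; ring).
  assert (H1 : (w + x)%C <> 0) by (apply nonreal_neq_0; lra).
  rewrite Cmod_inv, Cmod_mult by (apply Cmult_neq_0; auto).
  pose proof (proj1 (Cmod_gt_0 _) H1) as P1.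
  set (A := Cmod (w + x)) in *. set (W := Cmod w) in *.
  assert (Hxx : 0 < x * x) by nra.
  apply (Rmult_le_reg_r (A * A * (x * x * (Im w * Im w)))).
  { apply Rmult_lt_0_compat; apply Rmult_lt_0_compat; auto. apply Rmult_lt_0_compat; auto. }
  replace (/ (A * A) * (A * A * (x * x * (Im w * Im w)))) with (x * x * (Im w * Im w)) by (field; lra).
  replace (W ^ 2 / (Im w * Im w) * / (x * x) * (A * A * (x * x * (Im w * Im w))))
      with (A ^ 2 * W ^ 2) by (field; lra).
  exact L.
Qed.

(** Minus the derivative of the cotangent series, computed once termwise by [Cser_derive] and once
    in closed form by [Cdrv_cotp]. *)
Theorem sinp2_series (w : C) : upper w ->
  Cser (fun n => / ((w + INR (S n)) * (w + INR (S n))) + / ((w - INR (S n)) * (w - INR (S n))))%C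
    (sinp2 w - / (w * w)).
Proof.
  intros Hw. assert (Hw' := Hw). unfold upper in Hw'.
  set (u' := fun n => (/ ((w + INR (S n)) * (w + INR (S n))) + / ((w - INR (S n)) * (w - INR (S n))))%C).
  set (c := Cmod w ^ 2 / (Im w * Im w)).
  assert (Hm : forall n, (w - INR (S n))%C = (w + (- INR (S n))%R)%C)
    by (intros; rewrite RtoC_opp; ring).
  assert (Hsq : forall x, / (- x * - x) = / (x * x)) by (intros; f_equal; ring).
  assert (HV : Cser u' (CS u')).
  { apply (Cser_CS _ (fun n => 2 * c * / (INR (S n) * INR (S n))) 0).
    - intros n _. unfold u'. pose proof (INR_S_pos n) as HS. eapply Rle_trans; [apply Cmod_triangle|].
      rewrite Hm. pose proof (Cmod_upper_inv_sqr w (INR (S n)) Hw ltac:(lra)).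
      pose proof (Cmod_upper_inv_sqr w (- INR (S n)) Hw ltac:(lra)) as X. rewrite Hsq in X.
      fold c in H, X. lra.
    - apply ex_series_scal_R, ex_series_inv_sqr. }
  assert (D1 : Cdrv (fun w => cotp w - / w)%C w (- CS u')).
  { apply (Cser_derive (fun n w => / (w + INR (S n)) + / (w - INR (S n)))%C (fun n => - u' n)%C w (Im w / 2)
      (fun n => 2 * (c * (2 / Im w)) * / (INR (S n) * INR (S n)))).
    - lra.
    - apply ex_series_scal_R, ex_series_inv_sqr.
    - intros n w1 H1. set (h := (w1 - w)%C) in *. pose proof (INR_S_pos n) as HS.
      replace w1 with (w + h)%C by (unfold h; ring).
      pose proof (inv_taylor_bound w (INR (S n)) h Hw ltac:(lra) H1) as A1.
      pose proof (inv_taylor_bound w (- INR (S n)) h Hw ltac:(lra) H1) as A2.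
      rewrite Hsq in A2. fold c in A1, A2.
      set (x := INR (S n)) in *.
      replace (/ (w + h + x) + / (w + h - x) - (/ (w + x) + / (w - x)) - h * - u' n)%C
        with ((/ (w + h + x) - / (w + x) - h * - / ((w + x) * (w + x)))
           + (/ (w + h + (- x)%R) - / (w + (- x)%R) - h * - / ((w + (- x)%R) * (w + (- x)%R))))%C.
      2:{ unfold u', Cminus. fold x. rewrite RtoC_opp. ring. }
      eapply Rle_trans; [apply Cmod_triangle|]. lra.
    - intros w1 H1. apply cotp_series. apply (upper_near w); auto.
    - apply (Cser_ext (fun n => - (1) * u' n)%C); [intros; ring|].
      replace (- CS u')%C with (- (1) * CS u')%C by ring. apply Cser_scal; auto. }
  assert (D2 : Cdrv (fun w => cotp w - / w)%C w (- sinp2 w - - / (w * w))).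
  { apply Cdrv_minus; [apply Cdrv_cotp; lra|]. apply Cdrv_inv_id, nonreal_neq_0. lra. }
  pose proof (Cdrv_unique _ _ _ _ D1 D2) as E.
  replace (sinp2 w - / (w * w))%C with (- (- sinp2 w - - / (w * w)))%C by ring.
  rewrite <- E. replace (- - CS u')%C with (CS u') by ring. auto.
Qed.

(** * The Lambert series of E2 *)

Lemma sumR_ext (n : nat) (f g : nat -> R) :
  (forall i, (i < n)%nat -> f i = g i) -> sumR n f = sumR n g.
Proof.
  induction n; intros H; [reflexivity|]. rewrite !sumR_S, IHn, H; auto.
Qed.

(** (N + M - 1) / M counts the multiples of M below N. Spreading a row over these multiples turns
    its column index into the exponent of q. *)
Lemma sumR_multiples (M : nat) (v : nat -> R) (N : nat) : (0 < M)%nat ->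
  sumR N (fun n => if Nat.eqb (n mod M) 0 then v (n / M)%nat else 0) = sumR ((N + M - 1) / M) v.
Proof.
  intros HM. induction N.
  - rewrite Nat.div_small by lia. reflexivity.
  - rewrite sumR_S, IHN. pose proof (Nat.div_mod N M ltac:(lia)) as E.
    pose proof (Nat.mod_upper_bound N M ltac:(lia)) as B.
    set (q := (N / M)%nat) in *. set (r := (N mod M)%nat) in *.
    destruct (Nat.eqb_spec r 0) as [Hr|Hr].
    + replace ((N + M - 1) / M)%nat with q by (apply (Nat.div_unique _ _ _ (M - 1)); lia).
      replace ((S N + M - 1) / M)%nat with (S q) by (apply (Nat.div_unique _ _ _ 0); lia).
      rewrite sumR_S. auto.
    + replace ((N + M - 1) / M)%nat with (S q) by (apply (Nat.div_unique _ _ _ (r - 1)); lia).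
      replace ((S N + M - 1) / M)%nat with (S q) by (apply (Nat.div_unique _ _ _ r); lia).
      ring.
Qed.

Lemma Cser_multiples (M : nat) (v : nat -> C) (s : C) : (0 < M)%nat -> Cser v s ->
  Cser (fun n => if Nat.eqb (n mod M) 0 then v (n / M)%nat else 0) s.
Proof.
  intros HM H.
  apply (Clim_ext (fun N => sumC ((N + M - 1) / M) v)).
  - intros N. apply C_eq.
    + rewrite !sumC_Re, <- sumR_multiples by auto. apply sumR_ext. intros i _.
      destruct (Nat.eqb (i mod M) 0); auto.
    + rewrite !sumC_Im, <- sumR_multiples by auto. apply sumR_ext. intros i _.
      destruct (Nat.eqb (i mod M) 0); auto.
  - apply (Clim_comp (fun n => sumC n v)); auto. intros K. exists (M * K)%nat. intros n Hn.
    apply Nat.div_le_lower_bound; lia.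
Qed.

(** Both sums exist by domination. Shifting the index gives g - 1 = q g for the geometric sum and s
    = q (s + g) for the sum in question, and these are solved for s. *)
Lemma geom_deriv_series (q : C) : Cmod q < 1 ->
  Cser (fun r => INR r * q ^ r)%C (q / ((1 - q) * (1 - q))).
Proof.
  intros Hq. pose proof (Cmod_ge_0 q) as H0.
  assert (Hq1 : (1 - q)%C <> 0).
  { intros E. assert (X : q = 1) by (replace q with (1 - (1 - q))%C by ring; rewrite E; ring).
    rewrite X, Cmod_1 in Hq. lra. }
  assert (G : Cser (fun r => q ^ r)%C (CS (fun r => q ^ r)%C)).
  { apply (Cser_CS _ (fun r => Cmod q ^ r) 0).
    - intros r _. rewrite Cmod_pow. lra.
    - apply ex_series_geom. rewrite Rabs_pos_eq; auto. }
  assert (D : disc_coef (fun r => RtoC (INR r))).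
  { eapply disc_coef_le; [|apply (disc_coef_deriv (fun _ => RtoC 1) 1), disc_coef_const].
    intros t. cbv beta. rewrite !Cmult_1_l. lra. }
  assert (HS : Cser (fun r => INR r * q ^ r)%C (CS (fun r => INR r * q ^ r)%C)).
  { apply (Cser_CS _ (fun r => Cmod (INR r) * Cmod q ^ r) 0).
    - intros r _. rewrite Cmod_mult, Cmod_pow. lra.
    - apply D. auto. }
  set (g := CS (fun r => q ^ r)%C) in *. set (s := CS (fun r => INR r * q ^ r)%C) in *.
  assert (E1 : (g - 1 = q * g)%C).
  { apply (Cser_unique (fun n => q ^ (S n))%C).
    - apply (Cser_shift (fun r => q ^ r)%C) in G. exact G.
    - apply (Cser_ext (fun n => q * q ^ n)%C); auto. apply Cser_scal; auto. }
  assert (E2 : (s = q * (s + g))%C).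
  { apply (Cser_unique (fun n => INR (S n) * q ^ (S n))%C).
    - apply (Cser_shift (fun r => INR r * q ^ r)%C) in HS.
      replace (s - INR 0 * q ^ 0)%C with s in HS by (simpl; ring). exact HS.
    - apply (Cser_ext (fun n => q * (INR n * q ^ n + q ^ n))%C).
      + intros n. rewrite S_INR, RtoC_plus, Cpow_S. ring.
      + apply Cser_scal, Cser_plus; auto. }
  replace (q / ((1 - q) * (1 - q)))%C with s; auto.
  assert (F1 : (g * (1 - q) = 1)%C).
  { replace (g * (1 - q))%C with (g - 1 - q * g + 1)%C by ring. rewrite E1. ring. }
  assert (F2 : (s * (1 - q) = q * g)%C).
  { replace (s * (1 - q))%C with (s - q * (s + g) + q * g)%C by ring. rewrite <- E2. ring. }
  replace s with ((s * (1 - q)) * (1 - q) / ((1 - q) * (1 - q)))%C by (field; auto).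
  rewrite F2. rewrite <- (Cmult_assoc q g), F1. field. auto.
Qed.

Lemma sumR_single (n k : nat) (x : R) :
  sumR n (fun i => if Nat.eqb i k then x else 0) = if Nat.ltb k n then x else 0.
Proof.
  induction n; [reflexivity|]. rewrite sumR_S, IHn.
  destruct (Nat.ltb_spec k n), (Nat.ltb_spec k (S n)), (Nat.eqb_spec n k); try lia; ring.
Qed.

Lemma sumR_zero (n : nat) : sumR n (fun _ => 0) = 0.
Proof. induction n; [reflexivity|]. rewrite sumR_S, IHn. ring. Qed.

Lemma RtoC_sumR (n : nat) (f : nat -> R) : RtoC (sumR n f) = sumC n (fun i => RtoC (f i)).
Proof. induction n; [reflexivity|]. rewrite sumR_S, sumC_S, RtoC_plus, IHn. auto. Qed.

Lemma sumR_exchange (n m : nat) (f : nat -> nat -> R) :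
  sumR n (fun i => sumR m (fun j => f i j)) = sumR m (fun j => sumR n (fun i => f i j)).
Proof.
  apply RtoC_inj. rewrite !RtoC_sumR.
  rewrite (sumC_ext n _ (fun i => sumC m (fun j => RtoC (f i j)))) by (intros; apply RtoC_sumR).
  rewrite sumC_exchange. apply sumC_ext. intros. symmetry. apply RtoC_sumR.
Qed.

Lemma sigma1_sumR (n : nat) : INR (sigma1 n) =
  sumR n (fun i => if Nat.eqb (n mod S i) 0 then INR (S i) else 0).
Proof.
  unfold sigma1, sumR. rewrite <- seq_shift, map_map.
  generalize (seq 0 n). intros l. induction l as [|x l IH]; [reflexivity|].
  cbn [map fold_right]. rewrite plus_INR, IH. f_equal. destruct (Nat.eqb (n mod S x) 0); auto.
Qed.

Lemma divisor_row (n d : nat) (y : R) : (0 < n)%nat ->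
  sumR n (fun e => if Nat.eqb (S d * S e) n then y else 0) =
  if Nat.eqb (n mod S d) 0 then y else 0.
Proof.
  intros Hn. pose proof (Nat.div_mod n (S d) ltac:(lia)) as E.
  pose proof (Nat.mod_upper_bound n (S d) ltac:(lia)) as B.
  destruct (Nat.eqb_spec (n mod S d) 0) as [H|H].
  - set (k := (n / S d)%nat) in *. assert (Hk : k <> O) by (intros Z; rewrite Z in E; lia).
    rewrite (sumR_ext n _ (fun e => if Nat.eqb e (k - 1) then y else 0)).
    + rewrite sumR_single. destruct (Nat.ltb_spec (k - 1) n); auto. nia.
    + intros e _. destruct (Nat.eqb_spec (S d * S e) n), (Nat.eqb_spec e (k - 1)); auto; nia.
  - transitivity (sumR n (fun _ => 0)); [|apply sumR_zero]. apply sumR_ext. intros e _.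
    destruct (Nat.eqb_spec (S d * S e) n) as [F|F]; auto. exfalso. apply H.
    rewrite <- F, Nat.mul_comm. apply Nat.mod_mul. lia.
Qed.

(** The involution [d -> n / d] on the divisors of [n]. *)
Lemma sigma1_codivisor (n : nat) : (0 < n)%nat ->
  INR (sigma1 n) = sumR n (fun i => if Nat.eqb (n mod S i) 0 then INR (n / S i) else 0).
Proof.
  intros Hn. rewrite sigma1_sumR.
  transitivity (sumR n (fun i => sumR n (fun j => if Nat.eqb (S i * S j) n then INR (S i) else 0))).
  { apply sumR_ext. intros i _. rewrite divisor_row; auto. }
  rewrite sumR_exchange. apply sumR_ext. intros j _.
  rewrite <- divisor_row by auto. apply sumR_ext. intros i _.
  rewrite Nat.mul_comm. destruct (Nat.eqb_spec (S j * S i) n) as [E|E]; auto.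
  f_equal. apply (Nat.div_unique _ _ _ 0); lia.
Qed.

Lemma sigma1_0 : sigma1 0 = O.
Proof. reflexivity. Qed.

Lemma Im_scal (x : R) (z : C) : Im (x * z)%C = x * Im z.
Proof. simpl. unfold Im. ring. Qed.

Lemma e1_nat (n : nat) (z : C) : e1 (INR n * z) = (e1 z ^ n)%C.
Proof.
  induction n.
  - simpl. unfold e1. rewrite <- Cexp_0. f_equal. ring.
  - rewrite S_INR, RtoC_plus, Cmult_plus_distr_r, e1_add, IHn, Cmult_1_l. simpl. ring.
Qed.

Lemma qpow_INR (n : nat) (z : C) : qpow (INR n) z = (e1 z ^ n)%C.
Proof. rewrite <- e1_nat. unfold qpow, e1. f_equal. rewrite RtoC_mult. ring. Qed.

Lemma Cmod_e1_lt_1 (z : C) : upper z -> Cmod (e1 z) < 1.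
Proof.
  intros Hz. rewrite Cmod_e1. apply exp_neg_lt_1. pose proof PI_RGT_0. unfold upper in Hz.
  apply Rmult_lt_0_compat; lra.
Qed.

(** Each sinp2 (m z) is -4 PI^2 times the sum of r q^(m r). Collecting the powers q^n over the
    divisors m of n gives sigma_1(n) in its codivisor form, and -4 PI^2 = -24 (PI^2 / 6). *)
Lemma E2_lambert (z : C) : upper z ->
  Cser (fun m => sinp2 (INR (S m) * z)) (RtoC (PI * PI / 6) * (E2 z - 1)).
Proof.
  intros Hz. pose proof (Cmod_e1_lt_1 z Hz) as Hq1. pose proof (Cmod_ge_0 (e1 z)) as Hq0.
  set (q := e1 z) in *. set (rho := Cmod q) in *.
  set (v := fun M r => (INR r * (q ^ M) ^ r)%C).
  set (a := fun m n => if Nat.eqb (n mod S m) 0 then v (S m) (n / S m)%nat else RtoC 0).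
  set (row := fun m => (q ^ S m / ((1 - q ^ S m) * (1 - q ^ S m)))%C).
  assert (HqM : forall m, Cmod (q ^ S m) < 1).
  { intros m. rewrite Cmod_pow. apply pow_lt_1_compat; [split; auto|lia]. }
  set (K := Series (fun r => INR (S r) * rho ^ r)).
  assert (HK : ex_series (fun r => INR (S r) * rho ^ r)).
  { assert (D : disc_coef (fun r => RtoC (INR (S r)))).
    { intros r Hr. apply (ex_series_ext (fun t => Cmod (INR t) * r ^ t + r ^ t)).
      - intros t. rewrite !Cmod_R, !Rabs_pos_eq by apply pos_INR. rewrite S_INR. simpl. ring.
      - apply (@ex_series_plus R_AbsRing R_NormedModule).
        + assert (D : disc_coef (fun r => RtoC (INR r))).
          { eapply disc_coef_le; [|apply (disc_coef_deriv (fun _ => RtoC 1) 1), disc_coef_const].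
            intros t. cbv beta. rewrite !Cmult_1_l. lra. }
          apply D; auto.
        + apply ex_series_geom. rewrite Rabs_pos_eq; lra. }
    eapply ex_series_ext; [|apply (D rho); auto]. intros r. simpl.
    rewrite Cmod_R, Rabs_pos_eq by apply (pos_INR (S r)). auto. }
  destruct (Cser_exchange a row (fun n => INR (sigma1 n) * q ^ n)%C (fun m n => Cmod (a m n))
     (fun m => rho ^ S m * K)) as [A1 A2].
  - intros; lra.
  - intros m n.
    rewrite (sumR_ext n _ (fun n => if Nat.eqb (n mod S m) 0 then Cmod (v (S m) (n / S m)%nat) else 0)).
    2:{ intros i _. unfold a. destruct (Nat.eqb (i mod S m) 0); auto. apply Cmod_0. }
    rewrite (sumR_multiples (S m) (fun r => Cmod (v (S m) r))) by lia.
    set (N := ((n + S m - 1) / S m)%nat). clearbody N.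
    assert (B : forall r, Cmod (v (S m) (S r)) <= rho ^ S m * (INR (S r) * rho ^ r)).
    { intros r. unfold v. rewrite Cmod_mult, !Cmod_pow, Cmod_R, Rabs_pos_eq by apply pos_INR.
      fold rho. rewrite <- tech_pow_Rmult. 
      assert (P1 : 0 <= rho ^ S m) by (apply pow_le; auto).
      assert (P2 : (rho ^ S m) ^ r <= rho ^ r).
      { rewrite <- pow_mult. replace (S m * r)%nat with (r + m * r)%nat by lia. rewrite pow_add.
        rewrite <- (Rmult_1_r (rho ^ r)) at 2. apply Rmult_le_compat_l; [apply pow_le; auto|].
        rewrite <- (pow1 (m * r)). apply pow_incr. lra. }
      pose proof (INR_S_pos r).
      replace (INR (S r) * (rho ^ S m * (rho ^ S m) ^ r))
        with (rho ^ S m * (INR (S r) * (rho ^ S m) ^ r)) by ring.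
      apply Rmult_le_compat_l; auto. apply Rmult_le_compat_l; lra. }
    assert (Hpos : forall i, 0 <= INR (S i) * rho ^ i).
    { intros i. apply Rmult_le_pos; [apply pos_INR|apply pow_le; auto]. }
    destruct N as [|N].
    + unfold sumR; simpl. apply Rmult_le_pos; [apply (pow_le rho (S m)); auto|].
      apply (sumR_le_Series 0 (fun r => INR (S r) * rho ^ r)); auto.
    + apply Rle_trans with (rho ^ S m * sumR N (fun r => INR (S r) * rho ^ r)).
      * induction N.
        { rewrite sumR_S. unfold sumR, v; simpl. rewrite Cmult_0_l, Cmod_0. lra. }
        { rewrite sumR_S. rewrite (sumR_S N (fun r => INR (S r) * rho ^ r)). rewrite Rmult_plus_distr_l.
          apply Rplus_le_compat; auto. }
      * apply Rmult_le_compat_l; [apply pow_le; auto|]. apply sumR_le_Series; auto.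
  - apply (ex_series_ext (fun m => K * rho * rho ^ m)).
    + intros m. simpl. ring.
    + apply ex_series_scal_R. apply ex_series_geom.
      rewrite Rabs_pos_eq; auto.
  - intros m. apply Cser_multiples; [lia|]. apply geom_deriv_series; auto.
  - intros n.
    assert (E : (INR (sigma1 n) * q ^ n)%C = sumC n (fun m => a m n)).
    { destruct n as [|n].
      - rewrite sigma1_0. simpl. unfold sumC; simpl. ring.
      - rewrite sigma1_codivisor, RtoC_sumR, Cmult_comm, <- sumC_scal by lia.
        apply sumC_ext. intros m _. unfold a, v.
        destruct (Nat.eqb_spec (S n mod S m) 0) as [F|F]; [|ring].
        rewrite <- Cpow_mult_r, Cmult_comm. f_equal. f_equal.
        apply Nat.div_exact; lia. }
    rewrite E. apply Cser_finite. intros m Hm. unfold a.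
    destruct n as [|n].
    + simpl. rewrite Nat.sub_diag. simpl. unfold v; simpl. ring.
    + rewrite Nat.mod_small by lia. simpl. auto.
  - apply (Cser_ext (fun m => - RtoC (4 * (PI * PI)) * row m)%C).
    { intros m. unfold sinp2, row. rewrite e1_nat. fold q.
      assert (N : (q ^ S m - 1)%C <> 0).
      { unfold q. rewrite <- (e1_nat (S m) z). apply e1_neq_1. rewrite Im_scal.
        pose proof (INR_S_pos m). unfold upper in Hz. nra. }
      field. split; auto. intros F. apply N. transitivity (- (1 - q ^ S m))%C; [ring|].
      rewrite F. ring. }
    replace (RtoC (PI * PI / 6) * (E2 z - 1))%C with (- RtoC (4 * (PI * PI)) * CS row)%C;
      [apply Cser_scal; auto|].
    rewrite <- (Cser_CS_eq _ _ A2).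
    replace (CS (fun n => INR (sigma1 n) * q ^ n)%C) with (CS (E2_term z)).
    + unfold E2. change (Series _, Series _) with (CS (E2_term z)).
      replace (RtoC (4 * (PI * PI))) with (RtoC (PI * PI / 6) * RtoC 24)%C
        by (rewrite <- RtoC_mult; f_equal; field).
      ring.
    + rewrite (Cser_CS_eq _ _ A2). apply Cser_CS_eq.
      eapply Cser_ext; [|apply A2]. intros n. unfold E2_term. rewrite qpow_INR. auto.
Qed.

Lemma lattice_bound_abs (z : C) (m nu : R) : upper z ->
  Rabs nu * Im z <= Cmod (m * z + nu) * Cmod z.
Proof.
  intros Hz. unfold upper in Hz. pose proof (lattice_bound z m nu) as L.
  apply Rsqr_incr_0.
  - unfold Rsqr. assert (Rabs nu * Rabs nu = nu * nu) by (rewrite <- Rabs_mult, Rabs_pos_eq; nra).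
    replace (Rabs nu * Im z * (Rabs nu * Im z)) with (Rabs nu * Rabs nu * (Im z * Im z)) by ring.
    rewrite H. simpl in L. lra.
  - apply Rmult_le_pos; [apply Rabs_pos|lra].
  - apply Rmult_le_pos; apply Cmod_ge_0.
Qed.

(** The kernel [1/u^2] minus the telescoping kernel [1/(u - 1/2) - 1/(u + 1/2)]. *)
Definition telescoped_kernel (u : C) : C :=
  (/ (u * u) - (/ (u - RtoC (1 / 2)) - / (u + RtoC (1 / 2))))%C.

Lemma upper_lattice (z : C) (m x : R) : upper z -> 0 < m -> upper (m * z + x).
Proof. intros Hz Hm. apply upper_plus_R. unfold upper. rewrite Im_scal. apply Rmult_lt_0_compat; auto. Qed.

Lemma Cmod_upper_lattice (z : C) (m x : R) : upper z -> 0 < m -> m * Im z <= Cmod (m * z + x).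
Proof.
  intros Hz Hm. eapply Rle_trans; [|apply Im_le_Cmod]. eapply Rle_trans; [|apply Rle_abs].
  apply Req_le. simpl. unfold Im. ring.
Qed.

Lemma RtoC_half : RtoC (1 / 2) = (1 / 2)%C.
Proof. rewrite RtoC_div; auto. Qed.

(** The kernel equals -1 / (4 u^2 (u^2 - 1/4)). Its order u^(-4) is what makes the double sum
    absolutely convergent. *)
Lemma Cmod_telescoped_kernel (z : C) (m x : R) : upper z -> 0 < m ->
  Cmod (telescoped_kernel (m * z + x)) =
    / (4 * (Cmod (m * z + x) ^ 2) * (Cmod (m * z + (x - 1 / 2)%R) * Cmod (m * z + (x + 1 / 2)%R))).
Proof.
  intros Hz Hm.
  pose proof (upper_neq_0 _ (upper_lattice z m x Hz Hm)) as H1.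
  pose proof (upper_neq_0 _ (upper_lattice z m (x - 1 / 2) Hz Hm)) as H2.
  pose proof (upper_neq_0 _ (upper_lattice z m (x + 1 / 2) Hz Hm)) as H3.
  rewrite RtoC_minus, RtoC_half in *. rewrite RtoC_plus, RtoC_half in *.
  replace (m * z + (x - 1 / 2))%C with (m * z + x - 1 / 2)%C in * by ring.
  replace (m * z + (x + 1 / 2))%C with (m * z + x + 1 / 2)%C in * by ring.
  unfold telescoped_kernel. rewrite RtoC_half. set (u := (m * z + x)%C) in *.
  replace (/ (u * u) - (/ (u - 1 / 2) - / (u + 1 / 2)))%C
    with (- / (4 * (u * u) * ((u - 1 / 2) * (u + 1 / 2))))%C.
  - rewrite Cmod_opp, Cmod_inv.
    + rewrite !Cmod_mult, Cmod_R, Rabs_pos_eq by lra. f_equal. simpl. ring.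
    + repeat apply Cmult_neq_0; auto. apply RtoC_neq_0; lra.
  - assert (K2 : (2 * u - 1)%C <> 0).
    { intros E. apply H2. replace (u - 1 / 2)%C with ((2 * u - 1) / 2)%C by field. rewrite E. field. }
    assert (K3 : (2 * u + 1)%C <> 0).
    { intros E. apply H3. replace (u + 1 / 2)%C with ((2 * u + 1) / 2)%C by field. rewrite E. field. }
    field. repeat split; auto; try (apply RtoC_neq_0; lra);
      intros E; [apply K3|apply K2]; rewrite <- E; ring.
Qed.

Lemma Cmod_telescoped_kernel_0 (z : C) (m : R) : upper z -> 1 <= m ->
  Cmod (telescoped_kernel (m * z)) <= / (4 * Im z ^ 4) * / (m * m).
Proof.
  intros Hz Hm. replace (m * z)%C with (m * z + 0)%C by ring.
  rewrite Cmod_telescoped_kernel by (auto; lra).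
  pose proof (Cmod_upper_lattice z m 0 Hz ltac:(lra)) as A1.
  pose proof (Cmod_upper_lattice z m (0 - 1 / 2) Hz ltac:(lra)) as A2.
  pose proof (Cmod_upper_lattice z m (0 + 1 / 2) Hz ltac:(lra)) as A3.
  unfold upper in Hz. set (y := Im z) in *.
  rewrite <- Rinv_mult. apply Rinv_le_contravar.
  - apply Rmult_lt_0_compat; [|nra]. assert (0 < y ^ 4) by (apply pow_lt; auto). lra.
  - assert (B1 : m * y * (m * y) <= Cmod (m * z + 0) ^ 2).
    { simpl. rewrite Rmult_1_r. apply Rmult_le_compat; nra. }
    assert (B2 : y * y <= Cmod (m * z + (0 - 1 / 2)%R) * Cmod (m * z + (0 + 1 / 2)%R)).
    { apply Rmult_le_compat; nra. }
    replace (4 * y ^ 4 * (m * m)) with (4 * (m * y * (m * y)) * (y * y)) by ring.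
    apply Rmult_le_compat; nra.
Qed.

(** Of the four factors in the denominator, the two equal to m z + x supply 1/m^2 through their
    imaginary part, and the two shifted by 1/2 supply 1/x^2 through [lattice_bound_abs]. A majorant
    of product form results. *)
Lemma Cmod_telescoped_kernel_x (z : C) (m x : R) : upper z -> 0 < m -> 1 <= x * x ->
  Cmod (telescoped_kernel (m * z + x)) <= (Cmod z ^ 2 / (2 * Im z ^ 4) * / (x * x)) * / (m * m).
Proof.
  intros Hz Hm Hx. rewrite Cmod_telescoped_kernel by auto.
  pose proof (Cmod_upper_lattice z m x Hz Hm) as A1.
  pose proof (lattice_bound_abs z m (x - 1 / 2) Hz) as A2.
  pose proof (lattice_bound_abs z m (x + 1 / 2) Hz) as A3.
  pose proof (proj1 (Cmod_gt_0 z) (upper_neq_0 z Hz)) as Hz0.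
  unfold upper in Hz. set (y := Im z) in *. set (Z := Cmod z) in *.
  set (u := Cmod (m * z + x)) in *. set (v := Cmod (m * z + (x - 1 / 2)%R)) in *.
  set (w := Cmod (m * z + (x + 1 / 2)%R)) in *.
  assert (B : x * x / 2 * (y * y) <= (v * w) * (Z * Z)).
  { replace (v * w * (Z * Z)) with ((v * Z) * (w * Z)) by ring.
    apply Rle_trans with ((Rabs (x - 1 / 2) * y) * (Rabs (x + 1 / 2) * y)).
    - replace ((Rabs (x - 1 / 2) * y) * (Rabs (x + 1 / 2) * y))
        with (Rabs (x - 1 / 2) * Rabs (x + 1 / 2) * (y * y)) by ring.
      rewrite <- Rabs_mult. apply Rmult_le_compat_r; [nra|].
      eapply Rle_trans; [|apply Rle_abs]. lra.
    - apply Rmult_le_compat; auto; apply Rmult_le_pos; try lra; apply Rabs_pos. }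
  assert (B1 : m * y * (m * y) <= u ^ 2).
  { simpl. rewrite Rmult_1_r. apply Rmult_le_compat; nra. }
  assert (Hvw : 0 < v * w).
  { apply (Rmult_lt_reg_r (Z * Z)); [nra|]. rewrite Rmult_0_l. nra. }
  assert (Hmy : 0 < m * y * (m * y)) by (assert (0 < m * y) by nra; nra).
  assert (HY : 0 < y * y) by nra.
  assert (HM : 0 < m * m) by nra.
  replace (Z ^ 2 / (2 * y ^ 4) * / (x * x) * / (m * m))
    with (/ (4 * (m * y * (m * y)) * (x * x / 2 * (y * y) / (Z * Z)))).
  2:{ field. repeat split; lra || nra. }
  apply Rinv_le_contravar.
  - apply Rmult_lt_0_compat; [lra|]. apply Rdiv_lt_0_compat; nra.
  - apply Rmult_le_compat; try lra.
    + left. apply Rdiv_lt_0_compat; nra.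
    + apply (Rmult_le_reg_r (Z * Z)); [nra|]. unfold Rdiv at 1. rewrite Rmult_assoc, Rinv_l by nra. lra.
Qed.

Definition zeta2 : R := Series (fun n => / (INR (S n) * INR (S n))).

Lemma zeta2_Cser : Cser (fun n => RtoC (/ (INR (S n) * INR (S n)))) zeta2.
Proof.
  apply Cser_Re_Im; simpl.
  - apply Series_correct, ex_series_inv_sqr.
  - apply is_series_sumR. apply (is_lim_seq_ext (fun _ => 0)); [|apply is_lim_seq_const].
    intros n. symmetry. apply sumR_zero.
Qed.

Lemma cotp_lim_infinity (w : C) (nu : nat -> R) : upper w -> (forall n, INR n <= nu n) ->
  Clim (fun n => cotp (nu n * w)) (- (RtoC PI * Ci)).
Proof.
  intros Hw Hnu eps Heps. pose proof PI_RGT_0 as HPI. unfold upper in Hw.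
  assert (HP : 0 < 2 * PI * Im w) by (apply Rmult_lt_0_compat; lra).
  assert (HE : 0 < 4 * PI / eps) by (apply Rdiv_lt_0_compat; lra).
  destruct (INR_unbounded ((4 * PI / eps + 1) / (2 * PI * Im w))) as [N HN].
  exists N. intros n Hn. apply le_INR in Hn. specialize (Hnu n).
  set (x := nu n) in *.
  assert (Hx : 4 * PI / eps + 1 < 2 * PI * Im w * x).
  { assert ((4 * PI / eps + 1) / (2 * PI * Im w) < x) by lra.
    apply (Rmult_lt_compat_r (2 * PI * Im w)) in H; auto.
    unfold Rdiv at 1 in H. rewrite Rmult_assoc, Rinv_l in H by lra. lra. }
  assert (HI : Im (x * w)%C = x * Im w) by apply Im_scal.
  assert (HI0 : Im (x * w)%C <> 0) by (rewrite HI; intros E; rewrite Rmult_assoc, (Rmult_comm (Im w)), E, Rmult_0_r in Hx; lra).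
  assert (N1 := e1_neq_1 _ HI0).
  set (E := e1 (x * w)) in *.
  assert (HEm : Cmod E <= / (4 * PI / eps + 2)).
  { unfold E. rewrite Cmod_e1, HI, exp_Ropp. apply Rinv_le_contravar; [lra|].
    pose proof (exp_ineq1_le (2 * PI * (x * Im w))). lra. }
  assert (HE2 : / (4 * PI / eps + 2) <= 1 / 2).
  { rewrite <- (Rinv_inv (1 / 2)). apply Rinv_le_contravar; lra. }
  assert (HD : 1 / 2 <= Cmod (E - 1)).
  { pose proof (Cmod_le_add 1 E) as X. rewrite Cmod_1, Cmod_minus_sym in X. lra. }
  replace (cotp (x * w) - - (RtoC PI * Ci))%C with (2 * PI * Ci * E / (E - 1))%C.
  2:{ unfold cotp. fold E. field. auto. }
  rewrite Cmod_div, !Cmod_mult, Cmod_Ci, !Cmod_R, !Rabs_pos_eq by (auto; lra).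
  apply (Rmult_lt_reg_r (Cmod (E - 1))); [lra|].
  unfold Rdiv. rewrite Rmult_assoc, Rinv_l by lra.
  apply Rle_lt_trans with (2 * PI * / (4 * PI / eps + 2)).
  - rewrite !Rmult_1_r. apply Rmult_le_compat_l; lra.
  - apply Rlt_le_trans with (eps * (1 / 2)); [|apply Rmult_le_compat_l; lra].
    apply (Rmult_lt_reg_r (4 * PI / eps + 2)); [lra|]. rewrite Rmult_assoc, Rinv_l by lra.
    replace (eps * (1 / 2) * (4 * PI / eps + 2)) with (2 * PI + eps) by (field; lra). lra.
Qed.

(** Summed over |n| <= N, the telescoping kernel leaves its values at the ends -(N + 1/2) and N +
    1/2. *)
Definition half_int (N : nat) : R := INR N + 1 / 2.

(** The [m]-th row of the lattice sum of weight 2, truncated to [|n| <= N], minus the same range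
    of the telescoping kernel. *)
Definition lat_row (z : C) (N m : nat) : C :=
  (/ ((INR (S m) * z) * (INR (S m) * z))
   + sumC N (fun n => / ((INR (S m) * z + INR (S n)) * (INR (S m) * z + INR (S n)))
                    + / ((INR (S m) * z - INR (S n)) * (INR (S m) * z - INR (S n))))
   - (/ (INR (S m) * z - half_int N) - / (INR (S m) * z + half_int N)))%C.

Lemma lat_row_telescoped_kernel (z : C) (N m : nat) : lat_row z N m =
  (telescoped_kernel (INR (S m) * z)
   + sumC N (fun n => telescoped_kernel (INR (S m) * z + INR (S n))
                      + telescoped_kernel (INR (S m) * z + (- INR (S n))%R)))%C.
Proof.
  unfold lat_row. induction N.
  - unfold sumC; simpl fold_right. unfold telescoped_kernel, half_int. simpl (INR 0). rewrite Rplus_0_l. ring.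
  - rewrite !sumC_S.
    match type of IHN with (?a + ?b - (?c - ?d))%C = (?e + ?f)%C =>
      assert (X : f = (a + b - (c - d) - e)%C) by (rewrite IHN; ring); rewrite X end.
    unfold telescoped_kernel, half_int.
    replace (INR (S m) * z + (- INR (S N))%R)%C with (INR (S m) * z - INR (S N))%C by (rewrite RtoC_opp; ring).
    replace (INR (S m) * z + INR (S N) - RtoC (1 / 2))%C with (INR (S m) * z + RtoC (INR N + 1 / 2))%C
      by (rewrite (S_INR N), !RtoC_plus, RtoC_half; field).
    replace (INR (S m) * z + INR (S N) + RtoC (1 / 2))%C with (INR (S m) * z + RtoC (INR (S N) + 1 / 2))%C
      by (rewrite RtoC_plus; ring).
    replace (INR (S m) * z - INR (S N) + RtoC (1 / 2))%C with (INR (S m) * z - RtoC (INR N + 1 / 2))%C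
      by (rewrite (S_INR N), !RtoC_plus, RtoC_half; field).
    replace (INR (S m) * z - INR (S N) - RtoC (1 / 2))%C with (INR (S m) * z - RtoC (INR (S N) + 1 / 2))%C
      by (rewrite RtoC_plus; ring).
    ring.
Qed.

Lemma lat_row_bound (z : C) (N m : nat) : upper z ->
  Cmod (lat_row z N m) <= (/ (4 * Im z ^ 4) + Cmod z ^ 2 / Im z ^ 4 * zeta2) * / (INR (S m) * INR (S m)).
Proof.
  intros Hz. pose proof (INR_S_pos m) as Hm.
  assert (Hm1 : 1 <= INR (S m)) by (rewrite S_INR; pose proof (pos_INR m); lra).
  assert (Hy : 0 < Im z ^ 4) by (apply pow_lt, Hz).
  rewrite lat_row_telescoped_kernel. eapply Rle_trans; [apply Cmod_triangle|].
  rewrite Rmult_plus_distr_r. apply Rplus_le_compat; [apply Cmod_telescoped_kernel_0; auto|].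
  set (c := Cmod z ^ 2 / Im z ^ 4).
  assert (Hc : 0 <= c) by (unfold c; apply Rmult_le_pos; [apply pow2_ge_0|left; apply Rinv_0_lt_compat; auto]).
  assert (Hmm : 0 < / (INR (S m) * INR (S m))) by (apply Rinv_0_lt_compat; nra).
  eapply Rle_trans; [apply Cmod_sumC|].
  apply Rle_trans with (sumR N (fun n => / (INR (S n) * INR (S n))) * (c * / (INR (S m) * INR (S m)))).
  - clear - Hz Hm Hmm Hy Hc. induction N; [unfold sumR; simpl; lra|].
    rewrite sumR_S. rewrite (sumR_S N (fun n => / (INR (S n) * INR (S n)))), Rmult_plus_distr_r.
    apply Rplus_le_compat; auto.
    eapply Rle_trans; [apply Cmod_triangle|].
    assert (H1 : 1 <= INR (S N) * INR (S N)) by (rewrite S_INR; pose proof (pos_INR N); nra).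
    pose proof (Cmod_telescoped_kernel_x z (INR (S m)) (INR (S N)) Hz Hm H1) as A1.
    pose proof (Cmod_telescoped_kernel_x z (INR (S m)) (- INR (S N)) Hz Hm ltac:(lra)) as A2.
    replace (- INR (S N) * - INR (S N)) with (INR (S N) * INR (S N)) in A2 by ring.
    replace (Cmod z ^ 2 / (2 * Im z ^ 4)) with (c / 2) in A1, A2 by (unfold c; field; unfold upper in Hz; lra).
    lra.
  - rewrite Rmult_comm, (Rmult_comm c), Rmult_assoc, (Rmult_comm (c * zeta2)).
    apply Rmult_le_compat_l; [lra|]. apply Rmult_le_compat_l; auto.
    apply sumR_le_Series; [|apply ex_series_inv_sqr].
    intros i. left. apply Rinv_0_lt_compat. pose proof (INR_S_pos i). nra.
Qed.

Lemma upper_scal_neg_inv (z : C) (x : R) : upper z -> 0 < x -> upper (x * - / z).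
Proof.
  intros Hz Hx. pose proof (upper_neg_inv z Hz) as H. unfold upper in *. rewrite Im_scal.
  apply Rmult_lt_0_compat; auto.
Qed.

(** Summation over m first: m z + n is z times m - n (-1/z), so each column is a series of
    [sinp2_series] at n (-1/z) divided by z^2. Its missing term m = 0 is the subtracted 1/n^2. The
    ends of the telescoping part add up to a cotangent in the same way. *)
Lemma lat_row_Cser (z : C) (N : nat) : upper z -> Cser (lat_row z N)
  (/ (z * z) * zeta2
   + sumC N (fun n => / (z * z) * sinp2 (INR (S n) * - / z) - RtoC (/ (INR (S n) * INR (S n))))
   - (/ z * cotp (half_int N * - / z) + / RtoC (half_int N)))%C.
Proof.
  intros Hz. pose proof (upper_neq_0 z Hz) as Hz0.
  assert (HSm : forall m, RtoC (INR (S m)) <> 0).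
  { intros m. apply RtoC_neq_0. pose proof (INR_S_pos m). lra. }
  assert (HM : forall m x, (INR (S m) * z + RtoC x)%C <> 0).
  { intros m x. apply upper_neq_0, upper_lattice; auto. apply INR_S_pos. }
  assert (HM' : forall m x, (INR (S m) * z - RtoC x)%C <> 0).
  { intros m x. replace (INR (S m) * z - RtoC x)%C with (INR (S m) * z + RtoC (- x))%C by (rewrite RtoC_opp; ring).
    apply HM. }
  assert (Hnu : 0 < half_int N) by (unfold half_int; pose proof (pos_INR N); lra).
  assert (Hnu0 : RtoC (half_int N) <> 0) by (apply RtoC_neq_0; lra).
  unfold lat_row. apply Cser_minus; [apply Cser_plus|].
  - apply (Cser_ext (fun m => / (z * z) * RtoC (/ (INR (S m) * INR (S m))))%C).
    + intros m. pose proof (INR_S_pos m). rewrite RtoC_inv, RtoC_mult by nra. field. auto.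
    + apply Cser_scal, zeta2_Cser.
  - induction N as [|N IH].
    + apply (Cser_ext (fun _ => RtoC 0)); auto. apply (Cser_finite (fun _ => RtoC 0) 0); auto.
    + rewrite sumC_S.
      apply (Cser_ext (fun m => sumC N (fun n => / ((INR (S m) * z + INR (S n)) * (INR (S m) * z + INR (S n)))
             + / ((INR (S m) * z - INR (S n)) * (INR (S m) * z - INR (S n))))
         + / (z * z) * (/ ((INR (S N) * - / z + INR (S m)) * (INR (S N) * - / z + INR (S m)))
             + / ((INR (S N) * - / z - INR (S m)) * (INR (S N) * - / z - INR (S m)))))%C).
      * intros m. rewrite sumC_S. f_equal.
        assert (E1 : (INR (S N) * - / z + INR (S m))%C = ((INR (S m) * z - INR (S N)) / z)%C)
          by (field; auto).
        assert (E2 : (INR (S N) * - / z - INR (S m))%C = (- (INR (S m) * z + INR (S N)) / z)%C)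
          by (field; auto).
        rewrite E1, E2. field. repeat split; auto.
      * apply Cser_plus.
        { apply IH; unfold half_int in *; pose proof (pos_INR N); [lra|apply RtoC_neq_0; lra]. }
        replace (/ (z * z) * sinp2 (INR (S N) * - / z) - RtoC (/ (INR (S N) * INR (S N))))%C
          with (/ (z * z) * (sinp2 (INR (S N) * - / z) - / ((INR (S N) * - / z) * (INR (S N) * - / z))))%C.
        { apply Cser_scal, sinp2_series, upper_scal_neg_inv; auto; apply INR_S_pos. }
        pose proof (INR_S_pos N). rewrite RtoC_inv, RtoC_mult by nra.
        field. repeat split; auto.
  - apply (Cser_ext (fun m => / z * (/ (half_int N * - / z + INR (S m)) + / (half_int N * - / z - INR (S m))))%C).
    + intros m.
      assert (E1 : (half_int N * - / z + INR (S m))%C = ((INR (S m) * z - half_int N) / z)%C)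
        by (field; auto).
      assert (E2 : (half_int N * - / z - INR (S m))%C = (- (INR (S m) * z + half_int N) / z)%C)
        by (field; auto).
      rewrite E1, E2. field. repeat split; auto.
    + replace (/ z * cotp (half_int N * - / z) + / RtoC (half_int N))%C
        with (/ z * (cotp (half_int N * - / z) - / (half_int N * - / z)))%C.
      * apply Cser_scal, cotp_series, upper_scal_neg_inv; auto.
      * field. auto.
Qed.

Lemma lat_row_lim (z : C) (m : nat) : upper z -> Clim (fun N => lat_row z N m) (sinp2 (INR (S m) * z)).
Proof.
  intros Hz. pose proof (INR_S_pos m) as Hm.
  set (w := (INR (S m) * z)%C).
  assert (Hw : upper w) by (unfold w, upper; rewrite Im_scal; apply Rmult_lt_0_compat; auto).
  replace (sinp2 w) with (/ (w * w) + (sinp2 w - / (w * w)) - (0 - 0))%C by ring.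
  unfold lat_row. fold w.
  assert (Hinv : forall s : R, s = 1 \/ s = - 1 -> Clim (fun N => / (w + RtoC (s * half_int N)))%C 0).
  { intros s Hs eps Heps. destruct (INR_unbounded (Cmod w + / eps)) as [N0 HN0].
    exists N0. intros n Hn. apply le_INR in Hn.
    assert (Hne : (w + RtoC (s * half_int n))%C <> 0) by (apply upper_neq_0, upper_plus_R; auto).
    replace (/ (w + RtoC (s * half_int n)) - 0)%C with (/ (w + RtoC (s * half_int n)))%C by ring.
    rewrite Cmod_inv by auto.
    assert (B : / eps < Cmod (w + RtoC (s * half_int n))).
    { pose proof (Cmod_le_add (RtoC (s * half_int n)) (- w)) as X.
      replace (RtoC (s * half_int n) - - w)%C with (w + RtoC (s * half_int n))%C in X by ring.
      rewrite Cmod_opp, Cmod_R, Rabs_mult in X.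
      assert (Rabs s = 1) by (destruct Hs; subst; [apply Rabs_R1|rewrite Rabs_left; lra]).
      assert (Rabs (half_int n) = half_int n) by (apply Rabs_pos_eq; unfold half_int; pose proof (pos_INR n); lra).
      rewrite H, H0 in X. unfold half_int in *. lra. }
    rewrite <- (Rinv_inv eps). apply Rinv_lt_contravar; auto.
    apply Rmult_lt_0_compat; [apply Rinv_0_lt_compat; auto|]. apply Cmod_gt_0; auto. }
  apply Clim_minus; [apply Clim_plus; [apply Clim_const|]|apply Clim_minus].
  - apply (sinp2_series w Hw).
  - apply (Clim_ext (fun N => / (w + RtoC (-1 * half_int N)))%C); [|apply Hinv; auto].
    intros n. f_equal. rewrite RtoC_mult. ring.
  - apply (Clim_ext (fun N => / (w + RtoC (1 * half_int N)))%C); [|apply Hinv; auto].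
    intros n. f_equal. rewrite Rmult_1_l. ring.
Qed.

(** Both orders of summation are compared as N grows. Row by row the ends of the telescoping part
    vanish; summed over m they form a cotangent whose argument goes to i infinity, with limit - PI
    i. This is the origin of the term PI i / z. *)
Lemma E2_S_zeta2 (z : C) : upper z ->
  (RtoC (PI * PI / 6) * (E2 z - 1) =
   / (z * z) * (RtoC (PI * PI / 6) * (E2 (- / z) - 1))
   + zeta2 * (/ (z * z) - 1) + RtoC PI * Ci / z)%C.
Proof.
  intros Hz. pose proof (upper_neq_0 z Hz) as Hz0.
  destruct (tannery (lat_row z) (fun m => sinp2 (INR (S m) * z))
    (fun N => / (z * z) * zeta2
       + sumC N (fun n => / (z * z) * sinp2 (INR (S n) * - / z) - RtoC (/ (INR (S n) * INR (S n))))
       - (/ z * cotp (half_int N * - / z) + / RtoC (half_int N)))%C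
    (fun m => (/ (4 * Im z ^ 4) + Cmod z ^ 2 / Im z ^ 4 * zeta2) * / (INR (S m) * INR (S m))) 0 0)
    as [A1 A2].
  - apply ex_series_scal_R, ex_series_inv_sqr.
  - intros N i _ _. apply lat_row_bound; auto.
  - intros i. apply lat_row_lim; auto.
  - intros N. apply lat_row_Cser; auto.
  - rewrite (Cser_unique _ _ _ A1 (E2_lambert z Hz)) in A2.
    apply (Clim_unique _ _ _ A2).
    replace (/ (z * z) * (RtoC (PI * PI / 6) * (E2 (- / z) - 1)) + zeta2 * (/ (z * z) - 1) + RtoC PI * Ci / z)%C
      with (/ (z * z) * zeta2 + (/ (z * z) * (RtoC (PI * PI / 6) * (E2 (- / z) - 1)) - zeta2)
            - (/ z * (- (RtoC PI * Ci)) + 0))%C by (field; auto).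
    apply Clim_minus; [apply Clim_plus; [apply Clim_const|]|apply Clim_plus].
    + apply Cser_minus; [|apply zeta2_Cser]. apply Cser_scal.
      apply E2_lambert, upper_neg_inv, Hz.
    + apply Clim_scal, cotp_lim_infinity; [apply upper_neg_inv, Hz|].
      intros n. unfold half_int. lra.
    + intros eps Heps. destruct (INR_unbounded (/ eps)) as [N0 HN0].
      exists N0. intros n Hn. apply le_INR in Hn.
      assert (Hnu : / eps < half_int n) by (unfold half_int; lra).
      assert (H0 : 0 < / eps) by (apply Rinv_0_lt_compat; auto).
      replace (/ RtoC (half_int n) - 0)%C with (RtoC (/ half_int n)) by (rewrite RtoC_inv by lra; ring).
      rewrite Cmod_R, Rabs_pos_eq by (left; apply Rinv_0_lt_compat; lra).
      rewrite <- (Rinv_inv eps). apply Rinv_lt_contravar; auto. apply Rmult_lt_0_compat; lra.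
Qed.

(** * The transformation of E2 and of the logarithm of Delta *)

Definition Clog (z : C) : C := (ln (Cmod z), Carg z).

(** On the upper half plane one smooth formula replaces the case split of [Carg]; the continuity and
    addition rules of the logarithm start from it. *)
Lemma Carg_upper (z : C) : upper z -> Carg z = PI / 2 - atan (Re z / Im z).
Proof.
  intros Hz. unfold upper in Hz. unfold Carg. destruct z as [x y]; simpl in *.
  destruct (Rlt_dec 0 x) as [H|H].
  - replace (y / x) with (/ (x / y)) by (field; lra). apply atan_inv.
    apply Rdiv_lt_0_compat; auto.
  - destruct (Rlt_dec x 0) as [H'|H'].
    + destruct (Rle_dec 0 y); [|lra].
      replace (y / x) with (- / (- x / y)) by (field; lra).
      rewrite atan_opp, atan_inv by (apply Rdiv_lt_0_compat; lra).
      replace (- x / y) with (- (x / y)) by (field; lra). rewrite atan_opp. field.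
    + destruct (Rlt_dec 0 y); [|lra]. replace x with 0 by lra.
      unfold Rdiv. rewrite Rmult_0_l, atan_0. ring.
Qed.

Lemma Carg_upper_bound (z : C) : upper z -> 0 < Carg z < PI.
Proof.
  intros Hz. rewrite Carg_upper by auto. pose proof (atan_bound (Re z / Im z)). lra.
Qed.

Lemma cpow_Cexp (z : C) (s : R) : z <> 0 -> cpow z s = Cexp (s * Clog z).
Proof.
  intros Hz. unfold cpow. destruct (Ceq_dec z 0); [contradiction|].
  unfold Clog, Cexp. simpl. unfold Rpower.
  replace (s * ln (Cmod z) - 0 * Carg z) with (s * ln (Cmod z)) by ring.
  replace (s * Carg z + 0 * ln (Cmod z)) with (s * Carg z) by ring.
  rewrite exp_0. apply C_eq; simpl; ring.
Qed.

Lemma Cexp_Clog (z : C) : upper z -> Cexp (Clog z) = z.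
Proof.
  intros Hz. unfold Cexp, Clog; simpl. rewrite exp_ln by (apply Cmod_gt_0, upper_neq_0; auto).
  rewrite Carg_upper by auto. rewrite cos_shift, sin_shift, sin_atan, cos_atan.
  unfold upper in Hz. 
  assert (E : Cmod z = Im z * sqrt (1 + (Re z / Im z)²)).
  { unfold Cmod. rewrite <- (sqrt_square (Im z)) at 1 by lra.
    rewrite <- sqrt_mult; [|nra|unfold Rsqr; nra]. f_equal. unfold Rsqr.
    destruct z as [x y]; simpl in *. field. lra. }
  assert (P : 0 < sqrt (1 + (Re z / Im z)²)) by (apply sqrt_lt_R0; pose proof (Rle_0_sqr (Re z / Im z)); lra).
  rewrite E. apply C_eq; simpl; field; lra.
Qed.

Lemma Clog_Cexp (zeta : C) : upper (Cexp zeta) -> - PI < Im zeta < PI -> Clog (Cexp zeta) = zeta.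
Proof.
  intros Hu Hb. pose proof (Cexp_Clog _ Hu) as E. pose proof (Carg_upper_bound _ Hu) as B.
  apply C_eq.
  - simpl. rewrite Cmod_Cexp. apply ln_exp.
  - simpl. set (phi := Carg (Cexp zeta)) in *. unfold Clog in E. fold phi in E.
    rewrite Cmod_Cexp in E. rewrite ln_exp in E. unfold Cexp in E, Hu; simpl in E.
    unfold upper in Hu; simpl in Hu.
    injection E as E1 E2. pose proof (exp_pos (Re zeta)).
    apply Rmult_eq_reg_l in E1; [|lra]. 
    assert (Hs : 0 < sin (Im zeta)) by (apply (Rmult_lt_reg_l (exp (Re zeta))); lra).
    assert (0 < Im zeta).
    { apply Rnot_le_lt. intros Hn. pose proof (sin_ge_0 (- Im zeta) ltac:(lra) ltac:(lra)) as X.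
      rewrite sin_neg in X. lra. }
    apply cos_inj; lra.
Qed.

Lemma Clog_continuous (z : C) : upper z -> forall eps, 0 < eps -> exists delta, 0 < delta /\
  forall w, Cmod (w - z) < delta -> Cmod (Clog w - Clog z) < eps.
Proof.
  intros Hz eps Heps. assert (Hz' := Hz). unfold upper in Hz'.
  destruct z as [x y]. simpl in Hz'.
  assert (C1 : continuity_2d_pt (fun x y => ln (sqrt (x * x + y * y))) x y).
  { apply (continuity_1d_2d_pt_comp (fun t => ln (sqrt t)) (fun x y => x * x + y * y)).
    - apply continuity_pt_filterlim, (ex_derive_continuous (fun t => ln (sqrt t))).
      assert (0 < x * x + y * y) by nra. pose proof (sqrt_lt_R0 _ H). auto_derive. auto.
    - apply continuity_2d_pt_plus; apply continuity_2d_pt_mult;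
        try apply continuity_2d_pt_id1; apply continuity_2d_pt_id2. }
  assert (C2 : continuity_2d_pt (fun x y => PI / 2 - atan (x * / y)) x y).
  { apply (continuity_1d_2d_pt_comp (fun t => PI / 2 - atan t) (fun x y => x * / y)).
    - apply continuity_pt_filterlim, (ex_derive_continuous (fun t => PI / 2 - atan t)).
      auto_derive. auto.
    - apply continuity_2d_pt_mult; [apply continuity_2d_pt_id1|].
      apply (continuity_1d_2d_pt_comp Rinv (fun _ v => v)); [|apply continuity_2d_pt_id2].
      apply continuity_pt_filterlim, (ex_derive_continuous Rinv). auto_derive. lra. }
  assert (He : 0 < eps / 2) by lra.
  destruct (C1 (mkposreal _ He)) as [d1 H1]. destruct (C2 (mkposreal _ He)) as [d2 H2].
  simpl in H1, H2.
  exists (Rmin (y / 2) (Rmin d1 d2)). split.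
  { repeat apply Rmin_pos; try apply cond_pos. lra. }
  intros [u v] Hw.
  split_min Hw W0 Hmin; split_min Hmin W1 W2.
  pose proof (re_le_Cmod ((u, v) - (x, y))) as R1. pose proof (Im_le_Cmod ((u, v) - (x, y))) as R2.
  simpl in R1, R2. fold (u - x) in R1. fold (v - y) in R2.
  assert (Hu : upper (u, v)) by (apply (upper_near (x, y)); auto).
  specialize (H1 u v ltac:(lra) ltac:(lra)). specialize (H2 u v ltac:(lra) ltac:(lra)).
  eapply Rle_lt_trans; [apply Cmod_le_Re_Im|].
  change (Re (Clog (u, v) - Clog (x, y))) with (ln (Cmod (u, v)) - ln (Cmod (x, y))).
  change (Im (Clog (u, v) - Clog (x, y))) with (Carg (u, v) - Carg (x, y)).
  rewrite !Carg_upper by auto. simpl (Re _). simpl (Im _).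
  assert (EC : forall a b, Cmod (a, b) = sqrt (a * a + b * b)).
  { intros a b. unfold Cmod. simpl. f_equal. ring. }
  rewrite !EC. unfold Rdiv in *. lra.
Qed.

(** Derivative of an inverse function: by continuity of [Clog], the expansion of [Cexp] at Clog z
    may be evaluated at Clog w. The bound M / 2 on e' makes |Clog w - Clog z| comparable to |w - z|;
    the other bound gives the final epsilon. *)
Lemma Cdrv_Clog (z : C) : upper z -> Cdrv Clog z (/ z).
Proof.
  intros Hz eps Heps. pose proof (upper_neq_0 z Hz) as Hz0.
  pose proof (proj1 (Cmod_gt_0 z) Hz0) as Hm. set (M := Cmod z) in *.
  set (e' := Rmin (M / 2) (eps * M * M / 2)).
  assert (He' : 0 < e').
  { apply Rmin_pos; [lra|]. apply Rdiv_lt_0_compat; [|lra]. apply Rmult_lt_0_compat; [nra|auto]. }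
  pose proof (Cdrv_Cexp (Clog z)) as HE. rewrite Cexp_Clog in HE by auto.
  destruct (HE e' He') as [d1 [Hd1 H1]].
  destruct (Clog_continuous z Hz d1 Hd1) as [d2 [Hd2 H2]].
  exists (Rmin d2 (Im z / 2)). split; [apply Rmin_pos; auto; unfold upper in Hz; lra|].
  intros w Hw.
  split_min Hw W1 W2.
  assert (Hu : upper w) by (apply (upper_near z); auto).
  specialize (H1 (Clog w) (H2 w W1)). rewrite !Cexp_Clog in H1 by auto.
  set (d := (Clog w - Clog z)%C) in *.
  assert (A : M * Cmod d <= Cmod (w - z) + e' * Cmod d).
  { pose proof (Cmod_sub_triangle (w - z) (w - z - d * z)) as T.
    replace (w - z - (w - z - d * z))%C with (z * d)%C in T by ring.
    rewrite Cmod_mult in T. fold M in T. lra. }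
  assert (e' <= M / 2) by apply Rmin_l. assert (e' <= eps * M * M / 2) by apply Rmin_r.
  pose proof (Cmod_ge_0 d) as Gd.
  assert (B : M * Cmod d <= 2 * Cmod (w - z)) by nra.
  replace (d - (w - z) * / z)%C with (- (/ z * (w - z - d * z)))%C by (field; auto).
  rewrite Cmod_opp, Cmod_mult, Cmod_inv by auto. fold M.
  apply (Rmult_le_reg_l M); auto. rewrite <- Rmult_assoc, Rinv_r, Rmult_1_l by lra.
  eapply Rle_trans; [apply H1|].
  assert (e' * Cmod d <= eps * M * M / 2 * Cmod d) by (apply Rmult_le_compat_r; auto).
  assert (eps * M / 2 * (M * Cmod d) <= eps * M / 2 * (2 * Cmod (w - z))).
  { apply Rmult_le_compat_l; auto. assert (0 <= eps * M) by nra. lra. }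
  lra.
Qed.

Lemma upper_segment (z w : C) (t : R) : upper z -> upper w -> 0 <= t <= 1 ->
  upper (z + t * (w - z)).
Proof.
  unfold upper. intros Hz Hw Ht. destruct z as [x y], w as [u v]; simpl in *.
  replace (y + (t * (v + - y) + 0 * (u + - x))) with ((1 - t) * y + t * v) by ring.
  destruct (Req_dec t 0) as [->|]; [lra|]. assert (0 < t * v) by (apply Rmult_lt_0_compat; lra).
  assert (0 <= (1 - t) * y) by (apply Rmult_le_pos; lra). lra.
Qed.

Lemma dH_zero_constant (f : C -> C) : dH f (fun _ => RtoC 0) ->
  forall z w, upper z -> upper w -> f z = f w.
Proof.
  intros H z w Hz Hw.
  assert (D : forall t, 0 <= t <= 1 ->
    is_derive (fun s : R => Re (f (z + s * (w - z))%C)) t 0 /\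
    is_derive (fun s : R => Im (f (z + s * (w - z))%C)) t 0).
  { intros t Ht. destruct (Cdrv_line f z (w - z) t 0) as [A B].
    - apply H, upper_segment; auto.
    - replace ((w - z) * 0)%C with (RtoC 0) in A, B by ring. auto. }
  assert (E : forall g : R -> R, (forall t, 0 <= t <= 1 -> is_derive g t 0) -> g 0 = g 1).
  { intros g Hg. destruct (MVT_gen g 0 1 (fun _ => 0)) as [c [_ Hc]].
    - intros x Hx. rewrite Rmin_left, Rmax_right in Hx by lra. apply Hg. lra.
    - intros x Hx. rewrite Rmin_left, Rmax_right in Hx by lra.
      apply continuity_pt_filterlim, (ex_derive_continuous g). exists 0. apply Hg. lra.
    - lra. }
  transitivity (f (z + 0 * (w - z))%C); [f_equal; ring|].
  transitivity (f (z + 1 * (w - z))%C); [|f_equal; ring].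
  apply C_eq.
  - apply (E (fun s : R => Re (f (z + s * (w - z))%C))). intros; apply D; auto.
  - apply (E (fun s : R => Im (f (z + s * (w - z))%C))). intros; apply D; auto.
Qed.

Lemma sigma1_le (n : nat) : INR (sigma1 n) <= INR n * INR n.
Proof.
  rewrite sigma1_sumR. apply Rle_trans with (sumR n (fun _ => INR n)).
  - apply sumR_le. intros i Hi. destruct (Nat.eqb (n mod S i) 0); [apply le_INR; lia|apply pos_INR].
  - apply Req_le. generalize (INR n) at 1 3. intros x. induction n.
    + unfold sumR; simpl. ring.
    + rewrite sumR_S, IHn, S_INR. ring.
Qed.

Lemma disc_coef_sigma1 (c : C) (a : nat -> C) :
  (forall n, (1 <= n)%nat -> Cmod (a n) <= Cmod c * INR (sigma1 n)) -> Cmod (a O) <= Cmod c ->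
  disc_coef a.
Proof.
  intros H H0 r Hr.
  apply (ex_series_dominated _
    (fun t => Cmod (c * (1 * INR t) * (1 * INR t)) * r ^ t + Cmod c * r ^ t)).
  - intros t. assert (Hp : 0 <= r ^ t) by (apply pow_le; lra). pose proof (Cmod_ge_0 (a t)).
    split; [apply Rmult_le_pos; auto|].
    rewrite <- Rmult_plus_distr_r. apply Rmult_le_compat_r; auto.
    rewrite !Cmod_mult, Cmod_1, Cmod_R, Rabs_pos_eq by apply pos_INR.
    pose proof (Cmod_ge_0 c). destruct t.
    + simpl. lra.
    + specialize (H (S t) ltac:(lia)). pose proof (sigma1_le (S t)).
      assert (Cmod c * INR (sigma1 (S t)) <= Cmod c * (INR (S t) * INR (S t)))
        by (apply Rmult_le_compat_l; auto). lra.
  - apply (@ex_series_plus R_AbsRing R_NormedModule).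
    + apply (disc_coef_deriv (fun t => c * (1 * INR t))%C 1); auto.
      apply (disc_coef_deriv (fun t => c) 1), disc_coef_const.
    + apply (disc_coef_const c). auto.
Qed.

Lemma sigma1_disc : disc_coef (fun n => RtoC (INR (sigma1 n))).
Proof.
  apply (disc_coef_sigma1 1).
  - intros n Hn. rewrite Cmod_1, Cmod_R, Rabs_pos_eq by apply pos_INR. lra.
  - simpl. rewrite Cmod_0, Cmod_1. lra.
Qed.

Lemma E2_qser (z : C) : upper z -> E2 z = (1 - 24 * qser 1 (fun n => RtoC (INR (sigma1 n))) z)%C.
Proof.
  intros Hz. unfold E2. change (Series _, Series _) with (CS (E2_term z)). do 2 f_equal.
  apply Cser_CS_eq. eapply Cser_ext; [|apply (qser_Cser 1 _ z Rlt_0_1 sigma1_disc Hz)].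
  intros n. unfold E2_term. rewrite Rmult_1_l. auto.
Qed.

Lemma E2_tame (n : nat) : tame n 1 E2.
Proof.
  apply (tame_ext n 1 (fun z => 1 + - RtoC 24 * qser 1 (fun n => RtoC (INR (sigma1 n))) z)%C).
  - intros z Hz. rewrite E2_qser by auto. ring.
  - pose proof (tame_plus n 1 _ _ _ (tame_const n 1)
      (tame_scal n (- RtoC 24) _ _ (qser_tame n 1 _ Rlt_0_1 sigma1_disc))) as T.
    replace (1 + - RtoC 24 * RtoC (INR (sigma1 0)))%C with (RtoC 1) in T by (simpl; ring).
    exact T.
Qed.

Lemma qpow_INR_periodic (n : nat) (z : C) : qpow (INR n) (z + 1) = qpow (INR n) z.
Proof. rewrite !qpow_INR, e1_add, e1_1, Cmult_1_r. auto. Qed.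

Lemma E2_periodic (z : C) : E2 (z + 1) = E2 z.
Proof.
  unfold E2. do 3 f_equal; apply Series_ext; intros n; unfold E2_term;
    rewrite qpow_INR_periodic; auto.
Qed.

(** 24 log prod (1 - q^n) expands as -24 sum (sigma_1(n) / n) q^n. At n = 0 the numerator vanishes,
    so the coefficient is 0 whatever the quotient by 0 stands for. *)
Definition log_coef (n : nat) : C := RtoC (- 24 * INR (sigma1 n) / INR n).

Lemma log_coef_disc : disc_coef log_coef.
Proof.
  apply (disc_coef_sigma1 24).
  - intros n Hn. apply le_INR in Hn. simpl in Hn. unfold log_coef, Rdiv.
    rewrite !Cmod_R, !Rabs_mult, (Rabs_left (-24)), (Rabs_pos_eq 24) by lra.
    rewrite (Rabs_pos_eq (INR _)) by apply pos_INR.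
    rewrite (Rabs_pos_eq (/ _)) by (left; apply Rinv_0_lt_compat; lra).
    assert (/ INR n <= 1) by (rewrite <- Rinv_1; apply Rinv_le_contravar; lra).
    pose proof (pos_INR (sigma1 n)). nra.
  - unfold log_coef, Rdiv. simpl. rewrite !Rmult_0_r, Rmult_0_l, Cmod_0. apply Cmod_ge_0.
Qed.

(** [log_prod] is [log (prod (1 - q^n)^24)]. *)
Definition log_prod : C -> C := qser 1 log_coef.

Lemma log_coef_0 : log_coef 0 = 0.
Proof. unfold log_coef, Rdiv. simpl. rewrite !Rmult_0_r, Rmult_0_l. auto. Qed.

Lemma log_prod_periodic (z : C) : log_prod (z + 1) = log_prod z.
Proof.
  unfold log_prod, qser, CS. f_equal; apply Series_ext; intros n; rewrite !Rmult_1_l,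
    qpow_INR_periodic; auto.
Qed.

Lemma log_prod_tame (n : nat) : tame n 0 log_prod.
Proof. rewrite <- log_coef_0. apply qser_tame; [lra|apply log_coef_disc]. Qed.

Lemma dH_log_prod : dH log_prod (fun z => RtoC (2 * PI) * Ci * (E2 z - 1))%C.
Proof.
  intros z Hz. eapply Cdrv_val; [apply (qser_Cdrv 1 _ z Rlt_0_1 log_coef_disc Hz)|].
  rewrite E2_qser by auto.
  transitivity (- RtoC 24 * (RtoC (2 * PI) * Ci) * qser 1 (fun n => RtoC (INR (sigma1 n))) z)%C; [|ring].
  apply Cser_CS_eq.
  eapply Cser_ext; [|apply Cser_scal, (qser_Cser 1 _ z Rlt_0_1 sigma1_disc Hz)].
  intros n. cbv beta. rewrite Rmult_1_r. destruct n as [|n].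
  - rewrite log_coef_0. simpl. ring.
  - unfold log_coef. pose proof (INR_S_pos n).
    rewrite RtoC_div, (RtoC_mult (-24)) by lra.
    replace (RtoC (-24)) with (- RtoC 24)%C by (rewrite <- RtoC_opp; auto). field. apply RtoC_neq_0; lra.
Qed.

(** The logarithm of q^x prod (1 - q^n)^24. The exponent x stays free because the inversion law is
    first available for x = [zeta2_ratio], before this number is known to be 1. *)
Definition log_hat (x : R) (z : C) : C := (RtoC (2 * PI * x) * Ci * z + log_prod z)%C.

Lemma dH_log_hat (x : R) : dH (log_hat x) (fun z => RtoC (2 * PI) * Ci * (x + (E2 z - 1)))%C.
Proof.
  intros z Hz. eapply Cdrv_val.
  - apply Cdrv_plus; [apply Cdrv_scal, Cdrv_id|apply dH_log_prod; auto].
  - rewrite (RtoC_mult (2 * PI) x). ring.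
Qed.

(** The quotient of [zeta(2)] by [PI^2 / 6]. *)
Definition zeta2_ratio : R := 6 * zeta2 / (PI * PI).

Lemma E2_S_zeta2_ratio (z : C) : upper z ->
  (zeta2_ratio + (E2 (- / z) - 1) = z * z * (zeta2_ratio + (E2 z - 1)) + 6 * z / (PI * Ci))%C.
Proof.
  intros Hz. pose proof (E2_S_zeta2 z Hz) as E. pose proof (upper_neq_0 z Hz) as Hz0.
  pose proof PI_RGT_0 as HP. assert (HP0 : RtoC PI <> 0) by (apply RtoC_neq_0; lra).
  assert (HCi : Ci <> 0) by (intros F; injection F as F; lra).
  assert (HCi2 : (Ci * Ci = - (1))%C) by (apply C_eq; simpl; ring).
  assert (Ez : RtoC zeta2 = (RtoC (PI * PI / 6) * zeta2_ratio)%C).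
  { rewrite <- RtoC_mult. f_equal. unfold zeta2_ratio. field. lra. }
  set (c := RtoC (PI * PI / 6)) in *.
  assert (Hc : c <> 0) by (apply RtoC_neq_0; assert (0 < PI * PI) by nra; lra).
  assert (Ec : (c * 6 = PI * PI)%C).
  { unfold c. rewrite <- !RtoC_mult. f_equal. field. }
  assert (E' : (c * (zeta2_ratio + (E2 (- / z) - 1)) = c * (z * z * (zeta2_ratio + (E2 z - 1))) - z * PI * Ci)%C).
  { transitivity (z * z * (/ (z * z) * (c * (E2 (- / z) - 1)) + zeta2 * (/ (z * z) - 1) + PI * Ci / z)
        + z * z * zeta2 - z * PI * Ci)%C.
    - rewrite Ez. field. auto.
    - rewrite <- E, Ez. ring. }
  transitivity (c * (zeta2_ratio + (E2 (- / z) - 1)) / c)%C; [field; auto|].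
  rewrite E'.
  replace (6 * z / (PI * Ci))%C with (- (z * PI * Ci) / c)%C; [field; auto|].
  transitivity (- (z * PI * Ci) * 6 / (c * 6))%C; [field; auto|].
  rewrite Ec. transitivity (6 * z * (- (Ci * Ci)) / (PI * Ci))%C; [field; auto|].
  rewrite HCi2. f_equal. ring.
Qed.

Lemma Clog_Ci : Clog Ci = (0, PI / 2).
Proof.
  unfold Clog. rewrite Cmod_Ci, ln_1. f_equal. unfold Carg; simpl.
  destruct (Rlt_dec 0 0); [lra|]. destruct (Rlt_dec 0 0); [lra|].
  destruct (Rlt_dec 0 1); [auto|lra].
Qed.

(** By the law of E2 the difference of the two sides has derivative 0. The constant is read off at
    the fixed point Ci of z -> -1/z, where 12 Clog Ci = 6 PI i. *)
Lemma log_hat_S (z : C) : upper z ->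
  log_hat zeta2_ratio (- / z) = (log_hat zeta2_ratio z + 12 * Clog z - 6 * PI * Ci)%C.
Proof.
  intros Hz. pose proof PI_RGT_0 as HP.
  assert (HP0 : RtoC PI <> 0) by (apply RtoC_neq_0; lra).
  assert (HCi : Ci <> 0) by (intros F; injection F as F; lra).
  set (f := fun z => (log_hat zeta2_ratio (- / z) - log_hat zeta2_ratio z - 12 * Clog z)%C).
  assert (D : dH f (fun _ => RtoC 0)).
  { intros w Hw. pose proof (upper_neq_0 w Hw) as Hw0. unfold f. eapply Cdrv_val.
    - apply Cdrv_minus; [apply Cdrv_minus|].
      + apply (Cdrv_comp (log_hat zeta2_ratio) (fun z => - / z)%C w).
        * apply Cdrv_opp, Cdrv_inv_id; auto.
        * apply dH_log_hat, upper_neg_inv; auto.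
      + apply dH_log_hat; auto.
      + apply Cdrv_scal, Cdrv_Clog; auto.
    - cbv beta. rewrite E2_S_zeta2_ratio by auto. rewrite RtoC_mult. field. auto. }
  assert (Hi : upper Ci) by (unfold upper; simpl; lra).
  pose proof (dH_zero_constant f D z Ci Hz Hi) as E. unfold f in E.
  replace (- / Ci)%C with Ci in E.
  2:{ apply C_eq; simpl; field. }
  rewrite Clog_Ci in E.
  replace (12 * (0%R, (PI / 2)%R))%C with (6 * PI * Ci)%C in E by (apply C_eq; simpl; field).
  transitivity (log_hat zeta2_ratio (- / z) - log_hat zeta2_ratio z - 12 * Clog z
    + (log_hat zeta2_ratio z + 12 * Clog z))%C; [ring|].
  rewrite E. ring.
Qed.

Lemma log_hat_T (x : R) (z : C) : log_hat x (z + 1) = (log_hat x z + RtoC (2 * PI * x) * Ci)%C.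
Proof. unfold log_hat. rewrite log_prod_periodic. ring. Qed.

Definition rho : C := Cexp (0, 2 * (PI / 3)).

Lemma rho_eq : rho = (- (1 / 2), sqrt 3 / 2).
Proof.
  unfold rho, Cexp; simpl. rewrite exp_0, cos_2PI3, sin_2PI3. f_equal; field.
Qed.

Lemma rho_upper : upper rho.
Proof. rewrite rho_eq. unfold upper; simpl. pose proof (sqrt_lt_R0 3 ltac:(lra)). lra. Qed.

Lemma rho_plus_1 : (- / rho = rho + 1)%C.
Proof.
  assert (E : (rho * (rho + 1) = - (1))%C).
  { rewrite rho_eq. pose proof (sqrt_sqrt 3 ltac:(lra)). apply C_eq; simpl; nra. }
  pose proof (upper_neq_0 rho rho_upper).
  transitivity (rho * (rho + 1) / rho)%C; [rewrite E|]; field; auto.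
Qed.

(** The relation [(ST)^3 = -1], evaluated at the fixed point of [ST], forces the constant term. *)
Lemma zeta2_ratio_1 : zeta2_ratio = 1.
Proof.
  pose proof (log_hat_S rho rho_upper) as E. rewrite rho_plus_1, log_hat_T in E.
  pose proof PI_RGT_0 as HP.
  assert (EL : Clog rho = (0, 2 * (PI / 3))) by (apply Clog_Cexp; [apply rho_upper|simpl; lra]).
  rewrite EL in E.
  assert (E' : (RtoC (2 * PI * zeta2_ratio) * Ci)%C = (12 * (0%R, (2 * (PI / 3))%R) - 6 * PI * Ci)%C).
  { transitivity (log_hat zeta2_ratio rho + RtoC (2 * PI * zeta2_ratio) * Ci - log_hat zeta2_ratio rho)%C; [ring|].
    rewrite E. ring. }
  (* The imaginary parts read 2 PI x = 8 PI - 6 PI for x = [zeta2_ratio]. *)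
  apply (f_equal Im) in E'. simpl in E'.
  apply (Rmult_eq_reg_l (2 * PI)); lra.
Qed.

Lemma E2_S (z : C) : upper z -> (E2 (- / z) = z * z * E2 z + 6 * z / (PI * Ci))%C.
Proof.
  intros Hz. pose proof (E2_S_zeta2_ratio z Hz) as E. rewrite zeta2_ratio_1 in E.
  transitivity (1 + (E2 (- / z) - 1))%C; [ring|]. rewrite E. ring.
Qed.

Definition logDelta : C -> C := log_hat 1.

Lemma logDelta_S (z : C) : upper z ->
  logDelta (- / z) = (logDelta z + 12 * Clog z - 6 * PI * Ci)%C.
Proof. unfold logDelta. rewrite <- zeta2_ratio_1. apply log_hat_S. Qed.

(** * Determinants *)

Fixpoint prodC (n : nat) (c : nat -> C) : C :=
  match n with O => RtoC 1 | S n' => (prodC n' c * c n')%C end.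

Module LinAlg.
Import all_boot perm all_algebra boolp GRing.Theory.
Set Implicit Arguments.
Unset Strict Implicit.
Local Open Scope ring_scope.
Local Notation C0 := (RtoC (IZR Z0)).
Local Notation C1 := (RtoC (IZR (Zpos xH))).

HB.instance Definition _ := gen_eqMixin C.
HB.instance Definition _ := gen_choiceMixin C.

Lemma Cadd0 : left_id C0 Cplus.
Proof. exact: Cplus_0_l. Qed.
Lemma CaddN : left_inverse C0 Copp Cplus.
Proof. by move=> x; rewrite Cplus_comm Cplus_opp_r. Qed.
Lemma Cmul1 : left_id C1 Cmult.
Proof. exact: Cmult_1_l. Qed.
Lemma CmulDl : left_distributive Cmult Cplus.
Proof. move=> x y z; exact: Cmult_plus_distr_r. Qed.
Lemma Cone_neq0 : (C1 : C) != C0.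
Proof. by apply/eqP => /RtoC_inj; exact: R1_neq_R0. Qed.

HB.instance Definition _ := GRing.isZmodule.Build C Cplus_assoc Cplus_comm Cadd0 CaddN.
HB.instance Definition _ :=
  GRing.Zmodule_isComNzRing.Build C Cmult_assoc Cmult_comm Cmul1 CmulDl Cone_neq0.

Lemma CmulV (x : C) : x != 0 -> Cmult (Cinv x) x = 1.
Proof. by move/eqP => Hx; rewrite Cmult_comm Cinv_r. Qed.
Lemma Cinv0 : Cinv (0 : C) = 0.
Proof.
rewrite /Cinv /=; apply: injective_projections => /=; rewrite /Rdiv ?Ropp_0; exact: Rmult_0_l.
Qed.
HB.instance Definition _ := GRing.ComNzRing_isField.Build C CmulV Cinv0.

(** Outside this module matrices are functions on [nat], so that the analytic statements involve no
    ordinals; [mx] cuts out the square corner of size n. *)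
Definition mx n (A : nat -> nat -> C) : 'M[C]_n := \matrix_(i < n, j < n) A i j.
Definition det (n : nat) (A : nat -> nat -> C) : C := \det (mx n A).

Lemma sumC_big n (f : nat -> C) : sumC n f = \sum_(i < n) f i.
Proof.
elim: n => [|n IHn]; first by rewrite big_ord0.
by rewrite sumC_S IHn big_ord_recr.
Qed.

Lemma prodC_big n (f : nat -> C) : prodC n f = \prod_(i < n) f i.
Proof.
elim: n => [|n IHn]; first by rewrite big_ord0.
by rewrite /= IHn big_ord_recr.
Qed.

Lemma det_ext n (A B : nat -> nat -> C) :
  (forall i j, Nat.lt i n -> Nat.lt j n -> A i j = B i j) -> det n A = det n B.
Proof.
move=> E; congr (\det _); apply/matrixP => i j; rewrite !mxE; apply: E; exact/ltP.
Qed.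

Lemma det_mul n (A B : nat -> nat -> C) :
  det n (fun i j => sumC n (fun l => Cmult (A i l) (B l j))) = Cmult (det n A) (det n B).
Proof.
transitivity (\det (mx n A *m mx n B)); last exact: det_mulmx.
congr (\det _); apply/matrixP => i j; rewrite !mxE sumC_big; apply: eq_bigr => l _; by rewrite !mxE.
Qed.

Lemma det_scale_col n (c : nat -> C) (A : nat -> nat -> C) :
  det n (fun i j => Cmult (c j) (A i j)) = Cmult (prodC n c) (det n A).
Proof.
change (Cmult (prodC n c) (det n A)) with (prodC n c * det n A).
have -> : det n (fun i j => Cmult (c j) (A i j)) =
          \det (mx n A *m diag_mx (\row_(j < n) c j)).
  congr (\det _); apply/matrixP => i j; rewrite !mxE (bigD1 j) //= big1 ?addr0.
    by rewrite !mxE eqxx mulr1n mulrC.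
  by move=> l nlj; rewrite !mxE (negPf nlj) mulr0n mulr0.
rewrite det_mulmx det_diag prodC_big mulrC; congr (_ * _).
by apply: eq_bigr => i _; rewrite !mxE.
Qed.

Lemma det_scale_row n (c : nat -> C) (A : nat -> nat -> C) :
  det n (fun i j => Cmult (c i) (A i j)) = Cmult (prodC n c) (det n A).
Proof.
change (Cmult (prodC n c) (det n A)) with (prodC n c * det n A).
have -> : det n (fun i j => Cmult (c i) (A i j)) =
          \det (diag_mx (\row_(j < n) c j) *m mx n A).
  congr (\det _); apply/matrixP => i j; rewrite !mxE (bigD1 i) //= big1 ?addr0.
    by rewrite !mxE eqxx mulr1n.
  by move=> l nlj; rewrite !mxE eq_sym (negPf nlj) mulr0n mul0r.
rewrite det_mulmx det_diag prodC_big; congr (_ * _).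
by apply: eq_bigr => i _; rewrite !mxE.
Qed.

(** By the Leibniz formula a determinant is a polynomial in its entries. The relation meant is
    between a function and its value at the cusp, so that the limit of a determinant is the
    determinant of the limits. *)
Lemma det_closed (P : (C -> C) -> C -> Prop) n (A : C -> nat -> nat -> C) (a : nat -> nat -> C) :
  (forall f g c, (forall z, f z = g z) -> P f c -> P g c) ->
  (forall c, P (fun _ => c) c) ->
  (forall f g c d, P f c -> P g d -> P (fun z => Cplus (f z) (g z)) (Cplus c d)) ->
  (forall f g c d, P f c -> P g d -> P (fun z => Cmult (f z) (g z)) (Cmult c d)) ->
  (forall i j, Nat.lt i n -> Nat.lt j n -> P (fun z => A z i j) (a i j)) ->
  P (fun z => det n (A z)) (det n a).
Proof.
move=> Pext Pc Pp Pm PA; rewrite /det /determinant.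
have Psum (I : Type) (r : seq I) (F : I -> C -> C) (b : I -> C) :
    (forall s, P (F s) (b s)) -> P (fun z => \sum_(s <- r) F s z) (\sum_(s <- r) b s).
  move=> PF; elim: r => [|s r IHr].
    rewrite big_nil; apply: (Pext (fun _ => 0)) => [z|]; last exact: Pc.
    by rewrite big_nil.
  rewrite big_cons; apply: (Pext (fun z => F s z + \sum_(s <- r) F s z)) => [z|].
    by rewrite big_cons.
  exact: Pp.
have Pprod (I : Type) (r : seq I) (F : I -> C -> C) (b : I -> C) :
    (forall s, P (F s) (b s)) -> P (fun z => \prod_(s <- r) F s z) (\prod_(s <- r) b s).
  move=> PF; elim: r => [|s r IHr].
    rewrite big_nil; apply: (Pext (fun _ => 1)) => [z|]; last exact: Pc.
    by rewrite big_nil.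
  rewrite big_cons; apply: (Pext (fun z => F s z * \prod_(s <- r) F s z)) => [z|].
    by rewrite big_cons.
  exact: Pm.
apply: (Psum _ _ (fun (s : 'S_n) z => (-1) ^+ s * \prod_i mx n (A z) i (s i))) => s.
apply: (Pm (fun _ => (-1) ^+ s)); first exact: Pc.
apply: (Pprod _ _ (fun (i : 'I_n) z => mx n (A z) i (s i))) => i.
rewrite mxE; apply: (Pext (fun z => A z i (s i))) => [z|]; first by rewrite mxE.
by apply: PA; exact/ltP.
Qed.

Definition skip (j l : nat) : nat := if Nat.ltb l j then l else S l.
Definition minor (n : nat) (A : nat -> nat -> C) (j : nat) : C := det n (fun i l => A i (skip j l)).

Lemma minor_last n (A : nat -> nat -> C) : minor n A n = det n A.
Proof.
apply: det_ext => i j _ /Nat.ltb_lt Hj; by rewrite /skip Hj.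
Qed.

(** Laplace expansion of the determinant with row [i] repeated. *)
Lemma minor_relation n (A : nat -> nat -> C) (i : nat) : Nat.lt i n ->
  sumC (S n) (fun j => Cmult (Cmult (Cpow (Copp C1) j) (minor n A j)) (A i j)) = C0.
Proof.
move=> /ltP Hi.
pose B : 'M[C]_n.+1 := \matrix_(r < n.+1, j < n.+1) A (if (r : nat) is r'.+1 then r' else i) j.
have HB : \det B = 0.
  apply: (@determinant_alternate _ _ B ord0 (lift ord0 (Ordinal Hi))) => //= j.
  by rewrite !mxE.
rewrite -[RHS]HB (expand_det_row B ord0) sumC_big; apply: eq_bigr => j _.
rewrite mxE /= mulrC; congr (_ * _).
rewrite /cofactor add0n; congr (_ * _).
  by elim: (nat_of_ord j) => [|k IHk] //=; rewrite exprS -IHk.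
congr (\det _); apply/matrixP => r l; rewrite !mxE /=.
congr (A _ _); rewrite /skip /bump.
case: (Nat.ltb_spec l j) => [/ltP H|/leP H]; first by rewrite leqNgt H.
by rewrite H.
Qed.

Lemma det_0_kernel n (A : nat -> nat -> C) : det n A = C0 ->
  exists c : nat -> C, (exists i, Nat.lt i n /\ c i <> C0) /\
    forall j, Nat.lt j n -> sumC n (fun i => Cmult (c i) (A i j)) = C0.
Proof.
move=> /eqP /det0P [v nzv Hv].
have /rV0Pn [i nzi] := nzv.
exists (fun k => if insub k is Some k' then v ord0 k' else 0); split.
  exists i; split; first exact/ltP.
  by rewrite valK; apply/eqP.
move=> j /ltP Hj; rewrite sumC_big.
move/rowP/(_ (Ordinal Hj)): Hv; rewrite !mxE => Hv.
etransitivity; last exact: Hv.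
apply: eq_bigr => k _.
by rewrite valK mxE.
Qed.

Lemma kernel_det_0 n (A : nat -> nat -> C) (c : nat -> C) :
  (exists i, Nat.lt i n /\ c i <> C0) ->
  (forall j, Nat.lt j n -> sumC n (fun i => Cmult (c i) (A i j)) = C0) ->
  det n A = C0.
Proof.
move=> [i [/ltP Hi nzi]] H; apply/eqP/det0P; exists (\row_(k < n) c k).
  by apply/eqP => /rowP /(_ (Ordinal Hi)); rewrite !mxE.
apply/rowP => j; rewrite !mxE; have /ltP Hj := ltn_ord j; move: (H j Hj).
rewrite sumC_big => Hc; etransitivity; last exact: Hc.
by apply: eq_bigr => k _; rewrite !mxE.
Qed.

(** The Newton polynomials are monic of degree j, hence unitriangular over the monomials, and the
    determinant is that of Vandermonde. They arise here as the leading coefficients of the iterated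
    Serre derivatives of powers of q. *)
Lemma newton_vandermonde_neq_0 n (x : nat -> C) (c : nat -> C) :
  (forall i j, Nat.lt i n -> Nat.lt j n -> i <> j -> x i <> x j) ->
  det n (fun i j => prodC j (fun l => Cminus (x i) (c l))) <> C0.
Proof.
move=> Hx.
pose p j : {poly C} := \prod_(l < j) ('X - (c l)%:P).
have size_p j : size (p j) = j.+1 by rewrite size_prod_XsubC [index_enum _]unlock -enumT size_enum_ord.
have horner_p j (y : C) : (p j).[y] = prodC j (fun l => Cminus y (c l)).
  rewrite prodC_big /p horner_prod; apply: eq_bigr => l _.
  by rewrite hornerXsubC.
pose V := Vandermonde n (\row_(i < n) x i).
pose T : 'M[C]_n := \matrix_(l < n, j < n) (p j)`_l.
have -> : det n (fun i j => prodC j (fun l => Cminus (x i) (c l))) = \det (V^T *m T).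
  congr (\det _); apply/matrixP => i j; rewrite !mxE -horner_p.
  rewrite (@horner_coef_wide _ n) ?size_p //; apply: eq_bigr => l _.
  by rewrite !mxE mulrC.
have HT : \det T = 1.
  rewrite -det_tr det_trig.
    rewrite big1 // => j _; rewrite !mxE.
    have /monicP := monic_prod_XsubC (index_enum 'I_j) xpredT (fun l : 'I_j => c l).
    by rewrite lead_coefE -/(p j) size_p.
  apply/is_trig_mxP => i j Hij; rewrite !mxE nth_default // size_p.
  exact: Hij.
rewrite det_mulmx HT mulr1 det_tr det_Vandermonde.
apply/eqP/prodf_neq0 => i _; apply/prodf_neq0 => j Hij.
rewrite !mxE subr_eq0; apply/eqP; apply: Hx; try exact/ltP.
by move=> E; rewrite E ltnn in Hij.
Qed.
End LinAlg.

(** * Generators of SL(2,Z) *)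

Lemma Cpow_neg_inv (w : nat) (z : C) : z <> 0 ->
  ((- / z) ^ w * z ^ w = (- (1)) ^ w)%C.
Proof.
  intros Hz. rewrite <- Cpow_mult_l. f_equal. field. auto.
Qed.

Lemma Z_jfac_neq_0 (c d : Z) (z : C) : upper z -> (c <> 0 \/ d <> 0)%Z ->
  (RtoC (IZR c) * z + RtoC (IZR d))%C <> 0.
Proof.
  intros Hz H E. unfold upper in Hz.
  pose proof (f_equal Im E) as E1. pose proof (f_equal Re E) as E2. simpl in E1, E2.
  assert (IZR c * Im z = 0) by (unfold Im; lra).
  apply Rmult_integral in H0. destruct H0 as [H0|H0]; [|lra].
  rewrite H0 in E2. assert (IZR d = 0) by lra.
  apply eq_IZR_R0 in H0. apply eq_IZR_R0 in H1. lia.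
Qed.

Lemma neg_inv_involutive (z : C) : z <> 0 -> (- / (- / z) = z)%C.
Proof.
  intros Hz. assert (Hi := Cinv_neq_0 z Hz). set (u := (- / z)%C).
  assert (Hu : u <> 0).
  { intros E. apply Hi. replace (/ z)%C with (- u)%C by (unfold u; ring). rewrite E. ring. }
  assert (E : (u * - z = 1)%C) by (unfold u; field; auto).
  transitivity (- (/ u * (u * - z)))%C; [rewrite E; ring|]. field. auto.
Qed.

(** Euclid's algorithm on the bottom row: [S] and [T] generate. *)
Lemma modular_generators (w : nat) (g : C -> C) :
  (forall z, upper z -> g (z + 1)%C = g z) ->
  (forall z, upper z -> g (- / z)%C = (z ^ w * g z)%C) ->
  forall A z, upper z -> g (mob A z) = (jfac A z ^ w * g z)%C.
Proof.
  intros HT HS.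
  (* Applying [HS] twice gives the action of the matrix -1, which is needed for both signs of the
     diagonal in the base case. *)
  assert (Hsgn : forall z, upper z -> ((- (1)) ^ w * g z = g z)%C).
  { intros z Hz. pose proof (upper_neq_0 z Hz) as Hz0.
    rewrite <- (Cpow_neg_inv w z Hz0), <- Cmult_assoc, <- HS, <- HS;
      auto using upper_neg_inv.
    f_equal. field. auto. }
  assert (HTn : forall (k : Z) z, upper z -> g (z + IZR k)%C = g z) by (intros k z Hz; apply (periodic_Z g HT); auto).
  (* Stated for integer entries, so that the induction on |c| handles the determinant condition as a
     plain hypothesis and not as a record field. *)
  assert (M : forall (N : nat) (a b c d : Z), (Z.abs_nat c < N)%nat -> (a * d - b * c = 1)%Z ->
     forall z, upper z -> g ((IZR a * z + IZR b) / (IZR c * z + IZR d))%C = ((IZR c * z + IZR d) ^ w * g z)%C).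
  { induction N; intros a b c d HN Hdet z Hz; [lia|]. pose proof (upper_neq_0 z Hz) as Hz0.
    destruct (Z.eq_dec c 0) as [->|Hc].
    - assert (H1 : (a = 1 /\ d = 1 \/ a = -1 /\ d = -1)%Z).
      { rewrite Z.mul_0_r, Z.sub_0_r in Hdet. apply Z.mul_eq_1 in Hdet as Ha.
        destruct Ha; subst; lia. }
      destruct H1 as [[-> ->]|[-> ->]].
      + replace ((1 * z + IZR b) / (0 * z + 1))%C with (z + IZR b)%C by (field; apply RtoC_neq_0; lra).
        rewrite HTn by auto. replace (0 * z + 1)%C with (RtoC 1) by ring.
        rewrite Cpow_1_l. ring.
      + replace ((IZR (-1) * z + IZR b) / (0 * z + IZR (-1)))%C with (z + IZR (- b))%C.
        2:{ rewrite opp_IZR, RtoC_opp. replace (RtoC (-1)) with (- (1))%C by (rewrite <- RtoC_opp; auto).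
            field; repeat split; intros E; apply (f_equal Re) in E; simpl in E; lra. }
        rewrite HTn by auto. replace (0 * z + IZR (-1))%C with (- (1))%C by (apply C_eq; simpl; ring).
        symmetry. apply Hsgn; auto.
    (* The point z is replaced by u = -1/(z - k). The new lower left entry is d + k c = d mod c,
       smaller than c in absolute value. *)
    - set (k := (- (d / c))%Z).
      assert (Hk : (Z.abs_nat (d + k * c) < N)%nat).
      { unfold k. pose proof (Z.div_mod d c Hc) as E.
        replace (d + - (d / c) * c)%Z with (d mod c)%Z by lia.
        pose proof (Z.mod_bound_or d c Hc) as B. lia. }
      assert (Hdet' : ((b + k * a) * - c - (- a) * (d + k * c) = 1)%Z) by lia.
      set (u := (- / (z - IZR k))%C).
      assert (Hzk : upper (z - IZR k)).
      { replace (z - IZR k)%C with (z + RtoC (IZR (- k)))%C by (rewrite opp_IZR, RtoC_opp; ring).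
        apply upper_plus_R; auto. }
      pose proof (upper_neq_0 _ Hzk) as Hzk0.
      pose proof (IHN (b + k * a)%Z (- a)%Z (d + k * c)%Z (- c)%Z Hk Hdet' u (upper_neg_inv _ Hzk)) as I.
      pose proof (Z_jfac_neq_0 c d z Hz (or_introl Hc)) as Hj.
      rewrite !plus_IZR, !mult_IZR, !opp_IZR, !RtoC_plus, !RtoC_mult, !RtoC_opp in I.
      assert (E1 : ((IZR d + IZR k * IZR c) * u + - IZR c)%C = (- ((IZR c * z + IZR d) / (z - IZR k)))%C)
        by (unfold u; field; auto).
      assert (E2 : ((IZR b + IZR k * IZR a) * u + - IZR a)%C = (- ((IZR a * z + IZR b) / (z - IZR k)))%C)
        by (unfold u; field; auto).
      rewrite E1, E2 in I.
      replace (- ((IZR a * z + IZR b) / (z - IZR k)) / - ((IZR c * z + IZR d) / (z - IZR k)))%C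
        with ((IZR a * z + IZR b) / (IZR c * z + IZR d))%C in I by (field; auto).
      rewrite I. unfold u. rewrite HS by auto.
      replace (- ((IZR c * z + IZR d) / (z - IZR k)))%C with ((IZR c * z + IZR d) * - / (z - IZR k))%C by (field; auto).
      rewrite Cpow_mult_l, <- !Cmult_assoc, (Cmult_assoc ((- / (z - IZR k)) ^ w)), Cpow_neg_inv by auto.
      rewrite Hsgn by auto. f_equal.
      replace (z - IZR k)%C with (z + RtoC (IZR (- k)))%C by (rewrite opp_IZR, RtoC_opp; ring).
      apply HTn; auto. }
  intros A z Hz. unfold mob, jfac. apply (M (S (Z.abs_nat (sc A)))); auto. apply (sdet A).
Qed.

(** On the upper half plane arg (-1/z) = PI - arg z with no multiple of 2 PI to correct, so the real
    power s turns S^2 into the factor e^(i PI s). *)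
Lemma Cexp_Clog_neg_inv (s : R) (z : C) : upper z ->
  (Cexp (s * Clog (- / z)) * Cexp (s * Clog z))%C = Cexp (Ci * RtoC (PI * s)).
Proof.
  intros Hz. rewrite <- Cexp_add. f_equal.
  assert (E : (Clog (- / z) + Clog z = Ci * PI)%C).
  { pose proof (upper_neg_inv z Hz) as Hz'. pose proof (upper_neq_0 z Hz) as Hz0.
    pose proof (proj1 (Cmod_gt_0 z) Hz0) as Hm.
    unfold Clog. rewrite Cmod_opp, Cmod_inv by auto. rewrite ln_Rinv by auto.
    rewrite !Carg_upper by auto.
    assert (X : Re (- / z)%C / Im (- / z)%C = - (Re z / Im z)).
    { unfold upper in Hz. destruct z as [x y]; simpl in *. field; repeat split; nra. }
    rewrite X, atan_opp. apply C_eq; simpl; field. }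
  rewrite <- Cmult_plus_distr_l, E, RtoC_mult. ring.
Qed.

Lemma Cpow_Clog (w : nat) (z : C) : upper z -> Cexp (INR w * Clog z) = (z ^ w)%C.
Proof.
  intros Hz. induction w.
  - simpl. rewrite Cmult_0_l, Cexp_0. auto.
  - rewrite S_INR, RtoC_plus, Cmult_plus_distr_r, Cexp_add, IHw, Cmult_1_l, Cexp_Clog by auto.
    simpl. ring.
Qed.

(** Uses the relations [S^2 = -1] and [(ST)^3 = -1]. *)
Lemma trivial_multiplier (h : C -> C) (mu : C) (s : R) (z : C) : upper z -> h z <> 0 ->
  (forall w, upper w -> h (w + 1)%C = h w) ->
  (forall w, upper w -> h (- / w)%C = (mu * Cexp (s * Clog w) * h w)%C) ->
  mu = 1 /\ exists N : Z, s = 2 * IZR N.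
Proof.
  intros Hz Hh HT HS. pose proof (upper_neq_0 z Hz) as Hz0.
  set (e := Cexp (Ci * RtoC (PI * s))).
  assert (R1 : (mu * mu * e = 1)%C).
  { pose proof (HS (- / z)%C (upper_neg_inv z Hz)) as E. rewrite (HS z Hz) in E.
    rewrite neg_inv_involutive in E by auto.
    unfold e. rewrite <- (Cexp_Clog_neg_inv s z Hz).
    transitivity (mu * Cexp (s * Clog (- / z)) * (mu * Cexp (s * Clog z) * h z) / h z)%C; [field; auto|].
    rewrite <- E. field. auto. }
  assert (R2 : (mu * mu * mu * e = 1)%C).
  { set (z1 := (z + 1)%C). assert (H1 : upper z1) by (apply (upper_plus_R z 1); auto).
    set (a := (- / z1)%C). assert (Ha : upper a) by (apply upper_neg_inv; auto).
    assert (H2 : upper (a + 1)) by (apply (upper_plus_R a 1); auto).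
    set (b := (- / (a + 1))%C). assert (Hb : upper b) by (apply upper_neg_inv; auto).
    assert (H3 : upper (b + 1)) by (apply (upper_plus_R b 1); auto).
    pose proof (upper_neq_0 _ H1) as N1. pose proof (upper_neq_0 _ H2) as N2.
    assert (Ea : (a + 1 = z / z1)%C) by (unfold a, z1 in *; field; auto).
    assert (Eb : (b + 1 = - / z)%C).
    { unfold b. rewrite Ea. unfold z1 in *. field. auto. }
    pose proof (HS _ H1) as E1. fold a in E1. unfold z1 in E1 at 2. rewrite HT in E1 by auto.
    pose proof (HS _ H2) as E2. fold b in E2. rewrite HT in E2 by auto.
    pose proof (HS _ H3) as E3. rewrite HT in E3 by auto.
    replace (- / (b + 1))%C with z in E3 by (rewrite Eb, neg_inv_involutive; auto).
    rewrite E2, E1 in E3. rewrite Eb, Ea in E3.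
    (* Both arguments lie in (0, PI) and z / z1 is again in the upper half plane, so the logarithm
       splits without a multiple of 2 PI i. *)
    assert (EL : Clog (z / z1) = (Clog z - Clog z1)%C).
    { assert (X : Cexp (Clog z - Clog z1) = (z / z1)%C).
      { unfold Cminus. rewrite Cexp_add, Cexp_opp, !Cexp_Clog by auto. auto. }
      rewrite <- X. apply Clog_Cexp.
      - rewrite X, <- Ea. auto.
      - pose proof (Carg_upper_bound z Hz). pose proof (Carg_upper_bound z1 H1). simpl. lra. }
    rewrite EL in E3.
    unfold e. rewrite <- (Cexp_Clog_neg_inv s z Hz).
    transitivity (mu * Cexp (s * Clog (- / z)) * (mu * Cexp (s * (Clog z - Clog z1)) * (mu * Cexp (s * Clog z1) * h z)) / h z)%C.
    - replace (Cexp (s * Clog z)) with (Cexp (s * (Clog z - Clog z1)) * Cexp (s * Clog z1))%C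
        by (rewrite <- Cexp_add; f_equal; ring).
      field. auto.
    - rewrite <- E3. field. auto. }
  (* R2 is mu times R1, which forces mu = 1. Then e^(i PI s) = 1, and cos (PI s) = 1 makes s / 2 an
     integer. *)
  assert (Hmu : mu = 1).
  { transitivity (mu * (mu * mu * e))%C; [rewrite R1; ring|]. rewrite <- R2. ring. }
  split; auto. rewrite Hmu in R1.
  assert (He : e = 1) by (rewrite <- R1; ring).
  unfold e in He. rewrite Cexp_iR in He. injection He as Hc _.
  pose proof (cos_sub1 (PI * s)) as X. rewrite Hc in X.
  assert (Hs0 : sin (PI * s / 2) = 0) by nra.
  apply sin_eq_0_0 in Hs0. destruct Hs0 as [N HN]. exists N.
  pose proof PI_RGT_0. apply (Rmult_eq_reg_l (PI / 2)); lra.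
Qed.

(** * Serre derivatives *)

Lemma Ci_neq_0 : Ci <> 0.
Proof. intros F. injection F as F. lra. Qed.

Lemma PI_C_neq_0 : RtoC PI <> 0.
Proof. apply RtoC_neq_0. pose proof PI_RGT_0. lra. Qed.

Lemma Dk_Cdrv (kap : R) (f : C -> C) (z d : C) : Cdrv f z d ->
  Dk kap f z = (d / (RtoC (2 * PI) * Ci) - RtoC (kap / 12) * (E2 z * f z))%C.
Proof. intros H. unfold Dk, qderiv. rewrite (Cdrv_C_derive f z d H). auto. Qed.

Definition tame_all (c : C) (f : C -> C) : Prop := forall n, tame n c f.

Lemma tame_all_deriv (c : C) (f : C -> C) : tame_all c f ->
  dH f (C_derive f) /\ tame_all 0 (C_derive f).
Proof.
  intros H.
  assert (E : forall f', dH f f' -> forall z, upper z -> f' z = C_derive f z).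
  { intros f' Hd z Hz. symmetry. apply Cdrv_C_derive. auto. }
  split.
  - destruct (H 1%nat) as [_ [f' [Hd _]]]. intros z Hz. rewrite <- (E f' Hd z Hz). auto.
  - intros n. destruct (H (S n)) as [_ [f' [Hd Ht]]]. apply (tame_ext n 0 f'); auto.
Qed.

Lemma tame_all_const (c : C) : tame_all c (fun _ => c).
Proof. intros n. apply tame_const. Qed.

Lemma tame_all_plus (c d : C) (f g : C -> C) :
  tame_all c f -> tame_all d g -> tame_all (c + d) (fun z => f z + g z)%C.
Proof. intros H H' n. apply tame_plus; auto. Qed.

Lemma tame_all_mult (c d : C) (f g : C -> C) :
  tame_all c f -> tame_all d g -> tame_all (c * d) (fun z => f z * g z)%C.
Proof. intros H H' n. apply tame_mult; auto. Qed.

Lemma tame_all_scal (k c : C) (f : C -> C) : tame_all c f -> tame_all (k * c) (fun z => k * f z)%C.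
Proof. intros H n. apply tame_scal; auto. Qed.

Lemma tame_all_ext (c : C) (f g : C -> C) : (forall z, upper z -> f z = g z) ->
  tame_all c f -> tame_all c g.
Proof. intros E H n. apply (tame_ext n c f); auto. Qed.

(** At the cusp E2 tends to 1 and the derivative of g to 0, so the Serre derivative multiplies the
    leading coefficient by lam - kap / 12. *)
Lemma Dk_qpow_tame (kap lam : R) (c : C) (f g : C -> C) :
  (forall z, upper z -> f z = (qpow lam z * g z)%C) -> tame_all c g ->
  exists g2, (forall z, upper z -> Dk kap f z = (qpow lam z * g2 z)%C) /\
    tame_all (c * (RtoC lam - RtoC (kap / 12))) g2.
Proof.
  intros E Hg. destruct (tame_all_deriv c g Hg) as [Dg Tg].
  exists (fun z => (g z * (RtoC lam + - RtoC (kap / 12) * E2 z)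
            + / (RtoC (2 * PI) * Ci) * C_derive g z)%C). split.
  - intros z Hz.
    rewrite (Dk_Cdrv kap f z (RtoC (2 * PI * lam) * Ci * qpow lam z * g z + qpow lam z * C_derive g z)%C).
    + rewrite E by auto. rewrite (RtoC_mult (2 * PI) lam). field. 
      split; [apply Ci_neq_0|]. apply RtoC_neq_0. pose proof PI_RGT_0; lra.
    + apply (Cdrv_ext_upper (fun z => qpow lam z * g z)%C); auto.
      * intros; symmetry; auto.
      * apply Cdrv_mult; [apply Cdrv_qpow|auto].
  - replace (c * (RtoC lam - RtoC (kap / 12)))%C
      with (c * (RtoC lam + - RtoC (kap / 12) * 1) + / (RtoC (2 * PI) * Ci) * 0)%C by ring.
    apply tame_all_plus; [apply tame_all_mult; auto|apply tame_all_scal; auto].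
    apply tame_all_plus; [apply tame_all_const|apply tame_all_scal].
    intros n. apply E2_tame.
Qed.

Lemma Dk_iter_qpow_tame (k lam : R) (c : C) (f g : C -> C) (j : nat) :
  (forall z, upper z -> f z = (qpow lam z * g z)%C) -> tame_all c g ->
  tame_all (c * prodC j (fun l => RtoC lam - RtoC ((k + 2 * INR l) / 12)%R))%C
    (fun z => / qpow lam z * Dk_iter k j f z)%C.
Proof.
  intros E Hg.
  assert (H : exists g2, (forall z, upper z -> Dk_iter k j f z = (qpow lam z * g2 z)%C) /\
    tame_all (c * prodC j (fun l => RtoC lam - RtoC ((k + 2 * INR l) / 12)%R))%C%C g2).
  { induction j as [|j [g1 [E1 T1]]].
    - exists g. split; auto. simpl. rewrite Cmult_1_r. auto.
    - destruct (Dk_qpow_tame (k + 2 * INR j) lam _ _ g1 E1 T1) as [g2 [E2 T2]].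
      exists g2. split; auto. simpl. rewrite Cmult_assoc. exact T2. }
  destruct H as [g2 [E2 T2]]. apply (tame_all_ext _ g2); auto.
  intros z Hz. rewrite E2 by auto. field. apply qpow_neq_0.
Qed.

Lemma Dk_iter_dH (k lam : R) (c : C) (f g : C -> C) (j : nat) :
  (forall z, upper z -> f z = (qpow lam z * g z)%C) -> tame_all c g ->
  dH (Dk_iter k j f) (C_derive (Dk_iter k j f)).
Proof.
  intros E Hg z Hz. pose proof (Dk_iter_qpow_tame k lam c f g j E Hg) as T.
  destruct (T 1%nat) as [_ [g' [Hd _]]].
  assert (X : Cdrv (Dk_iter k j f) z
     (RtoC (2 * PI * lam) * Ci * qpow lam z * (/ qpow lam z * Dk_iter k j f z) + qpow lam z * g' z)%C).
  { apply (Cdrv_ext_upper (fun z => qpow lam z * (/ qpow lam z * Dk_iter k j f z))%C); auto.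
    - intros w Hw. field. apply qpow_neq_0.
    - apply (Cdrv_mult (qpow lam) (fun z => / qpow lam z * Dk_iter k j f z)%C); [apply Cdrv_qpow|auto]. }
  rewrite (Cdrv_C_derive _ _ _ X). auto.
Qed.

Lemma Cdrv_sumC (n : nat) (c : nat -> C) (f f' : nat -> C -> C) (z : C) :
  (forall i, (i < n)%nat -> Cdrv (f i) z (f' i z)) ->
  Cdrv (fun w => sumC n (fun i => c i * f i w)%C) z (sumC n (fun i => c i * f' i z)%C).
Proof.
  induction n; intros H.
  - unfold sumC; simpl. apply Cdrv_const.
  - apply (Cdrv_ext (fun w => sumC n (fun i => c i * f i w)%C + c n * f n w)%C).
    + intros w. rewrite sumC_S. auto.
    + rewrite sumC_S. apply Cdrv_plus; [apply IHn; auto|apply Cdrv_scal; auto].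
Qed.

Lemma Dk_sumC (kap : R) (n : nat) (c : nat -> C) (f f' : nat -> C -> C) (z : C) :
  (forall i, (i < n)%nat -> Cdrv (f i) z (f' i z)) ->
  Dk kap (fun w => sumC n (fun i => c i * f i w)%C) z = sumC n (fun i => c i * Dk kap (f i) z)%C.
Proof.
  intros H. rewrite (Dk_Cdrv kap _ z _ (Cdrv_sumC n c f f' z H)).
  rewrite (sumC_ext n (fun i => c i * Dk kap (f i) z)%C
    (fun i => / (RtoC (2 * PI) * Ci) * (c i * f' i z) + - RtoC (kap / 12) * E2 z * (c i * f i z))%C).
  - rewrite sumC_plus, !sumC_scal. unfold Cdiv. ring.
  - intros i Hi. rewrite (Dk_Cdrv kap _ z _ (H i Hi)). unfold Cdiv. ring.
Qed.

Lemma Dk_transform_T (kap : R) (f g f' g' : C -> C) :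
  dH f f' -> dH g g' -> (forall z, upper z -> f (z + 1)%C = g z) ->
  forall z, upper z -> Dk kap f (z + 1) = Dk kap g z.
Proof.
  intros Hf Hg E z Hz.
  assert (Hz1 : upper (z + 1)) by (apply (upper_plus_R z 1); auto).
  assert (X : f' (z + 1)%C = g' z).
  { apply (Cdrv_unique g z); auto.
    apply (Cdrv_ext_upper (fun z => f (z + 1)%C)); auto.
    eapply Cdrv_val; [apply (Cdrv_comp f (fun z => z + 1)%C z)|].
    - apply Cdrv_plus; [apply Cdrv_id|apply Cdrv_const].
    - apply Hf; auto.
    - ring. }
  rewrite (Dk_Cdrv kap f _ _ (Hf _ Hz1)), (Dk_Cdrv kap g _ _ (Hg _ Hz)), X, E2_periodic, E; auto.
Qed.

Lemma Cdrv_Cexp_Clog (s : R) (z : C) : upper z ->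
  Cdrv (fun w => Cexp (s * Clog w)) z (s / z * Cexp (s * Clog z))%C.
Proof.
  intros Hz. eapply Cdrv_val; [apply (Cdrv_comp Cexp (fun w => s * Clog w)%C z)|].
  - apply Cdrv_scal, Cdrv_Clog; auto.
  - apply Cdrv_Cexp.
  - unfold Cdiv. ring.
Qed.

Lemma Cexp_Clog_plus_2 (s : R) (z : C) : upper z ->
  Cexp (RtoC (s + 2) * Clog z) = (z * z * Cexp (s * Clog z))%C.
Proof.
  intros Hz. rewrite RtoC_plus, Cmult_plus_distr_r, Cexp_add.
  replace (RtoC 2 * Clog z)%C with (Clog z + Clog z)%C by ring.
  rewrite Cexp_add, Cexp_Clog by auto. ring.
Qed.

(** Differentiating z^kap produces kap / z, which after multiplication by z^2 / (2 PI i) is exactly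
    kap / 12 times the anomaly 6 z / (PI i) of E2. The functions f and g may differ because
    inversion sends a component to a combination of all components. *)
Lemma Dk_transform_S (kap : R) (f g f' g' : C -> C) :
  dH f f' -> dH g g' ->
  (forall z, upper z -> f (- / z)%C = (Cexp (kap * Clog z) * g z)%C) ->
  forall z, upper z -> Dk kap f (- / z)%C = (Cexp (RtoC (kap + 2) * Clog z) * Dk kap g z)%C.
Proof.
  intros Hf Hg E z Hz. pose proof (upper_neq_0 z Hz) as Hz0.
  pose proof (upper_neg_inv z Hz) as Hz1.
  assert (X : (/ (z * z) * f' (- / z))%C =
     (kap / z * Cexp (kap * Clog z) * g z + Cexp (kap * Clog z) * g' z)%C).
  { apply (Cdrv_unique (fun z => f (- / z)%C) z).
    - eapply Cdrv_val; [apply (Cdrv_comp f (fun z => - / z)%C z)|].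
      + apply Cdrv_opp, Cdrv_inv_id; auto.
      + apply Hf; auto.
      + ring.
    - apply (Cdrv_ext_upper (fun z => Cexp (kap * Clog z) * g z)%C); auto.
      + intros; symmetry; auto.
      + apply (Cdrv_mult (fun w => Cexp (kap * Clog w)) g); auto. apply Cdrv_Cexp_Clog; auto. }
  rewrite (Dk_Cdrv kap f _ _ (Hf _ Hz1)), (Dk_Cdrv kap g _ _ (Hg _ Hz)), E2_S, E, Cexp_Clog_plus_2 by auto.
  replace (f' (- / z)%C) with (z * z * (/ (z * z) * f' (- / z)))%C by (field; auto).
  rewrite X. rewrite RtoC_div, RtoC_mult by lra.
  assert (H12 : RtoC 12 <> 0) by (apply RtoC_neq_0; lra).
  replace (RtoC 12) with (RtoC 2 * RtoC 6)%C by (rewrite <- RtoC_mult; f_equal; ring).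
  assert (H6 : RtoC 6 <> 0) by (apply RtoC_neq_0; lra).
  field. auto using Ci_neq_0, PI_C_neq_0.
Qed.

(** Abel's lemma: the height y is chosen with |q^m| = r' for some r' between r and 1; convergence
    there bounds the terms a_t r'^t, and the ratio r / r' supplies a geometric majorant. *)
Lemma qseries_disc_coef (m : R) (a : nat -> C) : 0 < m ->
  (forall z, upper z -> exists s, Cser (fun t => a t * qpow (m * INR t) z)%C s) -> disc_coef a.
Proof.
  intros Hm H r Hr. set (r' := (1 + r) / 2). assert (Hr' : 0 < r' < 1 /\ r < r') by (unfold r'; lra).
  pose proof PI_RGT_0 as HP.
  set (y := - ln r' / (2 * PI * m)).
  assert (Hln : ln r' < 0) by (rewrite <- ln_1; apply ln_increasing; lra).
  assert (H2 : 0 < 2 * PI * m) by (apply Rmult_lt_0_compat; lra).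
  assert (Hy : 0 < y) by (apply Rdiv_lt_0_compat; lra).
  destruct (H (0, y) Hy) as [s Hs].
  assert (HB : exists B N, 0 <= B /\ forall t, (N <= t)%nat -> Cmod (a t) * r' ^ t <= B).
  { destruct (Hs 1 Rlt_0_1) as [N HN]. exists 2, N. split; [lra|]. intros t Ht.
    pose proof (HN t Ht) as A. pose proof (HN (S t) ltac:(lia)) as B. rewrite sumC_S in B.
    set (x := (a t * qpow (m * INR t) (0%R, y))%C) in *. set (S0 := sumC t _) in *.
    assert (Hx : Cmod x <= 2).
    { replace x with ((S0 + x - s) - (S0 - s))%C by ring.
      eapply Rle_trans; [apply Cmod_sub_triangle|]. lra. }
    unfold x in Hx. rewrite Cmod_mult, Cmod_qpow_nat in Hx. simpl Im in Hx.
    replace (exp (- (2 * PI * m * y))) with r' in Hx; auto.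
    unfold y. replace (- (2 * PI * m * (- ln r' / (2 * PI * m)))) with (ln r') by (field; lra).
    rewrite exp_ln; lra. }
  destruct HB as [B [N [HB0 HB]]].
  apply (ex_series_incr_n _ N).
  apply (ex_series_dominated _ (fun t => B * (r / r') ^ (N + t))).
  - intros t. split; [apply Rmult_le_pos; [apply Cmod_ge_0|apply pow_le; lra]|].
    specialize (HB (N + t)%nat ltac:(lia)).
    assert (E : r ^ (N + t) = r' ^ (N + t) * (r / r') ^ (N + t)).
    { rewrite <- Rpow_mult_distr. f_equal. field. lra. }
    rewrite E, <- Rmult_assoc. apply Rmult_le_compat_r; auto. apply pow_le.
    apply Rmult_le_pos; [lra|left; apply Rinv_0_lt_compat; lra].
  - apply (proj1 (ex_series_incr_n (fun t => B * (r / r') ^ t) N)).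
    apply ex_series_scal_R. apply ex_series_geom.
    rewrite Rabs_pos_eq.
    + apply (Rmult_lt_reg_r r'); [lra|]. unfold Rdiv. rewrite Rmult_assoc, Rinv_l by lra. lra.
    + apply Rmult_le_pos; [lra|left; apply Rinv_0_lt_compat; lra].
Qed.

(** * Linear differential systems along a segment *)

Definition seg (z0 z1 : C) (t : R) : C := (z0 + t * (z1 - z0))%C.

Lemma bounded_on_segment (f : C -> C) (z0 z1 : C) : upper z0 -> upper z1 ->
  (forall z, upper z -> exists d, Cdrv f z d) ->
  exists K, 0 < K /\ forall t, 0 <= t <= 1 -> Cmod (f (seg z0 z1 t)) <= K.
Proof.
  intros H0 H1 Hf.
  destruct (rect_bounded (fun t _ => Cmod (f (seg z0 z1 t))) 0 1 0 0) as [K [HK HB]].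
  - intros t s Ht _. destruct (Hf (seg z0 z1 t)) as [d Hd]; [apply upper_segment; auto|].
    destruct (Cdrv_continuous _ _ _ Hd 1 Rlt_0_1) as [delta [Hdel Hw]].
    exists (Cmod (f (seg z0 z1 t)) + 1), (delta / (Cmod (z1 - z0) + 1)).
    pose proof (Cmod_ge_0 (z1 - z0)) as G.
    split; [apply Rdiv_lt_0_compat; lra|]. intros u v _ _ Hu _.
    assert (E : Cmod (seg z0 z1 u - seg z0 z1 t) < delta).
    { replace (seg z0 z1 u - seg z0 z1 t)%C with (RtoC (u - t) * (z1 - z0))%C
        by (unfold seg; rewrite RtoC_minus; ring).
      rewrite Cmod_mult, Cmod_R.
      apply (Rmult_lt_compat_r (Cmod (z1 - z0) + 1)) in Hu; [|lra].
      unfold Rdiv in Hu. rewrite Rmult_assoc, Rinv_l in Hu by lra.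
      pose proof (Rabs_pos (u - t)). nra. }
    specialize (Hw _ E). pose proof (Cmod_le_add (f (seg z0 z1 u)) (f (seg z0 z1 t))). lra.
  - exists K. split; auto. intros t Ht. apply (HB t 0); auto. lra.
Qed.

(** Gronwall's inequality for [sum |Y_j|^2] along the segment. *)
Lemma linear_ode_zero (n : nat) (Y Y' : nat -> C -> C) (z0 z1 : C) (beta : R) :
  upper z0 -> upper z1 -> 0 <= beta ->
  (forall j z, (j < n)%nat -> upper z -> Cdrv (Y j) z (Y' j z)) ->
  (forall j t, (j < n)%nat -> 0 <= t <= 1 ->
     Cmod (Y' j (seg z0 z1 t)) <= beta * sumR n (fun l => Cmod (Y l (seg z0 z1 t)))) ->
  (forall j, (j < n)%nat -> Y j z0 = 0) -> forall j, (j < n)%nat -> Y j z1 = 0.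
Proof.
  intros H0 H1 Hbeta HY HB Hi.
  set (u := (z1 - z0)%C).
  set (N := fun t => sumR n (fun j => Cmod (Y j (seg z0 z1 t)) ^ 2)).
  set (N' := fun t => sumR n (fun j => 2 * (Re (Y j (seg z0 z1 t)) * Re (u * Y' j (seg z0 z1 t))%C
                        + Im (Y j (seg z0 z1 t)) * Im (u * Y' j (seg z0 z1 t))%C))).
  assert (Hpos : forall t j, 0 <= Cmod (Y j (seg z0 z1 t)) ^ 2) by (intros; apply pow2_ge_0).
  assert (Hle : forall p t j, (j < p)%nat -> Cmod (Y j (seg z0 z1 t)) ^ 2 <= sumR p (fun j => Cmod (Y j (seg z0 z1 t)) ^ 2)).
  { induction p; intros t j Hj; [lia|]. rewrite sumR_S.
    destruct (Nat.eq_dec j p) as [->|Hne].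
    - pose proof (sumR_nonneg p (fun j => Cmod (Y j (seg z0 z1 t)) ^ 2) (Hpos t)). lra.
    - pose proof (IHp t j ltac:(lia)). pose proof (Hpos t p). lra. }
  assert (HD : forall t, 0 <= t <= 1 -> is_derive N t (N' t)).
  { intros t Ht. unfold N, N'.
    assert (G : forall p, (p <= n)%nat -> is_derive (fun t => sumR p (fun j => Cmod (Y j (seg z0 z1 t)) ^ 2)) t
      (sumR p (fun j => 2 * (Re (Y j (seg z0 z1 t)) * Re (u * Y' j (seg z0 z1 t))%C
                        + Im (Y j (seg z0 z1 t)) * Im (u * Y' j (seg z0 z1 t))%C)))).
    { induction p; intros Hp.
      - apply (is_derive_ext (fun _ => 0)); [reflexivity|]. apply @is_derive_const.
      - eapply is_derive_ext; [intros s; symmetry; apply sumR_S|]. rewrite sumR_S.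
        apply (is_derive_plus (fun t => sumR p (fun j => Cmod (Y j (seg z0 z1 t)) ^ 2))); [apply IHp; lia|].
        destruct (Cdrv_line (Y p) z0 u t (Y' p (seg z0 z1 t))) as [Da Db].
        { apply HY; [lia|]. apply upper_segment; auto. }
        eapply is_derive_ext; [intros s; symmetry; apply Cmod_sqr|].
        evar_last.
        + exact (is_derive_plus _ _ _ _ _ (is_derive_mult _ _ _ _ _ Da Da Rmult_comm)
            (is_derive_mult _ _ _ _ _ Db Db Rmult_comm)).
        + unfold seg. fold u. unfold plus, mult; simpl. unfold mult; simpl. ring. }
    apply G; auto. }
  set (K := 2 * Cmod u * beta * INR n * INR n).
  assert (HK : forall t, 0 <= t <= 1 -> N' t <= K * N t).
  { intros t Ht. unfold N'.
    assert (A : forall j, (j < n)%nat ->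
      2 * (Re (Y j (seg z0 z1 t)) * Re (u * Y' j (seg z0 z1 t))%C
         + Im (Y j (seg z0 z1 t)) * Im (u * Y' j (seg z0 z1 t))%C) <= 2 * Cmod u * beta * INR n * N t).
    { intros j Hj. set (y := Y j (seg z0 z1 t)). set (y' := Y' j (seg z0 z1 t)).
      assert (A1 : Re y * Re (u * y')%C + Im y * Im (u * y')%C <= Cmod y * (Cmod u * Cmod y')).
      { rewrite <- Cmod_mult. rewrite <- (Cmod_conj y), <- Cmod_mult.
        eapply Rle_trans; [|apply re_le_Cmod]. eapply Rle_trans; [|apply Rle_abs].
        apply Req_le. simpl. unfold Re, Im. ring. }
      assert (A2 : Cmod y * Cmod y' <= beta * (INR n * N t)).
      { eapply Rle_trans; [apply Rmult_le_compat_l; [apply Cmod_ge_0|apply HB; auto]|].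
        replace (Cmod y * (beta * sumR n (fun l => Cmod (Y l (seg z0 z1 t)))))
          with (beta * (Cmod y * sumR n (fun l => Cmod (Y l (seg z0 z1 t))))) by ring.
        apply Rmult_le_compat_l; auto.
        assert (A3 : forall p, (p <= n)%nat -> Cmod y * sumR p (fun l => Cmod (Y l (seg z0 z1 t))) <= INR p * N t).
        { induction p; intros Hp.
          - unfold sumR; simpl. lra.
          - rewrite sumR_S, S_INR. specialize (IHp ltac:(lia)).
            pose proof (Hle n t j Hj) as L1. pose proof (Hle n t p ltac:(lia)) as L2.
            fold y in L1. fold (N t) in L1, L2.
            set (v := Cmod (Y p (seg z0 z1 t))) in *. nra. }
        apply A3; auto. }
      pose proof (Cmod_ge_0 u). 
      assert (Cmod u * (Cmod y * Cmod y') <= Cmod u * (beta * (INR n * N t))) by (apply Rmult_le_compat_l; auto).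
      nra. }
    eapply Rle_trans; [apply sumR_le, A|].
    assert (C0 : forall p x, sumR p (fun _ => x) = INR p * x).
    { induction p; intros x; [unfold sumR; simpl; ring|]. rewrite sumR_S, IHp, S_INR. ring. }
    rewrite C0. unfold K. lra. }
  assert (HN0 : N 0 = 0).
  { unfold N. transitivity (sumR n (fun _ => 0)); [|apply sumR_zero]. apply sumR_ext. intros j Hj.
    replace (seg z0 z1 0) with z0 by (unfold seg; ring). rewrite Hi, Cmod_0 by auto. ring. }
  (* N' <= K N makes N e^(-K t) nonincreasing; it starts at 0 and N is a sum of squares. *)
  set (P := fun t => N t * exp (- K * t)).
  set (P' := fun t => (N' t - K * N t) * exp (- K * t)).
  assert (HP : forall t, 0 <= t <= 1 -> is_derive P t (P' t)).
  { intros t Ht. evar_last.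
    - apply (is_derive_mult N (fun t => exp (- K * t)) t (N' t) (- K * exp (- K * t))).
      + apply HD; auto.
      + auto_derive; auto. ring.
      + apply Rmult_comm.
    - unfold P', plus, mult; simpl. unfold mult; simpl. ring. }
  destruct (MVT_gen P 0 1 P') as [c [Hc1 Hc2]].
  - intros x Hx. rewrite Rmin_left, Rmax_right in Hx by lra. apply HP. lra.
  - intros x Hx. rewrite Rmin_left, Rmax_right in Hx by lra.
    apply continuity_pt_filterlim, (ex_derive_continuous P). exists (P' x). apply HP. lra.
  - rewrite Rmin_left, Rmax_right in Hc1 by lra.
    assert (HPc : P' c <= 0).
    { unfold P'. pose proof (HK c Hc1). pose proof (exp_pos (- K * c)). nra. }
    assert (HN1 : N 1 <= 0).
    { unfold P in Hc2 at 1 2. rewrite HN0 in Hc2. pose proof (exp_pos (- K * 1)).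
      assert (N 1 * exp (- K * 1) <= 0) by lra. nra. }
    intros j Hj. pose proof (Hle n 1 j Hj) as L. fold (N 1) in L.
    replace (seg z0 z1 1) with z1 in L by (unfold seg; ring).
    apply Cmod_eq_0. pose proof (Cmod_ge_0 (Y j z1)). nra.
Qed.

(** * Wronskians *)

(** Minors of the matrix [D^j f_i] ([i < n], [j <= n]); deleting column [n] gives the Wronskian. *)
Definition wronskian_minor (k : R) (n : nat) (F : nat -> C -> C) (J : nat) (z : C) : C :=
  LinAlg.minor n (fun i j => Dk_iter k j (F i) z) J.

(** [L] is the sum of the exponents at the cusp, so this is a minor divided by [Delta^L]. *)
Definition reduced_minor (k : R) (n : nat) (F : nat -> C -> C) (L : R) (J : nat) (z : C) : C :=
  (wronskian_minor k n F J z * Cexp (- RtoC L * logDelta z))%C.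

Definition iterates_differentiable (k : R) (n : nat) (F : nat -> C -> C) : Prop :=
  forall i j, (i < n)%nat -> dH (Dk_iter k j (F i)) (C_derive (Dk_iter k j (F i))).

Lemma Dk_iter_S (k : R) (n : nat) (F : nat -> C -> C) (M : nat -> nat -> C) :
  iterates_differentiable k n F ->
  (forall i z, (i < n)%nat -> upper z ->
     F i (- / z)%C = (Cexp (k * Clog z) * sumC n (fun l => M i l * F l z))%C) ->
  forall j i z, (i < n)%nat -> upper z ->
    Dk_iter k j (F i) (- / z)%C =
    (Cexp (RtoC (k + 2 * INR j) * Clog z) * sumC n (fun l => M i l * Dk_iter k j (F l) z))%C.
Proof.
  intros HD H. induction j; intros i z Hi Hz.
  - simpl. rewrite Rmult_0_r, Rplus_0_r. apply H; auto.
  - rewrite S_INR. replace (k + 2 * (INR j + 1)) with (k + 2 * INR j + 2) by ring. simpl.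
    rewrite (Dk_transform_S (k + 2 * INR j) (Dk_iter k j (F i))
      (fun z => sumC n (fun l => M i l * Dk_iter k j (F l) z)%C)
      (C_derive (Dk_iter k j (F i)))
      (fun z => sumC n (fun l => M i l * C_derive (Dk_iter k j (F l)) z)%C)); auto.
    + f_equal. apply (Dk_sumC _ n (M i) (fun l => Dk_iter k j (F l)) (fun l => C_derive (Dk_iter k j (F l)))).
      intros l Hl. apply HD; auto.
    + intros w Hw.
      apply (Cdrv_sumC n (M i) (fun l => Dk_iter k j (F l)) (fun l => C_derive (Dk_iter k j (F l)))).
      intros l Hl. apply HD; auto.
Qed.

Lemma Dk_iter_T (k : R) (n : nat) (F : nat -> C -> C) (M : nat -> nat -> C) :
  iterates_differentiable k n F ->
  (forall i z, (i < n)%nat -> upper z -> F i (z + 1)%C = sumC n (fun l => M i l * F l z)%C) ->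
  forall j i z, (i < n)%nat -> upper z ->
    Dk_iter k j (F i) (z + 1)%C = sumC n (fun l => M i l * Dk_iter k j (F l) z)%C.
Proof.
  intros HD H. induction j; intros i z Hi Hz.
  - apply H; auto.
  - simpl.
    rewrite (Dk_transform_T (k + 2 * INR j) (Dk_iter k j (F i))
      (fun z => sumC n (fun l => M i l * Dk_iter k j (F l) z)%C)
      (C_derive (Dk_iter k j (F i)))
      (fun z => sumC n (fun l => M i l * C_derive (Dk_iter k j (F l)) z)%C)); auto.
    + apply (Dk_sumC _ n (M i) (fun l => Dk_iter k j (F l)) (fun l => C_derive (Dk_iter k j (F l)))).
      intros l Hl. apply HD; auto.
    + intros w Hw.
      apply (Cdrv_sumC n (M i) (fun l => Dk_iter k j (F l)) (fun l => C_derive (Dk_iter k j (F l)))).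
      intros l Hl. apply HD; auto.
Qed.

Lemma prodC_Cexp (n : nat) (c : nat -> R) (zeta : C) :
  prodC n (fun l => Cexp (c l * zeta)) = Cexp (RtoC (sumR n c) * zeta).
Proof.
  induction n.
  - unfold sumR; simpl. rewrite Cmult_0_l, Cexp_0. auto.
  - simpl. rewrite IHn, <- Cexp_add, sumR_S, RtoC_plus. f_equal. ring.
Qed.

Lemma prodC_qpow (n : nat) (lam : nat -> R) (z : C) :
  prodC n (fun i => qpow (lam i) z) = qpow (sumR n lam) z.
Proof.
  induction n.
  - unfold sumR; simpl. rewrite qpow_0. auto.
  - simpl. rewrite IHn, sumR_S, qpow_plus. auto.
Qed.

(** The n + 1 weights k + 2 l with l <= n add up to (n + 1)(k + n); leaving out k + 2 J gives the
    value. *)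
Lemma weight_sum (k : R) (n J : nat) : (J <= n)%nat ->
  sumR n (fun l => k + 2 * INR (LinAlg.skip J l)) = INR n * (k + INR n - 1) + 2 * INR (n - J).
Proof.
  intros HJ. rewrite minus_INR by auto.
  assert (A : forall p, (p <= J)%nat ->
    sumR p (fun l => k + 2 * INR (LinAlg.skip J l)) = INR p * (k + INR p - 1)).
  { induction p; intros Hp; [unfold sumR; simpl; ring|].
    rewrite sumR_S, IHp, S_INR by lia. unfold LinAlg.skip.
    destruct (Nat.ltb_spec p J); [|lia]. ring. }
  assert (B : forall p, sumR (J + p) (fun l => k + 2 * INR (LinAlg.skip J l))
     = INR (J + p) * (k + INR (J + p) - 1) + 2 * INR p).
  { induction p; [rewrite Nat.add_0_r, A by lia; simpl; ring|].
    rewrite Nat.add_succ_r, sumR_S, IHp. unfold LinAlg.skip.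
    destruct (Nat.ltb_spec (J + p) J); [lia|]. rewrite !S_INR. ring. }
  replace n with (J + (n - J))%nat at 1 by lia. rewrite B.
  replace (J + (n - J))%nat with n by lia. rewrite minus_INR by auto. ring.
Qed.

(** Inversion mixes the rows by M and multiplies the column of order l by z^(k + 2 l), so det M and
    the sum of the weights come out of the minor. Dividing by Delta^L lowers the weight by 12 L and
    leaves the constant e^(6 PI i L) from the branch of the logarithm. *)
Lemma reduced_minor_S (k : R) (n : nat) (F : nat -> C -> C) (M : nat -> nat -> C) (L : R) :
  iterates_differentiable k n F ->
  (forall i z, (i < n)%nat -> upper z ->
     F i (- / z)%C = (Cexp (k * Clog z) * sumC n (fun l => M i l * F l z))%C) ->
  forall J z, (J <= n)%nat -> upper z ->
    reduced_minor k n F L J (- / z)%C =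
    (LinAlg.det n M * Cexp (RtoC L * (6 * PI * Ci))
     * Cexp (RtoC (INR n * (k + INR n - 1) - 12 * L + 2 * INR (n - J)) * Clog z)
     * reduced_minor k n F L J z)%C.
Proof.
  intros HD H J z HJ Hz.
  assert (E : wronskian_minor k n F J (- / z)%C =
    (Cexp (RtoC (INR n * (k + INR n - 1) + 2 * INR (n - J)) * Clog z) * (LinAlg.det n M * wronskian_minor k n F J z))%C).
  { rewrite <- weight_sum by auto. rewrite <- prodC_Cexp. unfold wronskian_minor, LinAlg.minor.
    rewrite <- LinAlg.det_mul, <- LinAlg.det_scale_col. apply LinAlg.det_ext.
    intros i l Hi _. rewrite (Dk_iter_S k n F M); auto. }
  unfold reduced_minor. rewrite E, logDelta_S by auto.
  replace (RtoC (INR n * (k + INR n - 1) + 2 * INR (n - J)))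
    with (RtoC (INR n * (k + INR n - 1) - 12 * L + 2 * INR (n - J)) + 12 * L)%C
    by (rewrite <- (RtoC_mult 12 L), <- RtoC_plus; f_equal; ring).
  rewrite Cmult_plus_distr_r, Cexp_add.
  replace (- RtoC L * (logDelta z + 12 * Clog z - 6 * PI * Ci))%C
    with (- RtoC L * logDelta z + (- (12 * L * Clog z) + RtoC L * (6 * PI * Ci)))%C by ring.
  rewrite !Cexp_add, Cexp_opp. field. apply Cexp_neq_0.
Qed.

Lemma reduced_minor_T (k : R) (n : nat) (F : nat -> C -> C) (M : nat -> nat -> C) (L : R) :
  iterates_differentiable k n F ->
  (forall i z, (i < n)%nat -> upper z -> F i (z + 1)%C = sumC n (fun l => M i l * F l z)%C) ->
  forall J z, upper z ->
    reduced_minor k n F L J (z + 1)%C =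
    (LinAlg.det n M * Cexp (- RtoC L * (RtoC (2 * PI) * Ci)) * reduced_minor k n F L J z)%C.
Proof.
  intros HD H J z Hz.
  assert (E : wronskian_minor k n F J (z + 1)%C = (LinAlg.det n M * wronskian_minor k n F J z)%C).
  { unfold wronskian_minor, LinAlg.minor. rewrite <- LinAlg.det_mul. apply LinAlg.det_ext.
    intros i l Hi _. rewrite (Dk_iter_T k n F M); auto. }
  unfold reduced_minor. rewrite E. unfold logDelta. rewrite log_hat_T, Rmult_1_r.
  rewrite Cmult_plus_distr_l, Cexp_add. ring.
Qed.

(** Row i releases the factor q^(lam_i). The product of these factors cancels the power of q in
    Delta^L, and what is left is a polynomial in functions with limits at the cusp times the
    exponential of - L [log_prod]. *)
Lemma reduced_minor_tame (k : R) (n : nat) (F G : nat -> C -> C) (lam : nat -> R) (c : nat -> C) (J : nat) :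
  (forall i z, (i < n)%nat -> upper z -> F i z = (qpow (lam i) z * G i z)%C) ->
  (forall i, (i < n)%nat -> tame_all (c i) (G i)) ->
  tame_all (LinAlg.minor n (fun i j => c i * prodC j (fun l => RtoC (lam i) - RtoC ((k + 2 * INR l) / 12)%R))%C J)
    (reduced_minor k n F (sumR n lam) J).
Proof.
  intros HF HG. set (L := sumR n lam).
  apply (tame_all_ext _ (fun z =>
    LinAlg.minor n (fun i j => / qpow (lam i) z * Dk_iter k j (F i) z)%C J * Cexp (- RtoC L * log_prod z))%C).
  - intros z Hz. unfold reduced_minor.
    replace (wronskian_minor k n F J z) with
      (qpow L z * LinAlg.minor n (fun i j => / qpow (lam i) z * Dk_iter k j (F i) z)%C J)%C.
    + unfold logDelta, log_hat. rewrite Rmult_1_r.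
      replace (- RtoC L * (RtoC (2 * PI) * Ci * z + log_prod z))%C
        with (- (RtoC (2 * PI * L) * Ci * z) + - RtoC L * log_prod z)%C by (rewrite (RtoC_mult (2 * PI)); ring).
      rewrite Cexp_add, Cexp_opp. unfold qpow at 2. field. apply Cexp_neq_0.
    + unfold L. rewrite <- prodC_qpow. unfold wronskian_minor, LinAlg.minor.
      rewrite <- LinAlg.det_scale_row. apply LinAlg.det_ext. intros i l _ _. field. apply qpow_neq_0.
  - rewrite <- (Cmult_1_r (LinAlg.minor _ _ _)). apply tame_all_mult.
    + unfold LinAlg.minor.
      apply (@LinAlg.det_closed (fun f c => tame_all c f) n
        (fun z i l => (/ qpow (lam i) z * Dk_iter k (LinAlg.skip J l) (F i) z)%C)).
      * intros f g d E. apply tame_all_ext. auto.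
      * apply tame_all_const.
      * intros; apply tame_all_plus; auto.
      * intros; apply tame_all_mult; auto.
      * intros i l Hi _. apply (Dk_iter_qpow_tame k (lam i) (c i) (F i) (G i)); auto.
    + intros p. replace (RtoC 1) with (Cexp (- RtoC L * 0)) by (rewrite <- Cexp_0; f_equal; ring).
      apply tame_Cexp, tame_scal, log_prod_tame.
Qed.

(** * Values at the cusp and the sign of the weight *)

Lemma decay_zero (c : C) (f : C -> C) : decay c f -> (forall z, upper z -> f z = 0) -> c = 0.
Proof.
  intros [e [K [He [HK H]]]] Hf.
  apply Cmod_eq_0. apply Rle_antisym; [|apply Cmod_ge_0]. apply Rnot_lt_le. intros Hc.
  (* At this height e y = e + K / |c|, so |c| exp (e y) >= |c| (1 + e y) > K, which the decay
     estimate forbids. *)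
  set (y := 1 + K / (Cmod c * e)).
  assert (HKc : 0 <= K / (Cmod c * e)).
  { apply Rmult_le_pos; auto. left. apply Rinv_0_lt_compat, Rmult_lt_0_compat; auto. }
  assert (Hy : 1 <= y) by (unfold y; lra).
  specialize (H (0, y) Hy). rewrite Hf in H by (unfold upper; simpl; lra).
  replace (0 - c)%C with (- c)%C in H by ring. rewrite Cmod_opp in H. simpl Im in H.
  rewrite exp_Ropp in H. pose proof (exp_ineq1_le (e * y)) as X.
  assert (Y : e * y = e + K / Cmod c) by (unfold y; field; lra).
  assert (Z : Cmod c * exp (e * y) <= K).
  { apply (Rmult_le_compat_r (exp (e * y))) in H; [|left; apply exp_pos].
    rewrite Rmult_assoc, Rinv_l in H by (pose proof (exp_pos (e * y)); lra). lra. }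
  assert (Cmod c * (1 + e * y) <= K) by (eapply Rle_trans; [apply Rmult_le_compat_l; [lra|apply X]|auto]).
  rewrite Y in H0. replace (Cmod c * (1 + (e + K / Cmod c))) with (Cmod c + Cmod c * e + K) in H0 by (field; lra).
  assert (0 < Cmod c * e) by (apply Rmult_lt_0_compat; auto). lra.
Qed.

Lemma decay_bounded (c : C) (f : C -> C) : decay c f ->
  exists K, forall z, 1 <= Im z -> Cmod (f z) <= K.
Proof.
  intros [e [K [He [HK H]]]]. exists (K + Cmod c). intros z Hz. specialize (H z Hz).
  pose proof (Cmod_le_add (f z) c).
  assert (exp (- (e * Im z)) <= 1) by (apply exp_neg_le_1; nra). nra.
Qed.

Lemma Cmod_Cexp_Clog (s : R) (z : C) : Cmod (Cexp (s * Clog z)) = Rpower (Cmod z) s.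
Proof.
  rewrite Cmod_Cexp. unfold Rpower. f_equal. simpl. ring.
Qed.

(** Translation does not change the limit at the cusp, hence muT c = c. *)
Lemma cusp_multiplier (h : C -> C) (c muT : C) : decay c h -> c <> 0 ->
  (forall z, upper z -> h (z + 1)%C = (muT * h z)%C) -> muT = 1.
Proof.
  intros Hd Hc HT.
  assert (D1 : decay c (fun z => h (z + 1)%C)).
  { destruct Hd as [e [K [He [HK H]]]]. exists e, K. repeat split; auto. intros z Hz.
    assert (I : Im (z + 1)%C = Im z) by (simpl; unfold Im; ring).
    specialize (H (z + 1)%C). rewrite I in H. auto. }
  pose proof (decay_plus _ _ _ _ D1 (decay_mult _ _ _ _ (decay_const (- muT)) Hd)) as D.
  apply decay_zero in D.
  - destruct (Ceq_dec muT 1) as [E|E]; auto. exfalso.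
    assert (X : ((1 - muT) * c)%C = 0) by (rewrite <- D; ring).
    assert (Y : (1 - muT)%C <> 0).
    { intros Z. apply E. replace muT with (1 - (1 - muT))%C by ring. rewrite Z. ring. }
    apply (Cmult_neq_0 _ _ Y Hc); auto.
  - intros z Hz. rewrite HT by auto. ring.
Qed.

(** Functions p Delta^(-eps) with p tame are closed under differentiation; two applications supply
    the derivatives asked for by [negative_weight_zero]. *)
Lemma dH_Cexp_logDelta (eps : R) (c : C) (p : C -> C) : tame_all c p ->
  exists c' p', tame_all c' p' /\
    dH (fun z => p z * Cexp (- RtoC eps * logDelta z))%C (fun z => p' z * Cexp (- RtoC eps * logDelta z))%C.
Proof.
  intros Hp. destruct (tame_all_deriv c p Hp) as [Dp Tp].
  exists (0 + - RtoC eps * (RtoC (2 * PI) * Ci) * (1 * c))%C,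
    (fun z => C_derive p z + - RtoC eps * (RtoC (2 * PI) * Ci) * (E2 z * p z))%C. split.
  - apply tame_all_plus; auto. apply tame_all_scal, tame_all_mult; auto. intros n; apply E2_tame.
  - intros z Hz. eapply Cdrv_val.
    + apply (Cdrv_mult p (fun z => Cexp (- RtoC eps * logDelta z))%C).
      * apply Dp; auto.
      * apply (Cdrv_comp Cexp (fun z => - RtoC eps * logDelta z)%C).
        { apply Cdrv_scal, (dH_log_hat 1); auto. }
        { apply Cdrv_Cexp. }
    + cbv beta. ring.
Qed.

(** Twisting [h - c] by a small negative power of [Delta] keeps it bounded at the cusp and makes
    the weight negative. *)
Lemma weight_0_constant (h : C -> C) (c : C) : tame_all c h ->
  (forall z, upper z -> h (z + 1)%C = h z) -> (forall z, upper z -> h (- / z)%C = h z) ->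
  forall z, upper z -> h z = c.
Proof.
  intros Hh HT HS. pose proof PI_RGT_0 as HP.
  destruct (tame_decay 0 c h (Hh O)) as [e [K [He [HK Hd]]]].
  destruct (decay_bounded _ _ (tame_decay 0 _ _ (log_prod_tame 0))) as [B HB].
  (* |Delta^(-eps)| grows like exp (2 PI eps Im z) = exp (e Im z), which uses up exactly the decay
     of h - c. *)
  set (eps := e / (2 * PI)).
  assert (Heps : 0 < eps) by (apply Rdiv_lt_0_compat; lra).
  assert (Tp : tame_all (c + - c) (fun z => h z + - c)%C) by (apply tame_all_plus; [auto|apply tame_all_const]).
  destruct (dH_Cexp_logDelta eps _ _ Tp) as [c1 [p1 [T1 D1]]].
  destruct (dH_Cexp_logDelta eps _ _ T1) as [c2 [p2 [T2 D2]]].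
  set (f := fun z => ((h z + - c) * Cexp (- RtoC eps * logDelta z))%C).
  intros z Hz.
  assert (Hf : f z = 0).
  { apply (negative_weight_zero f _ _ (- 12 * eps) (K * exp (eps * B)) 1 D1 D2); auto.
    - lra.
    - intros w Hw. unfold f, logDelta. rewrite HT, log_hat_T, Rmult_1_r, !Cmod_mult, !Cmod_Cexp by auto.
      do 2 f_equal. simpl. ring.
    - intros w Hw. unfold f. rewrite HS, logDelta_S by auto.
      replace (- RtoC eps * (logDelta w + 12 * Clog w - 6 * PI * Ci))%C
        with (- RtoC eps * logDelta w + (RtoC (- 12 * eps) * Clog w + RtoC (6 * eps * PI) * Ci))%C.
      2:{ rewrite !RtoC_mult. replace (RtoC (-12)) with (- RtoC 12)%C by (rewrite <- RtoC_opp; auto). ring. }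
      rewrite !Cexp_add, !Cmod_mult, Cmod_Cexp_Clog.
      replace (Cmod (Cexp (RtoC (6 * eps * PI) * Ci))) with 1; [ring|].
      rewrite Cmod_Cexp. rewrite <- exp_0. f_equal. simpl. ring.
    - intros w Hw. unfold f. rewrite Cmod_mult, Cmod_Cexp.
      specialize (Hd w Hw). specialize (HB w Hw).
      replace (h w + - c)%C with (h w - c)%C by ring.
      apply Rle_trans with (K * exp (- (e * Im w)) * exp (e * Im w + eps * B)).
      + apply Rmult_le_compat; auto; [apply Cmod_ge_0|left; apply exp_pos|].
        apply exp_le_mono.
        assert (X : Re (- RtoC eps * logDelta w)%C = e * Im w + - eps * Re (log_prod w)).
        { unfold logDelta, log_hat. simpl. unfold eps, Re, Im. field. lra. }
        rewrite X. pose proof (re_le_Cmod (log_prod w)) as Y. apply Rabs_le_between in Y. nra.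
      + apply Req_le. rewrite Rmult_assoc, <- exp_plus. do 2 f_equal. ring. }
  unfold f in Hf. assert (Hz0 : (h z + - c)%C = 0).
  { replace (h z + - c)%C with ((h z + - c) * Cexp (- RtoC eps * logDelta z) / Cexp (- RtoC eps * logDelta z))%C
      by (field; apply Cexp_neq_0).
    rewrite Hf. field. apply Cexp_neq_0. }
  replace (h z) with (h z + - c + c)%C by ring. rewrite Hz0. ring.
Qed.

Lemma weight_nonneg (h : C -> C) (c : C) (s : R) : tame_all c h -> c <> 0 ->
  (forall z, upper z -> h (z + 1)%C = h z) ->
  (forall z, upper z -> h (- / z)%C = (Cexp (s * Clog z) * h z)%C) -> 0 <= s.
Proof.
  intros Hh Hc HT HS. apply Rnot_lt_le. intros Hs.
  destruct (tame_all_deriv c h Hh) as [D1 T1]. destruct (tame_all_deriv _ _ T1) as [D2 _].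
  destruct (decay_bounded _ _ (tame_decay 0 _ _ (Hh O))) as [K HK].
  apply Hc, (decay_zero c h (tame_decay 0 _ _ (Hh O))).
  apply (negative_weight_zero h _ _ s K 1 D1 D2); auto.
  - intros z Hz. rewrite HT; auto.
  - intros z Hz. rewrite HS, Cmod_mult, Cmod_Cexp_Clog; auto.
Qed.

Lemma weight_nonpos_of_nonvanishing (h : C -> C) (c : C) (s : R) : tame_all c h -> c <> 0 ->
  (forall z, upper z -> h z <> 0) ->
  (forall z, upper z -> h (z + 1)%C = h z) ->
  (forall z, upper z -> h (- / z)%C = (Cexp (s * Clog z) * h z)%C) -> s <= 0.
Proof.
  intros Hh Hc Hn HT HS. apply Rnot_lt_le. intros Hs.
  destruct (tame_all_deriv c h Hh) as [D1 T1]. destruct (tame_all_deriv _ _ T1) as [D2 _].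
  set (h1 := C_derive h) in *. set (h2 := C_derive h1) in *.
  assert (E1 : dH (fun z => / h z)%C (fun z => - h1 z * (/ h z * / h z))%C).
  { intros z Hz. eapply Cdrv_val; [apply Cdrv_inv; auto|]. field. auto. }
  assert (E2' : dH (fun z => - h1 z * (/ h z * / h z))%C
     (fun z => - h2 z * (/ h z * / h z) + - h1 z * (- h1 z * (/ h z * / h z) * / h z + / h z * (- h1 z * (/ h z * / h z))))%C).
  { intros z Hz. apply (Cdrv_mult (fun z => - h1 z)%C (fun z => / h z * / h z)%C).
    - apply Cdrv_opp; auto.
    - apply (Cdrv_mult (fun z => / h z)%C (fun z => / h z)%C); apply E1; auto. }
  destruct (tame_decay 0 _ _ (Hh O)) as [e [K [He [HK Hd]]]].
  pose proof (proj1 (Cmod_gt_0 c) Hc) as Hm.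
  (* From this height on |h - c| <= |c| / 2, because exp (e y) >= 1 + e y >= 2 K / |c|; hence |1 /
     h| <= 2 / |c|. *)
  set (M := 1 + 2 * K / (Cmod c * e)).
  assert (HMp : 0 <= 2 * K / (Cmod c * e)).
  { apply Rmult_le_pos; [lra|]. left. apply Rinv_0_lt_compat, Rmult_lt_0_compat; auto. }
  assert (Hi : upper Ci) by (unfold upper; simpl; lra).
  apply (Cinv_neq_0 (h Ci)); auto.
  apply (negative_weight_zero (fun z => / h z)%C _ _ (- s) (2 / Cmod c) M E1 E2'); auto.
  - lra.
  - intros z Hz. rewrite HT; auto.
  - intros z Hz. rewrite HS by auto.
    assert (Hz1 : (Cexp (s * Clog z) * h z)%C <> 0) by (apply Cmult_neq_0; auto using Cexp_neq_0).
    rewrite !Cmod_inv, Cmod_mult, Cmod_Cexp_Clog by auto.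
    rewrite Rinv_mult. f_equal. unfold Rpower. rewrite <- exp_Ropp. f_equal. ring.
  - intros z Hz. assert (Hz1 : 1 <= Im z) by (unfold M in Hz; lra).
    assert (Hu : upper z) by (unfold upper; lra).
    rewrite Cmod_inv by auto. specialize (Hd z Hz1).
    assert (Hy : 2 * K <= Cmod c * (1 + e * Im z)).
    { assert (e * M <= e * Im z) by (apply Rmult_le_compat_l; lra).
      assert (X : Cmod c * (e * M) = Cmod c * e + 2 * K) by (unfold M; field; lra).
      assert (0 < Cmod c * e) by (apply Rmult_lt_0_compat; auto).
      assert (Cmod c * (e * M) <= Cmod c * (e * Im z)) by (apply Rmult_le_compat_l; lra). lra. }
    assert (HX : K * exp (- (e * Im z)) <= Cmod c / 2).
    { rewrite exp_Ropp. pose proof (exp_ineq1_le (e * Im z)) as X.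
      apply (Rmult_le_reg_r (exp (e * Im z))); [apply exp_pos|].
      rewrite Rmult_assoc, Rinv_l by (pose proof (exp_pos (e * Im z)); lra).
      assert (Cmod c * (1 + e * Im z) <= Cmod c * exp (e * Im z)) by (apply Rmult_le_compat_l; lra). lra. }
    pose proof (Cmod_le_add c (h z)) as Y. rewrite Cmod_minus_sym in Y.
    replace (2 / Cmod c) with (/ (Cmod c / 2)) by (field; lra).
    apply Rinv_le_contravar; lra.
Qed.

(** * The differential equation *)

Lemma Cmod_pow_m1 (j : nat) : Cmod ((- (1)) ^ j)%C = 1.
Proof. rewrite Cmod_pow, Cmod_m1, pow1. auto. Qed.

Lemma pow_m1_sqr (j : nat) : ((- (1)) ^ j * (- (1)) ^ j = 1)%C.
Proof.
  rewrite <- Cpow_mult_l. replace (- (1) * - (1))%C with (RtoC 1) by ring. apply Cpow_1_l.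
Qed.

(** The Laplace relation read backwards, since coefficient j of an MLDE belongs to the derivative of
    order n - j. The power of Delta is common to all terms; the scalar [kap] is there for the later
    normalisation to a monic equation. *)
Lemma reduced_minors_solve (k : R) (n : nat) (F : nat -> C -> C) (L : R) (kap : C) (i : nat) :
  (i < n)%nat ->
  solves_MLDE k n (fun j z => kap * ((- (1)) ^ (n - j) * reduced_minor k n F L (n - j) z))%C (F i).
Proof.
  intros Hi z Hz.
  pose proof (LinAlg.minor_relation (fun i j => Dk_iter k j (F i) z) Hi) as E.
  rewrite sumC_rev in E.
  rewrite (sumC_ext _ _ (fun j => kap * Cexp (- RtoC L * logDelta z) *
    ((- (1)) ^ (S n - 1 - j) * LinAlg.minor n (fun i j => Dk_iter k j (F i) z) (S n - 1 - j)
       * Dk_iter k (S n - 1 - j) (F i) z))%C).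
  - rewrite sumC_scal, E. ring.
  - intros j Hj. replace (S n - 1 - j)%nat with (n - j)%nat by lia.
    unfold reduced_minor, wronskian_minor. ring.
Qed.

(** The coefficients of a monic equation have no poles, so solutions are determined by their
    initial values. *)
Lemma monic_wronskian_nonvanishing (k : R) (n : nat) (F : nat -> C -> C) (g : nat -> C -> C) (z0 z1 : C) :
  iterates_differentiable k n F -> is_monic_MLDE n g ->
  (forall i, (i < n)%nat -> solves_MLDE k n g (F i)) ->
  upper z0 -> upper z1 -> wronskian_minor k n F n z0 = 0 -> wronskian_minor k n F n z1 = 0.
Proof.
  intros HD [[Hg _] Hg0] Hsol H0 H1 HW. unfold wronskian_minor in *.
  rewrite LinAlg.minor_last in *.
  (* A zero of the Wronskian at [z0] gives a combination of the F i whose Serre derivatives of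
     orders 0 to n - 1 all vanish there. Uniqueness carries this to [z1] with the same
     coefficients. *)
  destruct (LinAlg.det_0_kernel HW) as [c [Hc Hker]].
  apply (LinAlg.kernel_det_0 Hc).
  assert (HE : exists KE, 0 < KE /\ forall t, 0 <= t <= 1 -> Cmod (E2 (seg z0 z1 t)) <= KE).
  { apply bounded_on_segment; auto. intros z Hz. destruct (E2_tame 1) as [_ [E' [HE' _]]].
    exists (E' z). auto. }
  destruct HE as [KE [HKE BE]].
  assert (HG : forall p, (p <= S n)%nat -> exists KG, 0 < KG /\ forall j t,
    (j < p)%nat -> 0 <= t <= 1 -> Cmod (g j (seg z0 z1 t)) <= KG).
  { induction p as [|p IHp]; intros Hp; [exists 1; split; [lra|lia]|].
    destruct (IHp ltac:(lia)) as [K1 [HK1 B1]].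
    destruct (bounded_on_segment (g p) z0 z1 H0 H1) as [K2 [HK2 B2]].
    { intros z Hz. destruct (Hg p ltac:(lia)) as [Hh _]. destruct (Hh z Hz) as [d Hd].
      exists d. apply is_derive_Cdrv; auto. }
    exists (K1 + K2). split; [lra|]. intros j t Hj Ht. destruct (Nat.eq_dec j p) as [->|Hne].
    - specialize (B2 t Ht). lra.
    - specialize (B1 j t ltac:(lia) Ht). lra. }
  destruct (HG (S n) ltac:(lia)) as [KG [HKG BG]].
  set (Y := fun j z => sumC n (fun i => c i * Dk_iter k j (F i) z)%C).
  set (Y' := fun j z => sumC n (fun i => c i * C_derive (Dk_iter k j (F i)) z)%C).
  assert (HY : forall j z, upper z -> Cdrv (Y j) z (Y' j z)).
  { intros j z Hz. apply (Cdrv_sumC n c (fun i => Dk_iter k j (F i)) (fun i => C_derive (Dk_iter k j (F i)))).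
    intros i Hi. apply HD; auto. }
  (* The Serre derivative solved for the ordinary one: Y' j is linear in Y (S j) and Y j. *)
  assert (HY' : forall j z, upper z ->
    Y' j z = (RtoC (2 * PI) * Ci * (Y (S j) z + RtoC ((k + 2 * INR j) / 12) * (E2 z * Y j z)))%C).
  { intros j z Hz.
    assert (X : Dk (k + 2 * INR j) (Y j) z = Y (S j) z).
    { apply (Dk_sumC _ n c (fun i => Dk_iter k j (F i)) (fun i => C_derive (Dk_iter k j (F i)))).
      intros i Hi. apply HD; auto. }
    rewrite (Dk_Cdrv _ (Y j) z _ (HY j z Hz)) in X. rewrite <- X. field.
    split; [apply Ci_neq_0|]. apply RtoC_neq_0. pose proof PI_RGT_0; lra. }
  (* This closes the first-order system: with leading coefficient 1, Y n is a combination of the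
     lower Y j with coefficients bounded on the segment. *)
  assert (Hlin : forall z, upper z -> (Y n z + sumC n (fun j => g (S j) z * Y (n - S j)%nat z) = 0)%C).
  { intros z Hz.
    assert (X : sumC (S n) (fun j => g j z * Y (n - j)%nat z)%C = 0).
    { rewrite (sumC_ext _ _ (fun j => sumC n (fun i => c i * (g j z * Dk_iter k (n - j) (F i) z)))%C).
      - rewrite sumC_exchange. rewrite (sumC_ext n _ (fun _ => 0 * 0)%C).
        + rewrite sumC_scal. ring.
        + intros i Hi. rewrite sumC_scal. rewrite (Hsol i Hi z Hz). ring.
      - intros j Hj. unfold Y. rewrite <- sumC_scal. apply sumC_ext. intros. ring. }
    rewrite sumC_shift, Hg0, Nat.sub_0_r in X by auto. rewrite <- X. ring. }
  set (ck := (Rabs k + 2 * INR n) / 12).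
  assert (Hck : 0 <= ck) by (unfold ck; pose proof (Rabs_pos k); pose proof (pos_INR n); lra).
  pose proof PI_RGT_0 as HP.
  set (beta := 2 * PI * (1 + KG + ck * KE)).
  assert (Hbeta : 0 <= beta).
  { unfold beta. apply Rmult_le_pos; [lra|]. assert (0 <= ck * KE) by (apply Rmult_le_pos; lra). lra. }
  apply (linear_ode_zero n Y Y' z0 z1 beta); auto.
  intros j t Hj Ht. assert (Hz : upper (seg z0 z1 t)) by (apply upper_segment; auto).
  set (z := seg z0 z1 t) in *. set (Sig := sumR n (fun l => Cmod (Y l z))).
  assert (HS : forall p l, (l < p)%nat -> Cmod (Y l z) <= sumR p (fun l => Cmod (Y l z))).
  { induction p; intros l Hl; [lia|]. rewrite sumR_S.
    assert (0 <= sumR p (fun l => Cmod (Y l z))) by (apply sumR_nonneg; intros; apply Cmod_ge_0).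
    destruct (Nat.eq_dec l p) as [->|Hne]; [lra|].
    pose proof (IHp l ltac:(lia)). pose proof (Cmod_ge_0 (Y p z)). lra. }
  assert (HSig : 0 <= Sig) by (apply sumR_nonneg; intros; apply Cmod_ge_0).
  assert (HYn : Cmod (Y (S j) z) <= (1 + KG) * Sig).
  { destruct (Nat.eq_dec (S j) n) as [E|Hne].
    - rewrite E. assert (X : Y n z = (- sumC n (fun j => g (S j) z * Y (n - S j)%nat z))%C).
      { replace (Y n z) with ((Y n z + sumC n (fun j => g (S j) z * Y (n - S j)%nat z))
          - sumC n (fun j => g (S j) z * Y (n - S j)%nat z))%C by ring. rewrite Hlin by auto. ring. }
      rewrite X, Cmod_opp. eapply Rle_trans; [apply Cmod_sumC|].
      assert (Hb : sumR n (fun j => Cmod (g (S j) z * Y (n - S j)%nat z)%C) <= KG * Sig).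
      { apply Rle_trans with (sumR n (fun j => KG * Cmod (Y (n - S j)%nat z))).
        - apply sumR_le. intros i Hi. rewrite Cmod_mult. apply Rmult_le_compat_r; [apply Cmod_ge_0|].
          apply BG; auto. lia.
        - apply Req_le. unfold Sig.
          assert (ER : forall p (f : nat -> R), sumR p (fun i => f (p - S i)%nat) = sumR p f).
          { intros p f. apply RtoC_inj. rewrite !RtoC_sumR. rewrite (sumC_rev p (fun i => RtoC (f i))).
            apply sumC_ext. intros i Hi. do 2 f_equal. lia. }
          assert (ES : forall p (f : nat -> R), sumR p (fun i => KG * f i) = KG * sumR p f).
          { intros p f. induction p; [unfold sumR; simpl; ring|]. rewrite !sumR_S, IHp. ring. }
          rewrite (ES n (fun j => Cmod (Y (n - S j)%nat z))).
          rewrite (ER n (fun l => Cmod (Y l z))). auto. }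
      lra.
    - pose proof (HS n (S j) ltac:(lia)) as X. fold Sig in X.
      assert (0 <= KG * Sig) by (apply Rmult_le_pos; lra). lra. }
  pose proof (HS n j Hj) as HYj. fold Sig in HYj.
  rewrite HY' by auto. rewrite !Cmod_mult, Cmod_Ci, Cmod_R, Rabs_pos_eq, Rmult_1_r by lra.
  unfold beta. rewrite (Rmult_assoc (2 * PI) _ Sig). apply Rmult_le_compat_l; [lra|].
  eapply Rle_trans; [apply Cmod_triangle|]. rewrite !Cmod_mult, Cmod_R.
  assert (Hcj : Rabs ((k + 2 * INR j) / 12) <= ck).
  { unfold ck, Rdiv. rewrite Rabs_mult, (Rabs_pos_eq (/ 12)) by lra. apply Rmult_le_compat_r; [lra|].
    eapply Rle_trans; [apply Rabs_triang|]. rewrite (Rabs_pos_eq (2 * INR j)) by (pose proof (pos_INR j); lra).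
    pose proof (le_INR j n ltac:(lia)). lra. }
  assert (X : Rabs ((k + 2 * INR j) / 12) * (Cmod (E2 z) * Cmod (Y j z)) <= ck * (KE * Sig)).
  { apply Rmult_le_compat; auto; [apply Rabs_pos|apply Rmult_le_pos; apply Cmod_ge_0|].
    apply Rmult_le_compat; auto; try apply Cmod_ge_0. apply BE; auto. }
  lra.
Qed.

(** * The slash action of the generators *)

Lemma cpow_one (s : R) : cpow 1 s = 1.
Proof.
  unfold cpow. destruct (Ceq_dec 1 0) as [E|_].
  - apply RtoC_inj in E. lra.
  - rewrite Cmod_1. unfold Carg. simpl. destruct (Rlt_dec 0 1); [|lra].
    unfold Rdiv. rewrite Rmult_0_l, atan_0, Rmult_0_r. unfold Rpower. rewrite ln_1, Rmult_0_r, exp_0.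
    change (0%R, 0%R) with (RtoC 0). rewrite Cexp_0. ring.
Qed.

Definition SL2_S : SL2 := mkSL2 0 (-1) 1 0 eq_refl.
Definition SL2_T : SL2 := mkSL2 1 1 0 1 eq_refl.

Lemma slash_S (k : R) (f : C -> C) (z : C) : upper z ->
  slash k f SL2_S z = (/ Cexp (k * Clog z) * f (- / z))%C.
Proof.
  intros Hz. pose proof (upper_neq_0 z Hz) as Hz0. unfold slash, mob, jfac. simpl.
  replace (1 * z + 0)%C with z by ring. rewrite cpow_Cexp by auto.
  rewrite RtoC_opp. replace (- RtoC k * Clog z)%C with (- (k * Clog z))%C by ring.
  rewrite Cexp_opp. do 2 f_equal.
  replace (RtoC (-1)) with (- (1))%C by (rewrite <- RtoC_opp; auto). field. auto.
Qed.

Lemma slash_T (k : R) (f : C -> C) (z : C) : slash k f SL2_T z = f (z + 1)%C.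
Proof.
  unfold slash, mob, jfac. simpl. replace (0 * z + 1)%C with (RtoC 1) by ring.
  rewrite cpow_one. replace ((1 * z + 1) / 1)%C with (z + 1)%C by (field; apply RtoC_neq_0; lra). ring.
Qed.

Theorem theorem2p4 (k : R) (v : SL2 -> C) (n : nat)
  (Rep : SL2 -> nat -> nat -> C) (F : nat -> C -> C)
  (m : R) (lam : nat -> R) (a : nat -> nat -> C) :
  multiplier_system k v ->
  representation n Rep ->
  weakly_holo_vvmf k v n Rep F ->
  0 < m ->
  (forall i, (i < n)%nat -> a i 0%nat <> RtoC 0) ->
  (forall i z, (i < n)%nat -> upper z ->
     exists S, @is_series C_AbsRing C_NormedModule
                 (fun t => Cmult (a i t) (qpow (m * INR t) z)) S /\
               F i z = Cmult (qpow (lam i) z) S) ->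
  (forall i j, (i < n)%nat -> (j < n)%nat -> i <> j -> lam i <> lam j) ->
  (INR n * (k + INR n - 1) >= 12 * sumR n lam) /\
  (exists (l : nat) (g : nat -> C -> C),
     is_MLDE n l g /\ forall i, (i < n)%nat -> solves_MLDE k n g (F i)) /\
  (INR n * (k + INR n - 1) = 12 * sumR n lam <->
   exists g : nat -> C -> C,
     is_monic_MLDE n g /\ forall i, (i < n)%nat -> solves_MLDE k n g (F i)).
Proof.
  intros _ _ [_ [Hslash _]] Hm Ha HF Hlam.
  set (L := sumR n lam). set (s := INR n * (k + INR n - 1) - 12 * L).
  assert (Hdisc : forall i, (i < n)%nat -> disc_coef (a i)).
  { intros i Hi. apply (qseries_disc_coef m); auto. intros z Hz.
    destruct (HF i z Hi Hz) as [S [HS _]]. exists S. apply is_series_Cser, HS. }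
  assert (HFq : forall i z, (i < n)%nat -> upper z -> F i z = (qpow (lam i) z * qser m (a i) z)%C).
  { intros i z Hi Hz. destruct (HF i z Hi Hz) as [S [HS ->]]. f_equal.
    apply is_series_Cser in HS. apply (Cser_unique _ _ _ HS). apply qser_Cser; auto. }
  assert (HGt : forall i, (i < n)%nat -> tame_all (a i O) (qser m (a i))).
  { intros i Hi p. apply qser_tame; auto. }
  assert (HD : iterates_differentiable k n F).
  { intros i j Hi. apply (Dk_iter_dH k (lam i) (a i O) (F i) (qser m (a i))); auto. }
  assert (HSF : forall i z, (i < n)%nat -> upper z ->
     F i (- / z)%C = (Cexp (k * Clog z) * sumC n (fun l => v SL2_S * Rep SL2_S i l * F l z))%C).
  { intros i z Hi Hz. pose proof (Hslash SL2_S i z Hi Hz) as E. rewrite slash_S in E by auto.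
    rewrite (sumC_ext n _ (fun l => v SL2_S * (Rep SL2_S i l * F l z))%C) by (intros; ring).
    rewrite sumC_scal, <- E. field. apply Cexp_neq_0. }
  assert (HTF : forall i z, (i < n)%nat -> upper z ->
     F i (z + 1)%C = sumC n (fun l => v SL2_T * Rep SL2_T i l * F l z)%C).
  { intros i z Hi Hz. pose proof (Hslash SL2_T i z Hi Hz) as E. rewrite slash_T in E by auto.
    rewrite E, <- sumC_scal. apply sumC_ext. intros; ring. }
  set (h := reduced_minor k n F L).
  pose proof (fun J => reduced_minor_tame k n F (fun i => qser m (a i)) lam (fun i => a i O) J HFq HGt) as Ht.
  fold L in Ht. fold h in Ht.
  set (d := fun J => LinAlg.minor n (fun i j =>
    a i O * prodC j (fun l => RtoC (lam i) - RtoC ((k + 2 * INR l) / 12)%R))%C J) in Ht.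
  (* The limit of the reduced Wronskian is the product of the a_i0 times a Newton-Vandermonde
     determinant in the exponents, nonzero because these are distinct. *)
  assert (Hd : d n <> 0).
  { unfold d. rewrite LinAlg.minor_last, LinAlg.det_scale_row. apply Cmult_neq_0.
    - assert (X : forall p, (p <= n)%nat -> prodC p (fun i => a i O) <> 0).
      { induction p; intros Hp; simpl.
        - apply RtoC_neq_0; lra.
        - apply Cmult_neq_0; [apply IHp; lia|apply Ha; lia]. }
      apply X; auto.
    - apply LinAlg.newton_vandermonde_neq_0. intros i j Hi Hj Hij E.
      apply RtoC_inj in E. apply (Hlam i j); auto. }
  pose proof (reduced_minor_S k n F _ L HD HSF) as HS. fold h s in HS.
  pose proof (reduced_minor_T k n F _ L HD HTF) as HT. fold h in HT.
  set (mu := (LinAlg.det n (fun i l => v SL2_S * Rep SL2_S i l) * Cexp (RtoC L * (6 * PI * Ci)))%C) in HS.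
  set (muT := (LinAlg.det n (fun i l => v SL2_T * Rep SL2_T i l) * Cexp (- RtoC L * (RtoC (2 * PI) * Ci)))%C) in HT.
  (* The multiplier at T is common to all minors, so the nonzero limit of the n-th one settles it
     for every J. *)
  assert (HmuT : muT = 1) by (apply (cusp_multiplier (h n) (d n) muT (tame_decay 0 _ _ (Ht n O)) Hd (HT n))).
  assert (HT1 : forall J z, upper z -> h J (z + 1)%C = h J z).
  { intros J z Hz. rewrite HT, HmuT by auto. ring. }
  assert (Hex : exists z, upper z /\ h n z <> 0).
  { apply NNPP. intros N. apply Hd, (decay_zero _ (h n) (tame_decay 0 _ _ (Ht n O))).
    intros z Hz. apply NNPP. intros Hz'. apply N. exists z. auto. }
  destruct Hex as [zn [Hzn Hhzn]].
  assert (HSn : forall z, upper z -> h n (- / z)%C = (mu * Cexp (s * Clog z) * h n z)%C).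
  { intros z Hz. rewrite HS, Nat.sub_diag by auto. simpl (INR 0). rewrite Rmult_0_r, Rplus_0_r. auto. }
  destruct (trivial_multiplier (h n) mu s zn Hzn Hhzn (HT1 n) HSn) as [Hmu [N HN]].
  assert (HSn1 : forall z, upper z -> h n (- / z)%C = (Cexp (s * Clog z) * h n z)%C).
  { intros z Hz. rewrite HSn, Hmu by auto. ring. }
  assert (Hs : 0 <= s) by (apply (weight_nonneg (h n) (d n) s (Ht n) Hd (HT1 n) HSn1)).
  set (l := Z.to_nat (2 * N)).
  assert (Hl : s = INR l).
  { unfold l. rewrite INR_IZR_INZ, Z2Nat.id, mult_IZR; auto.
    apply le_IZR. rewrite mult_IZR. lra. }
  assert (HSJ : forall J z, (J <= n)%nat -> upper z -> h J (- / z)%C = (z ^ (l + 2 * (n - J)) * h J z)%C).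
  { intros J z HJ Hz. rewrite HS, Hmu, Hl by auto.
    rewrite <- (Cpow_Clog (l + 2 * (n - J))), plus_INR, mult_INR by auto.
    replace (INR 2) with 2 by (simpl; ring). ring. }
  (* Coefficient i is the minor without column n - i, of weight l + 2 i, with the sign of its place
     in the Laplace expansion. *)
  assert (Hmod : forall kap i, (i <= n)%nat ->
     modular_form (l + 2 * i) (fun z => kap * ((- (1)) ^ (n - i) * h (n - i)%nat z))%C).
  { intros kap i Hi. destruct (tame_all_deriv _ _ (Ht (n - i)%nat)) as [Dh _]. repeat split.
    - intros z Hz. eexists. apply Cdrv_is_derive. apply Cdrv_scal, Cdrv_scal, Dh, Hz.
    - intros A z Hz.
      apply (modular_generators (l + 2 * i) (fun z => kap * ((- (1)) ^ (n - i) * h (n - i)%nat z))%C);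
        auto; clear z Hz; intros z Hz.
      + rewrite HT1; auto.
      + rewrite HSJ by (lia || auto). replace (n - (n - i))%nat with i by lia. ring.
    - destruct (decay_bounded _ _ (tame_decay 0 _ _ (Ht (n - i)%nat O))) as [K HK].
      exists (Cmod kap * K), 1. intros z Hz. rewrite !Cmod_mult, Cmod_pow_m1, Rmult_1_l.
      apply Rmult_le_compat_l; [apply Cmod_ge_0|]. apply HK. lra. }
  assert (Hsgn : ((- (1)) ^ n)%C <> 0) by (apply Cmod_gt_0; rewrite Cmod_pow_m1; lra).
  split; [|split].
  - unfold s in Hs. fold L. lra.
  - exists l, (fun i z => 1 * ((- (1)) ^ (n - i) * h (n - i)%nat z))%C. split; [split|].
    + intros i Hi. apply Hmod; auto.
    + exists zn. split; auto. rewrite Nat.sub_0_r, Cmult_1_l. apply Cmult_neq_0; auto.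
    + intros i Hi. apply reduced_minors_solve; auto.
  - fold L. split.
    + intros E. assert (Hs0 : s = 0) by (unfold s; lra).
      assert (Hc : forall z, upper z -> h n z = d n).
      { apply weight_0_constant; auto. intros z Hz. rewrite HSn1, Hs0, Cmult_0_l, Cexp_0 by auto. ring. }
      assert (Hl0 : l = O) by (apply INR_eq; rewrite <- Hl; auto).
      (* [d n] is the constant value of [h n], and (-1)^n is its own inverse, so this factor makes
         the leading coefficient 1. *)
      set (kap := ((- (1)) ^ n / d n)%C).
      assert (Hg0 : forall z, upper z -> (kap * ((- (1)) ^ (n - 0) * h (n - 0)%nat z))%C = 1).
      { intros z Hz. rewrite Nat.sub_0_r, Hc by auto. unfold kap.
        transitivity ((- (1)) ^ n * (- (1)) ^ n)%C; [field; auto|apply pow_m1_sqr]. }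
      exists (fun i z => kap * ((- (1)) ^ (n - i) * h (n - i)%nat z))%C. split; [split; [split|]|].
      * intros i Hi. pose proof (Hmod kap i Hi) as X. rewrite Hl0 in X. exact X.
      * exists zn. split; auto. rewrite Hg0 by auto. apply RtoC_neq_0; lra.
      * exact Hg0.
      * intros i Hi. apply reduced_minors_solve; auto.
    + intros [g [Hg Hsol]].
      (* A zero of the Wronskian anywhere would propagate to [zn], where it is known not to
         vanish. *)
      assert (Hnv : forall z, upper z -> h n z <> 0).
      { intros z Hz E. apply Hhzn. unfold h, reduced_minor in *.
        assert (W0 : wronskian_minor k n F n z = 0).
        { apply NNPP. intros W. revert E. apply Cmult_neq_0; auto. apply Cexp_neq_0. }
        rewrite (monic_wronskian_nonvanishing k n F g z zn HD Hg Hsol Hz Hzn W0). ring. }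
      pose proof (weight_nonpos_of_nonvanishing (h n) (d n) s (Ht n) Hd Hnv (HT1 n) HSn1).
      unfold s in *. lra.
Qed.
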